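(* There exists a GSF-local property $\mathcal{P}\subseteq\mathcal{C}_3$ of graphs of maximum degree at most $3$ that is not testable in the bounded-degree graph model. Consequently, not all GSF-local properties are non-propagating.
   Context: $\mathcal{C}_d$ is the class of finite simple undirected graphs of maximum degree at most $d$; a property is an isomorphism-closed subset $\mathcal{P}=\bigcup_n\mathcal{P}_n$ of $\mathcal{C}_d$, $\mathcal{P}_n$ its $n$-vertex members. A graph on $n$ vertices is $\epsilon$-close to $\mathcal{P}$ if at most $\epsilon dn$ edge insertions/deletions turn it into a member of $\mathcal{P}_n$, and $\epsilon$-far otherwise. Testing: an algorithm gets $n$ and can query $(v,i)$, $i\le d$, receiving the $i$-th neighbour of $v$ (or a special symbol); an $\epsilon$-tester accepts members of $\mathcal{P}_n$ with probability $\ge2/3$ and rejects graphs $\epsilon$-far from $\mathcal{P}_n$ with probability $\ge2/3$; $\mathcal{P}$ is testable if for all $n,\epsilon$ there is such a tester with at most $q(\epsilon,d)$ queries, independent of $n$. For a vertex $v$ of $G$, $N_1^G(v)$ is the set consisting of $v$ and its neighbours. A marked graph is a graph each of whose vertices is marked 'full', 'semifull' or 'partial'. An embedding of a marked graph $F$ into a graph $G$ is an injective map $f:V(F)\to V(G)$ such that for every $v\in V(F)$: if $v$ is full then $N_1^G(f(v))=f(N_1^F(v))$; if $v$ is semifull then $N_1^G(f(v))\cap f(V(F))=f(N_1^F(v))$; if $v$ is partial then $N_1^G(f(v))\supseteq f(N_1^F(v))$. $G$ is $F$-free if no embedding of $F$ into $G$ exists, and $\mathcal{F}$-free for a set $\mathcal{F}$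 if it is $F$-free for all $F\in\mathcal{F}$. For a sequence $\overline{\mathcal{F}}=(\mathcal{F}_n)_{n\in\mathbb{N}}$ of sets of marked graphs, $\mathcal{P}$ is $\overline{\mathcal{F}}$-local if there is $s$ such that for every $n$ every graph in $\mathcal{F}_n$ has at most $s$ vertices and $\mathcal{P}_n$ equals the set of $n$-vertex graphs that are $\mathcal{F}_n$-free; $\mathcal{P}$ is GSF-local if it is $\overline{\mathcal{F}}$-local for some such sequence. A set $B\subseteq V(G)$ covers $\mathcal{F}_n$ in $G$ if every embedding of every $F\in\mathcal{F}_n$ into $G$ maps at least one vertex into $B$. $\overline{\mathcal{F}}$ is non-propagating if there is a monotonically non-decreasing $\tau:(0,1]\to(0,1]$ such that (1) for every $\epsilon>0$ there is $\beta>0$ with $\tau(\beta)<\epsilon$, and (2) for every graph $G$ on $n$ vertices and every $B\subseteq V(G)$ covering $\mathcal{F}_n$ in $G$, either $G$ is $\tau(|B|/n)$-close to being $\mathcal{F}_n$-free or there is no $n$-vertex $\mathcal{F}_n$-free graph. A GSF-local property is non-propagating if it is $\overline{\mathcal{F}}$-local for some non-propagating $\overline{\mathcal{F}}$. *)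

(* Defs.v *)
From mathcomp Require Import all_boot all_order all_algebra.
From mathcomp Require Import reals.

Set Implicit Arguments.
Unset Strict Implicit.
Unset Printing Implicit Defensive.

Import Order.TTheory GRing.Theory Num.Theory.
Local Open Scope ring_scope.

(* Simple undirected graphs on the vertex set {0, ..., n-1}. *)
Record sgraph (n : nat) := SGraph {
  edge :> rel 'I_n;
  edge_sym : symmetric edge;
  edge_irr : irreflexive edge }.

Definition nbhd n (G : sgraph n) (v : 'I_n) : {set 'I_n} := [set u | G v u].

(* N_1^G(v) *)
Definition nbhd1 n (G : sgraph n) (v : 'I_n) : {set 'I_n} := v |: nbhd G v.

(* Membership in C_d. *)
Definition max_degree_le (d n : nat) (G : sgraph n) : Prop :=
  forall v, (#|nbhd G v| <= d)%N.

Definition isomorphic n (G H : sgraph n) : Prop :=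
  exists2 f : 'I_n -> 'I_n, bijective f & forall u v, G u v = H (f u) (f v).

Record property (d : nat) := Property {
  mem_property :> forall n, sgraph n -> Prop;
  property_degree : forall n (G : sgraph n),
    mem_property G -> max_degree_le d G;
  property_iso : forall n (G H : sgraph n),
    isomorphic G H -> mem_property G -> mem_property H }.

(* Least number of edge insertions and deletions turning G into H. *)
Definition edit_distance n (G H : sgraph n) : nat :=
  #|[set p : 'I_n * 'I_n | (p.1 < p.2)%N && (G p.1 p.2 != H p.1 p.2)]|.

Definition close_to (R : realType) (d : nat) (eps : R) n (G : sgraph n)
    (Q : sgraph n -> Prop) : Prop :=
  exists2 H : sgraph n, Q H & (edit_distance G H)%:R <= eps * d%:R * n%:R.

Definition far_from (R : realType) (d : nat) (eps : R) n (G : sgraph n)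
    (Q : sgraph n -> Prop) : Prop :=
  ~ close_to d eps G Q.

(* Oracle access to a graph: [nb v] lists the neighbours of v in an arbitrary
   order; the answer to a query (v, i) is the i-th entry of [nb v], counting
   from 0, or [None] (the special symbol) if v has at most i neighbours. *)
Definition oracle (n : nat) := 'I_n -> seq 'I_n.

Definition represents n (nb : oracle n) (G : sgraph n) : Prop :=
  forall v, perm_eq (nb v) (enum (nbhd G v)).

Inductive query_alg (n d : nat) : Type :=
| Answer of bool
| Query (v : 'I_n) (i : 'I_d) of (option 'I_n -> query_alg n d).

Fixpoint accepts n d (A : query_alg n d) (nb : oracle n) : bool :=
  match A with
  | Answer b => b
  | Query v i k => accepts (k (onth (nb v) i)) nb
  end.

Fixpoint num_queries n d (A : query_alg n d) (nb : oracle n) : nat :=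
  match A with
  | Answer _ => 0%N
  | Query v i k => (num_queries (k (onth (nb v) i)) nb).+1
  end.

(* A randomized algorithm is a probability distribution over deterministic
   ones. A finite sample space loses no generality: for given n, d and q there
   are finitely many behaviours of deterministic algorithms making at most q
   queries. *)
Record rand_alg (R : realType) (n d : nat) := RandAlg {
  sample : finType;
  prob : sample -> R;
  prob_ge0 : forall w, 0 <= prob w;
  prob_sum1 : \sum_w prob w = 1;
  alg : sample -> query_alg n d }.

Definition accept_prob (R : realType) n d (T : rand_alg R n d) (nb : oracle n)
  : R := \sum_(w : sample T | accepts (alg w) nb) prob w.

Definition reject_prob (R : realType) n d (T : rand_alg R n d) (nb : oracle n)
  : R := \sum_(w : sample T | ~~ accepts (alg w) nb) prob w.

Definition is_tester (R : realType) (d : nat) (P : property d) (n : nat)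
    (eps : R) (T : rand_alg R n d) : Prop :=
  (forall (G : sgraph n) nb, represents nb G ->
     P n G -> 2 / 3 <= accept_prob T nb) /\
  (forall (G : sgraph n) nb, represents nb G -> max_degree_le d G ->
     far_from d eps G (P n) -> 2 / 3 <= reject_prob T nb).

Definition query_bound (R : realType) n d (T : rand_alg R n d) (q : nat)
  : Prop :=
  forall (w : sample T) (G : sgraph n) nb, represents nb G ->
    max_degree_le d G -> (num_queries (alg w) nb <= q)%N.

Definition testable (R : realType) (d : nat) (P : property d) : Prop :=
  exists q : R -> nat, forall (n : nat) (eps : R), 0 < eps ->
    exists T : rand_alg R n d, is_tester P eps T /\ query_bound T (q eps).

Inductive marking := Full | Semifull | Partial.

Record marked_graph := MarkedGraph {
  msize : nat;
  underlying :> sgraph msize;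
  mark : 'I_msize -> marking }.

Definition embedding (F : marked_graph) n (G : sgraph n)
    (f : 'I_(msize F) -> 'I_n) : Prop :=
  injective f /\
  forall v, match mark v with
    | Full => nbhd1 G (f v) = f @: nbhd1 F v
    | Semifull => nbhd1 G (f v) :&: f @: [set: 'I_(msize F)] = f @: nbhd1 F v
    | Partial => f @: nbhd1 F v \subset nbhd1 G (f v)
    end.

Definition F_free (Fs : marked_graph -> Prop) n (G : sgraph n) : Prop :=
  forall F, Fs F -> ~ exists f, embedding (F := F) G f.

Definition bounded_free (d : nat) (Fs : marked_graph -> Prop) n (G : sgraph n)
  : Prop := max_degree_le d G /\ F_free Fs G.

Definition family := nat -> marked_graph -> Prop.

Definition is_local (Fs : family) (d : nat) (P : property d) : Prop :=
  exists s : nat, forall n : nat,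
    (forall F, Fs n F -> (msize F <= s)%N) /\
    (forall G : sgraph n, P n G <-> bounded_free d (Fs n) G).

Definition GSF_local (d : nat) (P : property d) : Prop :=
  exists Fs : family, is_local Fs P.

Definition covers n (B : {set 'I_n}) (Fs : marked_graph -> Prop)
    (G : sgraph n) : Prop :=
  forall F, Fs F -> forall f, embedding (F := F) G f -> exists v, f v \in B.

(* |B|/n lies in the domain (0, 1] of tau exactly when B is nonempty; the empty
   set covers Fs in G only if G is already Fs-free. *)
Lemma covers_set0 n (Fs : marked_graph -> Prop) (G : sgraph n) :
  covers set0 Fs G -> F_free Fs G.
Proof. by move=> cov F FsF [f /(cov F FsF)[v]]; rewrite inE. Qed.

Definition non_propagating_family (R : realType) (d : nat) (Fs : family)
  : Prop :=
  exists tau : R -> R,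
    [/\ forall x, 0 < x <= 1 -> 0 < tau x <= 1,
        forall x y, 0 < x -> x <= y -> y <= 1 -> tau x <= tau y,
        forall eps, 0 < eps -> exists2 beta, 0 < beta <= 1 & tau beta < eps
      & forall n (G : sgraph n) (B : {set 'I_n}),
          max_degree_le d G -> B != set0 -> covers B (Fs n) G ->
          close_to d (tau (#|B|%:R / n%:R)) G (@bounded_free d (Fs n) n) \/
          ~ exists H : sgraph n, bounded_free d (Fs n) H].

Definition non_propagating (R : realType) (d : nat) (P : property d) : Prop :=
  exists2 Fs : family, is_local Fs P & non_propagating_family R d Fs.

(* Main.v *)
Require Import Defs.
From mathcomp Require Import all_boot all_order all_algebra.
From mathcomp Require Import all_fingroup all_solvable all_field.
From mathcomp Require Import boolp reals ring lra zify.

Set Implicit Arguments.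
Unset Strict Implicit.
Unset Printing Implicit Defensive.

Import Order.TTheory GRing.Theory Num.Theory.

(** Non-testability is obtained from a rigidity phenomenon (a relative property
    (T)) for the finitely presented group [gamma] generated by a translation
    [a], two dilations [D] and [T], a swap [s] and a shear [E] of the plane over
    a field of characteristic 2.  The conjugates of [a] generate a normal
    elementary abelian 2-subgroup; that they all commute follows from finitely
    many relations by a trick of Baumslag.

    A finite gamma-set is encoded as a graph of maximum degree 3, each point
    becoming a path with ten ports.  The property consists of the graphs whose
    balls of a fixed radius all occur in encodings with the same number of
    vertices; its members are then themselves made of gamma-sets.

    Let [K] be a field with [2^k] elements.  If a gamma-set [X] with fewer than
    [4^k] points agreed with [K^2] up to a small fraction of defects, the graph
    of the partial bijection would be an almost invariant subset of [X * K^2];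
    the Fourier transform along the abelian subgroup turns it into a measure on
    characters which is almost invariant under [D], [E] and [s], and comparing
    the valuations of the two components of a character shows that this measure
    is concentrated at the trivial character, which forces an orbit of [X] to
    have at least [4^k] points.  So the encoding of [K^2] with [4^j] points
    removed is far from the property.  Disjoint copies of the plane over the
    field with [2^j] elements have the same number of points and are in the
    property, and around almost all points both graphs look the same, so that
    boundedly many queries cannot tell them apart and the few exceptional
    vertices cover all forbidden configurations. *)

(** * The group gamma *)

Section GammaGroup.
Local Open Scope group_scope.

(** Two obstacles shape the construction. Both graphs need the same number of vertices, while
    rigidity only concerns sets smaller than the plane: deleting 4^j of 4^k points leaves (4^(k-j) -
    1) 4^j points, which whole copies of the small plane fill exactly, and the deleted fraction
    vanishes as k grows with j fixed. Balls must look the same although the fields differ: short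
    words have only finitely many possible coincidence patterns, so by pigeonhole arbitrarily large
    fields share one, and it never has to be computed. For the measure on characters, let U, V, W be
    the characters whose first component has smaller, equal, larger valuation than the second.
    Dilating the first coordinate moves U and V into U up to a boundary term, so V has little mass;
    the shear moves W into V and the swap moves U into W, so the nontrivial characters together have
    little mass. *)

Definition gen := 'I_5.
Definition ga : gen := @Ordinal 5 0 isT.
Definition gd : gen := @Ordinal 5 1 isT.
Definition gt : gen := @Ordinal 5 2 isT.
Definition gs : gen := @Ordinal 5 3 isT.
Definition ge : gen := @Ordinal 5 4 isT.

Definition letter : Type := (gen * bool)%type.
Definition word := seq letter.

Section Words.
Variable gT : finGroupType.
Definition lval (g : gen -> gT) (l : letter) : gT :=
  if l.2 then (g l.1)^-1 else g l.1.
Definition wval (g : gen -> gT) (w : word) : gT :=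
  foldr (fun l p => lval g l * p) 1 w.
End Words.

Definition pos_letter (i : gen) : letter := (i, false).
Definition neg_letter (i : gen) : letter := (i, true).
Local Notation "+: i" := (pos_letter i) (at level 2, i at level 1).
Local Notation "-: i" := (neg_letter i) (at level 2, i at level 1).

(** The first four relators present Baumslag's group in characteristic 2. The next four adjoin the
    swap and make the two coordinates commute, and the last three make [E] a shear that commutes
    with the scalar dilation [D * D ^ s]. No side has more than five letters, so a ball of bounded
    radius sees every relator. *)
Definition relators : seq (word * word) :=
  [:: ([:: +: ga; +: ga], [::]);
      ([:: +: gd; +: gt], [:: +: gt; +: gd]);
      ([:: +: ga; -: gd; +: ga; +: gd], [:: -: gd; +: ga; +: gd; +: ga]);
      ([:: -: gt; +: ga; +: gt], [:: +: ga; -: gd; +: ga; +: gd]);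
      ([:: +: gs; +: gs], [::]);
      ([:: +: gd; +: gs; +: gd; +: gs], [:: +: gs; +: gd; +: gs; +: gd]);
      ([:: +: gd; +: gs; +: ga; +: gs], [:: +: gs; +: ga; +: gs; +: gd]);
      ([:: +: ga; +: gs; +: ga; +: gs], [:: +: gs; +: ga; +: gs; +: ga]);
      ([:: -: ge; +: ga; +: ge], [:: +: ga; +: gs; +: ga; +: gs]);
      ([:: -: ge; +: gs; +: ga; +: gs; +: ge], [:: +: gs; +: ga; +: gs]);
      ([:: +: ge; +: gd; +: gs; +: gd; +: gs],
       [:: +: gd; +: gs; +: gd; +: gs; +: ge])].

Definition gamma (gT : finGroupType) (g : gen -> gT) : Prop :=
  forall i, wval g (nth ([::], [::]) relators i).1 =
            wval g (nth ([::], [::]) relators i).2.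

Section GammaTheory.
Variables (gT : finGroupType) (g : gen -> gT).
Hypothesis gg : gamma g.
Local Notation a := (g ga).
Local Notation D := (g gd).
Local Notation T := (g gt).
Local Notation s := (g gs).
Local Notation E := (g ge).

Definition trans1 i := a ^ (D ^+ i).
Definition trans2 i := trans1 i ^ s.
Local Notation A := trans1.
Local Notation B := trans2.

Let raa : a * a = 1.
Proof. by have := gg 0; rewrite /wval /lval /= !mulg1. Qed.
Let rdt : commute D T.
Proof. by have := gg 1%N; rewrite /wval /lval /= !mulg1. Qed.
Let rad : commute a (a ^ D).
Proof. by have := gg 2; rewrite /wval /lval /= !mulg1 /commute /conjg !mulgA. Qed.
Let rat : a ^ T = a * a ^ D.
Proof. by have := gg 3; rewrite /wval /lval /= !mulg1 /conjg !mulgA. Qed.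
Let rss : s * s = 1.
Proof. by have := gg 4; rewrite /wval /lval /= !mulg1. Qed.
Let sV : s^-1 = s.
Proof. by apply/eqP; rewrite eq_invg_mul rss. Qed.
Let rdds : commute D (D ^ s).
Proof. by have := gg 5; rewrite /wval /lval /= !mulg1 /commute /conjg sV !mulgA. Qed.
Let rdas : commute D (a ^ s).
Proof. by have := gg 6; rewrite /wval /lval /= !mulg1 /commute /conjg sV !mulgA. Qed.
Let raas : commute a (a ^ s).
Proof. by have := gg 7; rewrite /wval /lval /= !mulg1 /commute /conjg sV !mulgA. Qed.
Let rae : a ^ E = a * a ^ s.
Proof. by have := gg 8; rewrite /wval /lval /= !mulg1 /conjg sV !mulgA. Qed.
Let rase : (a ^ s) ^ E = a ^ s.
Proof. by have := gg 9; rewrite /wval /lval /= !mulg1 /conjg sV !mulgA. Qed.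
Let rede : commute E (D * D ^ s).
Proof. by have := gg 10; rewrite /wval /lval /= !mulg1 /commute /conjg sV !mulgA. Qed.

Lemma commuteJ (x y z : gT) : commute x y -> commute (x ^ z) (y ^ z).
Proof. by move=> cxy; rewrite /commute -!conjMg cxy. Qed.

Let cJ (x y : gT) : commute x y -> x ^ y = x.
Proof. by move=> c; rewrite conjgE c mulKg. Qed.

Let Jss (x : gT) : (x ^ s) ^ s = x.
Proof. by rewrite -conjgM rss conjg1. Qed.

Lemma trans1_invol i : A i * A i = 1.
Proof. by rewrite -conjMg raa conj1g. Qed.

Lemma trans1_D i : A i ^ D = A i.+1.
Proof. by rewrite -conjgM -expgSr. Qed.

Let A_T i : A i ^ T = A i * A i.+1.
Proof.
rewrite -conjgM -(commuteX i (commute_sym rdt)).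
by rewrite [in LHS]conjgM rat conjMg -conjgM -expgS.
Qed.

Let A_shift i j : A (i + j) = (A i) ^ (D ^+ j).
Proof. by rewrite -conjgM -expgD. Qed.

(** Baumslag's trick: conjugating the commutation of [a] and [A i.+1] by [T] gives that of [a * A 1]
    and [A i.+1 * A i.+2]. Induction and conjugation by [D] settle all pairs of factors except [a]
    and [A i.+2], so this pair commutes as well. *)
Let cA0 i : commute a (A i).
Proof.
have [m] := ubnP i; elim: m i => // m IH [|[|i]] lti.
- by rewrite /A expg0 conjg1.
- by rewrite /A expg1.
have c0 : commute a (A i.+1) by apply: IH; lia.
have c1 : commute (A 1%N) (A i.+1).
  by have /(commuteJ D) : commute a (A i) by [apply: IH; lia];
     rewrite trans1_D.
have c2 : commute (A 1%N) (A i.+2).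
  by have := commuteJ D c0; rewrite trans1_D.
have := commuteJ T c0; rewrite A_T rat -[a ^ D]/(A 1%N) => c3.
have e1 : commute (A 1%N) (A i.+1 * A i.+2) by apply: commuteM.
have e0 : commute a (A i.+1 * A i.+2).
  have : commute ((a * A 1%N) * (A 1%N)^-1) (A i.+1 * A i.+2).
    by apply/commute_sym/commuteM; [exact/commute_sym|apply/commuteV/commute_sym].
  by rewrite mulgK.
have : commute a ((A i.+1)^-1 * (A i.+1 * A i.+2)).
  by apply: commuteM => //; apply: commuteV.
by rewrite mulKg.
Qed.

Lemma trans11_commute i j : commute (A i) (A j).
Proof.
wlog le_ij : i j / (i <= j)%N.
  by move=> W; case/orP: (leq_total i j) => /W // /commute_sym.
by rewrite -(subnK le_ij) A_shift; apply: commuteJ.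
Qed.

Lemma trans2_invol i : B i * B i = 1.
Proof. by rewrite -conjMg trans1_invol conj1g. Qed.

Lemma trans22_commute i j : commute (B i) (B j).
Proof. exact/commuteJ/trans11_commute. Qed.

Let dB i : B i = (a ^ s) ^ ((D ^ s) ^+ i).
Proof. by rewrite -conjXg -conjJg. Qed.

Lemma trans2_D i : B i ^ D = B i.
Proof.
apply: cJ; rewrite dB conjgE; apply/commute_sym.
have c : commute D ((D ^ s) ^+ i) by apply: commuteX.
by do 2?apply: commuteM => //; apply: commuteV.
Qed.

Let rdsa : commute (D ^ s) a.
Proof. by have := commuteJ s rdas; rewrite Jss. Qed.

Let cA0B j : commute a (B j).
Proof.
have e : a ^ ((D ^ s) ^+ j) = a by rewrite cJ //; apply/commuteX/commute_sym.
by rewrite dB -{1}e; apply: commuteJ.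
Qed.

Lemma trans12_commute i j : commute (A i) (B j).
Proof.
have -> : B j = B j ^ (D ^+ i) by elim: i => [|i IH];
  rewrite ?conjg1 // expgSr conjgM -IH trans2_D.
exact: commuteJ.
Qed.

Lemma trans2_s i : B i ^ s = A i.
Proof. exact: Jss. Qed.

(** [D ^ s] commutes with [a], so powers of [D * D ^ s] move [a] as powers of [D] do. Since [E]
    commutes with [D * D ^ s], its action on all translations follows from its action on [a] and
    [a ^ s]. *)
Let dA i : A i = a ^ ((D * D ^ s) ^+ i).
Proof.
rewrite (expgMn _ rdds) conjgM [RHS]cJ //; apply/commuteX/commute_sym.
rewrite conjgE; have c : commute (D ^ s) (D ^+ i) by exact/commuteX/commute_sym.
by do 2?apply: commuteM => //; apply: commuteV.
Qed.
Let dBE i : B i = (a ^ s) ^ ((D * D ^ s) ^+ i).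
Proof.
rewrite (expgMn _ rdds) conjgM dB; congr (_ ^ _); rewrite [RHS]cJ //.
exact/commuteX/commute_sym.
Qed.

Lemma trans1_E i : A i ^ E = A i * B i.
Proof.
have c : commute ((D * D ^ s) ^+ i) E by exact/commute_sym/commuteX.
by rewrite {1}dA -conjgM c conjgM rae conjMg -dA -dBE.
Qed.

Lemma trans2_E i : B i ^ E = B i.
Proof.
have c : commute ((D * D ^ s) ^+ i) E by exact/commute_sym/commuteX.
by rewrite dBE -conjgM c conjgM rase.
Qed.

End GammaTheory.

End GammaGroup.

(** * Characters of elementary abelian 2-groups *)

Section CharacterTheory.
Local Open Scope ring_scope.

Lemma F2P (x : 'F_2) : x = 0 \/ x = 1.
Proof. by case: x => [[|[|]]] // i; [left|right]; apply: val_inj. Qed.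

Lemma F2_addrr (x : 'F_2) : x + x = 0.
Proof. by case: (F2P x) => ->; apply/eqP. Qed.

Section Characters.
Variables (R : realFieldType) (Z : finType).
Local Notation V := {ffun Z -> 'F_2}.

Definition dot (u x : V) : 'F_2 := \sum_z u z * x z.
Definition sgn (t : 'F_2) : R := if t == 0 then 1 else -1.
Definition basis (z : Z) : V := [ffun y => (y == z)%:R].

Lemma sgnD s t : sgn (s + t) = sgn s * sgn t.
Proof.
by case: (F2P s) => ->; case: (F2P t) => ->; rewrite /sgn /= ?mulr1 ?mul1r ?mulrNN ?mulr1.
Qed.

Lemma dotC u x : dot u x = dot x u.
Proof. by apply: eq_bigr => z _; rewrite mulrC. Qed.

Lemma dotDl u v x : dot (u + v) x = dot u x + dot v x.
Proof. by rewrite -big_split; apply: eq_bigr => z _; rewrite ffunE mulrDl. Qed.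

Lemma dotDr u v x : dot x (u + v) = dot x u + dot x v.
Proof. by rewrite dotC dotDl !(dotC x). Qed.

Lemma dot0l x : dot 0 x = 0.
Proof. by apply: big1 => z _; rewrite ffunE mul0r. Qed.

Lemma dot_basis z x : dot (basis z) x = x z.
Proof.
rewrite /dot (bigD1 z) //= ffunE eqxx mul1r big1 ?addr0 // => y /negPf yz.
by rewrite ffunE yz mul0r.
Qed.

Lemma F2ffun_addrr (u : V) : u + u = 0.
Proof. by apply/ffunP=> z; rewrite !ffunE F2_addrr. Qed.

Lemma sum_sgn u : \sum_x sgn (dot u x) = if u == 0 then #|{: V}|%:R else 0.
Proof.
case: eqP => [->|/eqP u0].
  by under eq_bigr do rewrite dot0l; rewrite sumr_const.
have [z /eqP uz] : exists z, u z == 1.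
  apply/existsP; apply: contraNT u0; rewrite negb_exists => /forallP h; apply/eqP/ffunP=> z.
  by rewrite ffunE; case: (F2P (u z)) => // e; move: (h z); rewrite e eqxx.
have: \sum_x sgn (dot u x) = - \sum_x sgn (dot u x).
  rewrite {1}(reindex_inj (addIr (basis z))) -sumrN /=; apply: eq_bigr => x _.
  by rewrite dotDr [dot u (basis z)]dotC dot_basis uz sgnD /sgn /= mulrN1.
by move=> h; lra.
Qed.

Lemma ffun_basis (u : V) : u = \sum_(z | u z != 0) basis z.
Proof.
apply/ffunP=> y; rewrite sum_ffunE; case: (F2P (u y)) => uy; rewrite uy.
  by rewrite big1 // => z uz; rewrite ffunE; case: eqP => // e; rewrite -e uy in uz.
rewrite (bigD1 y) ?uy //= ffunE eqxx big1 ?addr0 // => z /andP[_ zy].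
by rewrite ffunE eq_sym (negPf zy).
Qed.

Lemma hom_ext (gT : finGroupType) (f h : V -> gT) :
  (forall u v, f (u + v) = (f u * f v)%g) ->
  (forall u v, h (u + v) = (h u * h v)%g) ->
  (forall z, f (basis z) = h (basis z)) -> f =1 h.
Proof.
move=> fD hD fh u.
have one (k : V -> gT) : (forall u v, k (u + v) = (k u * k v)%g) -> k 0 = 1%g.
  by move=> kD; apply: (mulgI (k 0)); rewrite -kD addr0 mulg1.
rewrite [u]ffun_basis (big_morph f fD (one f fD)) (big_morph h hD (one h hD)).
by apply: eq_bigr.
Qed.

Definition tau (gT : finGroupType) (c : Z -> gT) (u : V) : gT :=
  (\prod_z c z ^+ (u z != 0))%g.

Section Tau.
Variables (gT : finGroupType) (c : Z -> gT).
Hypothesis cinv : forall z, (c z * c z = 1)%g.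
Hypothesis ccom : forall y z, commute (c y) (c z).

Lemma tauD u v : tau c (u + v) = (tau c u * tau c v)%g.
Proof.
rewrite /tau; elim: (index_enum Z) => [|z r IH]; first by rewrite !big_nil mulg1.
rewrite !big_cons IH.
have h : commute (\prod_(j <- r) c j ^+ (u j != 0))%g (c z ^+ (v z != 0))%g.
  apply/commute_sym; elim/big_ind: _ => [|x y|y _]; first exact: commute1.
    exact: commuteM.
  by apply/commuteX/commute_sym/commuteX/commute_sym.
rewrite -!mulgA (mulgA (\prod_(j <- r) c j ^+ (u j != 0))%g) h !mulgA; congr (_ * _ * _)%g.
rewrite ffunE; case: (F2P (u z)) => ->; case: (F2P (v z)) => -> /=;
  by rewrite ?addr0 ?add0r ?eqxx ?F2_addrr /= ?expg0 ?expg1 ?mulg1 ?mul1g ?cinv.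
Qed.

Lemma tau_basis z : tau c (basis z) = c z.
Proof.
rewrite /tau; have := index_enum_uniq Z; have := mem_index_enum z.
elim: (index_enum Z) => // y r IH; rewrite inE /= big_cons ffunE => zr /andP[yr ur].
case: (eqVneq y z) zr yr => [->|yz] /= zr yr; last first.
  by rewrite mul1g IH // ; move: zr; rewrite eq_sym (negPf yz).
rewrite expg1 big1_seq ?mulg1 // => x /= xr; rewrite ffunE.
by case: (eqVneq x z) xr => [->|] //; rewrite (negPf yr).
Qed.
End Tau.

(** * Fourier transform along an action of an elementary abelian 2-group *)

Section Fourier.
Variables (gT : finGroupType) (Y : finType) (act : gT -> Y -> Y).
Hypothesis actM : forall p q y, act (p * q)%g y = act q (act p y).
Hypothesis act1 : forall y, act 1%g y = y.
Variable t : V -> gT.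
Hypothesis tD : forall u v, t (u + v) = (t u * t v)%g.

Lemma ract_inj p : injective (act p).
Proof.
by move=> x y e; rewrite -[x]act1 -[y]act1 -(mulgV p) !actM e.
Qed.

Let t0 : t 0 = 1%g.
Proof. by apply: (mulgI (t 0)); rewrite -tD addr0 mulg1. Qed.

(** This is [#|V|] times the projection of [f] to the isotypic part of the character [x], which
    explains the factors [cV ^+ 2] below. If [t] is not injective, the characters nontrivial on its
    kernel carry no mass. *)
Definition fourier (f : Y -> R) (x : V) (y : Y) : R :=
  \sum_u sgn (dot u x) * f (act (t u) y).
Definition mass f x : R := \sum_y fourier f x y ^+ 2.
Definition sqnorm (f : Y -> R) : R := \sum_y f y ^+ 2.
Local Notation cV := (#|{: V}|%:R : R).

Lemma mass_ge0 f x : 0 <= mass f x.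
Proof. by apply: sumr_ge0 => y _; apply: sqr_ge0. Qed.

Lemma parseval f : \sum_x mass f x = cV ^+ 2 * sqnorm f.
Proof.
rewrite exchange_big /=.
have h y : \sum_x fourier f x y ^+ 2 = cV * \sum_u f (act (t u) y) ^+ 2.
  have -> : \sum_x fourier f x y ^+ 2 =
    \sum_x \sum_u \sum_v f (act (t u) y) * f (act (t v) y) * sgn (dot (u + v) x).
    apply: eq_bigr => x _; rewrite expr2 mulr_suml; apply: eq_bigr => u _.
    rewrite mulr_sumr; apply: eq_bigr => v _; rewrite dotDl sgnD; ring.
  rewrite exchange_big mulr_sumr /=; apply: eq_bigr => u _.
  rewrite exchange_big /= (bigD1 u) //= -mulr_sumr F2ffun_addrr sum_sgn eqxx.
  rewrite big1 ?addr0; first by rewrite expr2 mulrC.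
  move=> v vu; rewrite -mulr_sumr sum_sgn ifF ?mulr0 //.
  by apply: contraNF vu => /eqP e; rewrite -[v]addr0 -(F2ffun_addrr u) addrCA addrA e add0r.
under eq_bigr do rewrite h.
rewrite -mulr_sumr exchange_big /= expr2 -mulrA; congr (_ * _).
rewrite mulr_natl -[RHS]sumr_const; apply: eq_bigr => u _.
by rewrite [RHS](reindex_inj (@ract_inj (t u))).
Qed.

(** Pointwise, p^2 <= (1 + 1/25) q^2 + (1 + 25) (p - q)^2, the difference being the square of 5 p -
    (26/5) q. The weight 1/25 keeps the multiplicative loss small, at the price of a factor 26 on
    the perturbation. *)
Lemma mass_near f1 f2 (E : pred V) :
  \sum_(x | E x) mass f1 x <=
  26 / 25 * \sum_(x | E x) mass f2 x
  + 26 * (cV ^+ 2 * sqnorm (fun y => f1 y - f2 y)).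
Proof.
rewrite -parseval mulr_sumr mulr_sumr.
have le2 : \sum_(x | E x) 26 * mass (fun y => f1 y - f2 y) x <=
           \sum_x 26 * mass (fun y => f1 y - f2 y) x.
  rewrite [leRHS](bigID E) /= lerDl; apply: sumr_ge0 => x _.
  by rewrite mulr_ge0 ?mass_ge0.
apply: le_trans (lerD (lexx _) le2); rewrite -big_split /=.
apply: ler_sum => x _; rewrite /mass !mulr_sumr -big_split /=.
apply: ler_sum => y _.
have -> : fourier (fun y => f1 y - f2 y) x y = fourier f1 x y - fourier f2 x y.
  by rewrite -sumrB; apply: eq_bigr => u _; ring.
set p := fourier f1 x y; set q := fourier f2 x y.
have := sqr_ge0 (5 * p - 26 / 5 * q); nra.
Qed.

Lemma mass_act f (h : gT) (gu gi : V -> V) :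
  injective gu -> (forall u, (t u ^ h)%g = t (gu u)) ->
  (forall u x, dot (gu u) x = dot u (gi x)) ->
  forall x, mass (fun y => f (act h y)) (gi x) = mass f x.
Proof.
move=> gI gt gd x; rewrite /mass [RHS](reindex_inj (@ract_inj h)) /=.
apply: eq_bigr => y _; congr (_ ^+ 2).
rewrite /fourier [RHS](reindex_inj gI) /=; apply: eq_bigr => u _.
by rewrite gd -gt -!actM conjgE mulKVg.
Qed.

(** [h] acts on the translations by [gu], hence on characters by the transpose [gi]: the mass of [f]
    at [x] is that of the translate of [f] at [gi x], and the translate is close to [f]. *)
Lemma mass_transport f (h : gT) (gu gi : V -> V) (E E' : pred V) eta :
  injective gu -> injective gi -> (forall u, (t u ^ h)%g = t (gu u)) ->
  (forall u x, dot (gu u) x = dot u (gi x)) ->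
  (forall x, E x -> E' (gi x)) ->
  sqnorm (fun y => f (act h y) - f y) <= eta * sqnorm f ->
  \sum_(x | E x) mass f x <= \sum_(x | E' x) mass f x
    + (1 / 25 + 26 * eta) * (cV ^+ 2 * sqnorm f).
Proof.
move=> gI giI gt gd EE' le_eta.
have -> : \sum_(x | E x) mass f x =
          \sum_(x | E x) mass (fun y => f (act h y)) (gi x).
  by apply: eq_bigr => x _; rewrite (mass_act _ gI gt gd).
have le1 : \sum_(x | E x) mass (fun y => f (act h y)) (gi x) <=
           \sum_(x | E' x) mass (fun y => f (act h y)) x.
  rewrite [leRHS](reindex_inj giI) /= [leRHS](bigID E) /=.
  rewrite [X in _ <= X + _](eq_bigl E) => [|x]; last first.
    by case: (boolP (E x)) => [/EE' ->|]; rewrite ?andbF.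
  by rewrite lerDl sumr_ge0 // => x _; apply: mass_ge0.
apply: le_trans le1 _; apply: le_trans (mass_near _ f _) _.
have mE : \sum_(x | E' x) mass f x <= cV ^+ 2 * sqnorm f.
  by rewrite -parseval [leRHS](bigID E') /= lerDl sumr_ge0 // => x _; apply: mass_ge0.
have : cV ^+ 2 * sqnorm (fun y => f (act h y) - f y) <= eta * (cV ^+ 2 * sqnorm f).
  by rewrite mulrCA ler_wpM2l // sqr_ge0.
by move: mE; set a := \sum_(_ | _) _; set b := cV ^+ 2 * sqnorm f; lra.
Qed.

(** On the part of [x] the translation by [basis z] is the sign given by [x z]. Subtracting the
    identity therefore kills the parts with [x z = 0] and multiplies the others by -2, whence the
    4. *)
Lemma mass_minus z f :
  4 * \sum_(x : V | x z != 0) mass f x =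
  cV ^+ 2 * sqnorm (fun y => f (act (t (basis z)) y) - f y).
Proof.
rewrite -parseval [RHS](bigID (fun x : V => x z != 0)) /= [X in _ + X]big1 ?addr0.
  rewrite mulr_sumr; apply: eq_bigr => x xz; rewrite /mass mulr_sumr.
  apply: eq_bigr => y _.
  rewrite [in RHS](_ : fourier _ x y = - 2 * fourier f x y); first by ring.
  rewrite /fourier; under eq_bigr do rewrite mulrBr; rewrite sumrB.
  have -> : \sum_u sgn (dot u x) * f (act (t (basis z)) (act (t u) y)) =
            - \sum_u sgn (dot u x) * f (act (t u) y).
    rewrite [in RHS](reindex_inj (addIr (basis z))) -sumrN; apply: eq_bigr => u _ /=.
    rewrite dotDl dot_basis sgnD tD actM; case: (F2P (x z)) xz => -> //= _.
    by rewrite {3}/sgn /=; ring.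
  by ring.
move=> x; rewrite negbK => /eqP xz; apply: big1 => y _.
rewrite (_ : fourier _ x y = 0) ?expr0n //.
rewrite /fourier; under eq_bigr do rewrite mulrBr; rewrite sumrB.
rewrite [X in _ - X](reindex_inj (addIr (basis z))) -sumrB; apply: big1 => u _ /=.
by rewrite dotDl dot_basis xz addr0 tD actM subrr.
Qed.

(** For the indicator of a set, the right side counts the returns of its points to the set along the
    translations; this is the quantity that a pigeonhole argument bounds from above. *)
Lemma mass0 f : mass f 0 = cV * \sum_y \sum_u f y * f (act (t u) y).
Proof.
have -> : mass f 0 = \sum_v \sum_y \sum_u f (act (t v) y) * f (act (t u) y).
  rewrite exchange_big; apply: eq_bigr => y _.
  have -> : fourier f 0 y = \sum_u f (act (t u) y).
    by apply: eq_bigr => u _; rewrite dotC dot0l /sgn eqxx mul1r.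
  by rewrite expr2 mulr_suml; apply: eq_bigr => u _; rewrite mulr_sumr.
rewrite mulr_natl -sumr_const; apply: eq_bigr => v _.
rewrite [RHS](reindex_inj (@ract_inj (t v))) /=; apply: eq_bigr => y _.
rewrite [RHS](reindex_inj (addIr v)) /=; apply: eq_bigr => u _.
by rewrite -actM -tD [v + _]addrC -addrA F2ffun_addrr addr0.
Qed.

End Fourier.
End Characters.

End CharacterTheory.

(** * Rigidity of gamma-sets *)

Section RigidityTheory.
Local Open Scope ring_scope.

(** * Valuations of the two components of a character *)

Section Valuations.
Variable k : nat.
Local Notation Z := (bool * 'I_k)%type.
Local Notation V := {ffun Z -> 'F_2}.
Implicit Types x u : V.

Definition vanish_below x (i : nat) : bool :=
  [forall j : 'I_k, (j < i)%N ==> (x (false, j) == 0) && (x (true, j) == 0)].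

(* For [x != 0] and [i] the least index at which one of the two components of
   [x] is nonzero, [p] and [q] tell which of them are. *)
Definition lead_type (p q : bool) x : bool :=
  [exists i : 'I_k, [&& (x (false, i) != 0) == p, (x (true, i) != 0) == q
                      & vanish_below x i]].

Lemma lead_type_cover x : x != 0 ->
  [|| lead_type true false x, lead_type true true x | lead_type false true x].
Proof.
move=> x0.
pose P (i : 'I_k) := (x (false, i) != 0) || (x (true, i) != 0).
have [i0 Pi0] : exists i, P i.
  apply/existsP; apply: contraNT x0; rewrite negb_exists => /forallP h.
  apply/eqP/ffunP => -[b i]; rewrite ffunE; move: (h i); rewrite negb_or !negbK.
  by case/andP=> /eqP e1 /eqP e2; case: b.
case: (arg_minnP (fun i : 'I_k => i : nat) Pi0) => i Pi imin.
have low : vanish_below x i.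
  apply/forallP => j; apply/implyP => ji; rewrite -[_ && _]negbK negb_and.
  by apply: contraL ji => /imin; rewrite -leqNgt.
apply: contraTT Pi; rewrite !negb_or => /and3P[/existsPn/(_ i) h1 /existsPn/(_ i) h2].
move=> /existsPn/(_ i) h3; move: h1 h2 h3; rewrite low !andbT.
by case: (x _ != 0); case: (x _ != 0).
Qed.

Lemma lead_type_disjoint x : lead_type true false x -> ~~ lead_type true true x.
Proof.
case/existsP => i /and3P[/eqP xi /eqP yi /forallP low]; apply/existsP => -[i'].
case/and3P => /eqP xi' /eqP yi' /forallP low'.
case: (ltngtP i i') => [lt|lt|/val_inj e].
- by have := low' i; rewrite lt /=; move: xi; case: eqP.
- by have := low i'; rewrite lt /=; move: xi'; case: eqP.
by move: yi'; rewrite -e yi.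
Qed.

Definition swap_index (z : Z) : Z := (~~ z.1, z.2).
(** Conjugation by [D] advances the translations [trans1] and fixes [trans2]. The shift is cyclic
    because [k] will be the order of [D]. *)
Definition shift_index (z : Z) : Z := if z.1 then z else (false, ordS z.2).
Definition unshift_index (z : Z) : Z := if z.1 then z else (false, ord_pred z.2).
Definition reindex_ffun (p : Z -> Z) (x : V) : V := [ffun z => x (p z)].
(** [shear2] describes conjugation by [E] on the translations; [shear1] is its transpose and
    describes the action on characters. *)
Definition shear1 (x : V) : V :=
  [ffun z => if z.1 then x z else x z + x (true, z.2)].
Definition shear2 (x : V) : V :=
  [ffun z => if z.1 then x z + x (false, z.2) else x z].

Lemma swap_indexK : involutive swap_index.
Proof. by case=> b i; rewrite /swap_index /= negbK. Qed.
Lemma shift_indexK : cancel shift_index unshift_index.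
Proof. by case=> [[] i]; rewrite /shift_index /unshift_index //= ordSK. Qed.
Lemma unshift_indexK : cancel unshift_index shift_index.
Proof. by case=> [[] i]; rewrite /shift_index /unshift_index //= ord_predK. Qed.

Lemma reindex_ffunK p q : cancel q p -> cancel (reindex_ffun p) (reindex_ffun q).
Proof. by move=> pK x; apply/ffunP => z; rewrite !ffunE pK. Qed.

Lemma shear1K : involutive shear1.
Proof.
by move=> x; apply/ffunP => -[[] i]; rewrite !ffunE //= -addrA F2_addrr addr0.
Qed.
Lemma shear2K : involutive shear2.
Proof.
by move=> x; apply/ffunP => -[[] i]; rewrite !ffunE //= -addrA F2_addrr addr0.
Qed.

Lemma dot_reindex p q u x : cancel q p -> cancel p q ->
  dot (reindex_ffun p u) x = dot u (reindex_ffun q x).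
Proof.
move=> qp pq; rewrite /dot (reindex q) /=; last by exists p => z _.
by apply: eq_bigr => z _; rewrite !ffunE qp.
Qed.

Lemma dot_pair u x : dot u x =
  \sum_i u (true, i) * x (true, i) + \sum_i u (false, i) * x (false, i).
Proof.
rewrite /dot (eq_bigr (fun z => u (z.1, z.2) * x (z.1, z.2))); last by case.
by rewrite -(pair_bigA _ (fun b i => u (b, i) * x (b, i))) big_bool.
Qed.

Lemma dot_shear u x : dot (shear2 u) x = dot u (shear1 x).
Proof.
rewrite !dot_pair -!big_split; apply: eq_bigr => i _; rewrite !ffunE /=; ring.
Qed.

Lemma lead_type_swap x :
  lead_type true false x -> lead_type false true (reindex_ffun swap_index x).
Proof.
case/existsP => i /and3P[xi yi /forallP low]; apply/existsP; exists i.
rewrite !ffunE /= yi xi; apply/forallP => j; apply/implyP => ji.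
by have := low j; rewrite ji !ffunE /= andbC.
Qed.

Lemma lead_type_shear x : lead_type false true x -> lead_type true true (shear1 x).
Proof.
case/existsP => i /and3P[/eqP/negbFE/eqP xi yi /forallP low].
apply/existsP; exists i; rewrite !ffunE /= xi add0r yi /=.
apply/forallP => j; apply/implyP => ji; have := low j; rewrite ji !ffunE /=.
by case/andP => /eqP -> /eqP ->; rewrite addr0 eqxx.
Qed.

(** The shift lowers the valuation of the first component by one and keeps the second component, so
    a valuation that was at most the other becomes strictly smaller. Vanishing at index 0 prevents a
    nonzero entry from wrapping around to the end. *)
Lemma lead_type_shift x (i0 : 'I_k) : val i0 = 0%N -> x (false, i0) == 0 ->
  lead_type true false x || lead_type true true x ->
  lead_type true false (reindex_ffun shift_index x).
Proof.
move=> i00 x0 h.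
have {h}[i xi /forallP low] :
    exists2 i : 'I_k, x (false, i) != 0 & vanish_below x i.
  by case/orP: h => /existsP[i /and3P[/eqP xi _ low]]; exists i.
have i_gt0 : (0 < i)%N.
  rewrite lt0n; apply: contraNneq xi => i0'; suff -> : i = i0 by [].
  by apply: val_inj; rewrite i00.
have vp : val (ord_pred i) = i.-1.
  have lik := ltn_ord i.
  have -> : val (ord_pred i) = ((i + k).-1 %% k)%N by [].
  by rewrite -subn1 -addnBAC // subn1 modnDr modn_small //; lia.
apply/existsP; exists (ord_pred i); rewrite !ffunE /= /shift_index /= ord_predK xi /=.
have yi : x (true, ord_pred i) == 0.
  by have := low (ord_pred i); rewrite -[nat_of_ord (ord_pred i)]/(val _) vp
    (_ : (i.-1 < i)%N) ?andbT => [/andP[]|]; last lia.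
rewrite (eqP yi) eqxx /=; apply/forallP => j; apply/implyP => ji0.
have ji : (j < i.-1)%N by rewrite -vp.
rewrite !ffunE /= {ji0}.
have lik := ltn_ord i; have ej : val (ordS j) = j.+1.
  by have -> : val (ordS j) = (j.+1 %% k)%N by []; rewrite modn_small //; lia.
have := low (ordS j); rewrite -[nat_of_ord (ordS j)]/(val _) ej.
have -> : (j.+1 < i)%N by lia.
case/andP => -> _; have := low j; have -> : (j < i)%N by lia.
by case/andP.
Qed.

End Valuations.

(** * Products of gamma-sets *)

Section ProductStructure.
Variables (gT1 gT2 : finGroupType) (g1 : gen -> gT1) (g2 : gen -> gT2).
Definition pair_gens (i : gen) : gT1 * gT2 := (g1 i, g2 i).

Lemma wval_pair w : wval pair_gens w = (wval g1 w, wval g2 w).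
Proof. by elim: w => // -[i []] w /= ->. Qed.

Lemma gamma_pair : gamma g1 -> gamma g2 -> gamma pair_gens.
Proof. by move=> h1 h2 i; rewrite !wval_pair h1 h2. Qed.

Lemma expg_pair2 (p : gT1 * gT2) n : ((p ^+ n)%g).2 = (p.2 ^+ n)%g.
Proof. by elim: n => // n IH; rewrite !expgS /= IH. Qed.

Lemma trans1_pair2 i : (trans1 pair_gens i).2 = trans1 g2 i.
Proof. by rewrite /trans1 /conjg /= expg_pair2. Qed.

Lemma trans2_pair2 i : (trans2 pair_gens i).2 = trans2 g2 i.
Proof. by rewrite /trans2 -trans1_pair2. Qed.
End ProductStructure.

Section Arithmetic.
Variable R : realFieldType.
Implicit Types p q : R.
Lemma quarter_mass_bound p c n q : 0 <= c -> 4 * p = c * n -> n <= 1 / 1000 * q ->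
  p <= 1 / 4000 * (c * q).
Proof. by move=> c0 e h; have := ler_wpM2l c0 h; lra. Qed.
Lemma shift_mass_bound e u v w p q (ka : R) : e <= u + ka * q -> w = u + v -> w <= e + p ->
  p <= 1 / 4000 * q -> v <= (ka + 1 / 4000) * q.
Proof. by lra. Qed.
(** The three classes have mass at most [ka], [2 * ka] and [3 * ka] times [q], each plus 1/4000;
    this gives the 6 and the 3. *)
Lemma zero_mass_bound u v w z q (ka : R) : u <= w + ka * q -> w <= v + ka * q ->
  v <= (ka + 1 / 4000) * q -> q <= z + (u + v + w) ->
  (1 - 6 * ka - 3 / 4000) * q <= z.
Proof. by lra. Qed.
(** The numerical margin of the argument: the factor on the left is 0.60325, which exceeds 1/2. *)
Lemma zero_of_mass_bounds p q : 0 < p -> 0 <= q ->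
  (1 - 6 * (1 / 25 + 26 * (1 / 1000)) - 3 / 4000) * (p * q) <= 1 / 2 * (p * q) -> q = 0.
Proof.
move=> p0 q0 h; have pq : 0 <= p * q by rewrite mulr_ge0 // ltW.
have /eqP : p * q = 0 by lra.
by rewrite mulf_eq0 (gt_eqF p0) /= => /eqP.
Qed.
Lemma half_mass_scale p q s : 0 <= p -> s <= p / 2 * q -> p * s <= 1 / 2 * (p ^+ 2 * q).
Proof. by move=> p0 /(ler_wpM2l p0); lra. Qed.
Lemma le_half_of_double p q : 2 * p <= q -> p <= q / 2.
Proof. by lra. Qed.
Lemma invariance_scale p q : 2000 * p <= q -> 2 * p <= 1 / 1000 * q.
Proof. by lra. Qed.
End Arithmetic.

(** * An almost invariant partial map into a larger transitive gamma-set is empty *)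

Section Rigidity.
Variable R : realFieldType.
Variables (X H : finType) (gX : gen -> {perm X}) (gH : gen -> {perm H}).
Hypotheses (hX : gamma gX) (hH : gamma gH) (ltXH : (#|X| < #|H|)%N).
Hypothesis transH : forall h h' : H, exists i1 i2 : nat, exists m1 m2 : bool,
  ((trans1 gH i1 ^+ m1 * trans2 gH i2 ^+ m2)%g : {perm H}) h = h'.
Variable W : {set X * H}.
Hypothesis funW : {in W &, forall p q, p.1 = q.1 -> p = q}.
Hypothesis invW : forall i : gen,
  (2000 * #|[set p in W | (gX i p.1, gH i p.2) \notin W]| <= #|W|)%N.

Local Notation gT := ({perm X} * {perm H})%type.
Local Notation Y := (X * H)%type.
Let g : gen -> gT := pair_gens gX gH.
Let hg : gamma g := gamma_pair hX hH.
Let act (p : gT) (y : Y) : Y := (p.1 y.1, p.2 y.2).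
Let actM p q y : act (p * q)%g y = act q (act p y).
Proof. by rewrite /act /= !permM. Qed.
Let act1 y : act 1%g y = y.
Proof. by case: y => x h; rewrite /act /= !perm1. Qed.

Let acti p : injective (act p).
Proof. exact: (ract_inj actM act1). Qed.

(** Modulo the order of [D] the families [trans1] and [trans2] are periodic, so finitely many
    indices suffice and conjugation by [D] permutes them. *)
Let k := #[g gd]%g.
Local Notation Z := (bool * 'I_k)%type.
Local Notation V := {ffun Z -> 'F_2}.
Let c (z : Z) : gT := if z.1 then trans2 g z.2 else trans1 g z.2.
Let cinv z : (c z * c z = 1)%g.
Proof. by case: z => -[] i; [apply: trans2_invol|apply: trans1_invol]. Qed.
Let ccom y z : commute (c y) (c z).
Proof.
case: y z => -[] i [] [] j; rewrite /c /=.
- exact: trans22_commute.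
- by apply/commute_sym; exact: trans12_commute.
- exact: trans12_commute.
- exact: trans11_commute.
Qed.
Let t : V -> gT := tau c.
Let tD u v : t (u + v) = (t u * t v)%g := tauD cinv ccom u v.

Let conj_hom (h : gT) (gu : V -> V) : (forall u v, gu (u + v) = gu u + gu v) ->
  (forall z, (c z ^ h)%g = t (gu (basis z))) -> forall u, (t u ^ h)%g = t (gu u).
Proof.
move=> guD e; apply: hom_ext => [u v|u v|z].
- by rewrite tD conjMg.
- by rewrite guD tD.
by rewrite -e /t tau_basis.
Qed.

Let conj_D u : (t u ^ g gd)%g = t (reindex_ffun (@unshift_index k) u).
Proof.
apply: conj_hom => [v w|[b i]]; first by apply/ffunP => z; rewrite !ffunE.
have -> : reindex_ffun (@unshift_index k) (basis (b, i)) = basis (shift_index (b, i)).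
  apply/ffunP => z; rewrite !ffunE; congr (nat_of_bool _)%:R.
  by apply/eqP/eqP => [<-|->]; rewrite ?unshift_indexK ?shift_indexK.
rewrite /t tau_basis /c /shift_index /=; case: b => /=; first exact: trans2_D.
rewrite trans1_D /trans1 -[in LHS](expg_mod_order (g gd)); congr (_ ^ (_ ^+ _))%g.
Qed.

Let conj_s u : (t u ^ g gs)%g = t (reindex_ffun (@swap_index k) u).
Proof.
apply: conj_hom => [v w|[b i]]; first by apply/ffunP => z; rewrite !ffunE.
have -> : reindex_ffun (@swap_index k) (basis (b, i)) = basis (swap_index (b, i)).
  apply/ffunP => z; rewrite !ffunE; congr (nat_of_bool _)%:R.
  by apply/eqP/eqP => [<-|->]; rewrite ?swap_indexK.
by rewrite /t tau_basis /c; case: b => //=; exact: trans2_s.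
Qed.

Let conj_E u : (t u ^ g ge)%g = t (shear2 u).
Proof.
apply: conj_hom => [v w|[b i]].
  by apply/ffunP => -[[] i]; rewrite !ffunE //=; ring.
case: b; rewrite /c /=.
  rewrite trans2_E //.
  have -> : shear2 (basis (true, i)) = basis (true, i).
    by apply/ffunP => -[[] j]; rewrite !ffunE //= addr0.
  by rewrite /t tau_basis.
rewrite trans1_E //.
have -> : shear2 (basis (false, i)) = basis (false, i) + basis (true, i).
  by apply/ffunP => -[[] j]; rewrite !ffunE //= ?addr0 ?add0r // /eq_op /= add0r.
by rewrite tD /t !tau_basis.
Qed.

Let F (y : Y) : R := (y \in W)%:R.
Let M := sqnorm F.
Let cV : R := #|{: V}|%:R.

Let ME : M = #|W|%:R.
Proof.
rewrite /M /sqnorm -sum1_card natr_sum [RHS]big_mkcond; apply: eq_bigr => y _.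
by rewrite /F; case: (_ \in _); rewrite ?expr1n ?expr0n.
Qed.

(** The indicator changes at the points that leave [W] and, the generator being a bijection, at
    equally many points that enter it. This doubling turns 1/2000 into 1/1000. *)
Let near i : sqnorm (fun y => F (act (g i) y) - F y) <= 1 / 1000 * M.
Proof.
have -> : sqnorm (fun y => F (act (g i) y) - F y) =
   2 * #|[set p in W | (gX i p.1, gH i p.2) \notin W]|%:R.
  have e1 : sqnorm (fun y => F (act (g i) y)) = M.
    by rewrite /M /sqnorm [RHS](reindex_inj (@acti (g i))).
  have -> : sqnorm (fun y => F (act (g i) y) - F y) =
     M - sqnorm (fun y => F (act (g i) y)) + 2 * \sum_y F y * (1 - F (act (g i) y)).
    rewrite e1 addrN add0r mulr_sumr.
    have -> : \sum_y 2 * (F y * (1 - F (act (g i) y))) =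
      \sum_y ((F (act (g i) y) - F y) ^+ 2 + (F y ^+ 2 - F (act (g i) y) ^+ 2)).
      by apply: eq_bigr => y _; rewrite /F; do 2!case: (_ \in _); rewrite /=; ring.
    by rewrite big_split /= sumrB -/(sqnorm F) -/(sqnorm (fun y => F (act (g i) y)))
       e1 subrr addr0.
  rewrite e1 subrr add0r; congr (_ * _); rewrite -sum1_card natr_sum.
  rewrite [RHS]big_mkcond; apply: eq_bigr => y _; rewrite inE /F.
  rewrite -[act _ _]/(gX i y.1, gH i y.2).
  by do 2!case: (_ \in _); rewrite /=; ring.
by have := invW i; rewrite ME -(ler_nat R) natrM; exact: invariance_scale.
Qed.

Let mas := mass act t F.
Let m (E : pred V) := \sum_(x | E x) mas x.
Let kappa : R := 1 / 25 + 26 * (1 / 1000).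

Let transport h gu gi E E' := @mass_transport R Z gT Y act actM act1 t
  F h gu gi E E' (1 / 1000).

Let le_s : m (lead_type true false) <= m (lead_type false true) + kappa * (cV ^+ 2 * M).
Proof.
have I := can_inj (reindex_ffunK (@swap_indexK k)).
apply: (transport I I conj_s _ (@lead_type_swap k) (near gs)) => u x.
by apply: dot_reindex; exact: swap_indexK.
Qed.

Let le_E : m (lead_type false true) <= m (lead_type true true) + kappa * (cV ^+ 2 * M).
Proof.
exact: (transport (can_inj (@shear2K k)) (can_inj (@shear1K k)) conj_E
  (@dot_shear k) (@lead_type_shear k) (near ge)).
Qed.

Let i0 : 'I_k := Ordinal (order_gt0 (g gd)).

Let le_a : m (fun x => x (false, i0) != 0) <= 1 / 4000 * (cV ^+ 2 * M).
Proof.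
set P := fun x : V => x (false, i0) != 0.
have e : 4 * m P = cV ^+ 2 * sqnorm (fun y => F (act (t (basis (false, i0))) y) - F y).
  exact: (mass_minus actM act1 tD (false, i0) F).
have e' : t (basis (false, i0)) = g ga.
  by rewrite /t tau_basis /c /trans1 expg0 conjg1.
apply: (quarter_mass_bound _ e); first exact: sqr_ge0.
by rewrite e'; exact: near.
Qed.

(** In the comparison given by [D] the mass of the type [true false] occurs on both sides and
    cancels. What remains bounds the type [true true] by the transport error and the mass of the
    characters nonzero at index 0, which the near invariance under [a] controls. *)
Let le_D : m (lead_type true true) <= (kappa + 1 / 4000) * (cV ^+ 2 * M).
Proof.
pose UV (x : V) := lead_type true false x || lead_type true true x.
pose E (x : V) := UV x && (x (false, i0) == 0).
have s1 : m E <= m (lead_type true false) + kappa * (cV ^+ 2 * M).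
  apply: (transport (can_inj (reindex_ffunK (@shift_indexK k)))
    (can_inj (reindex_ffunK (@unshift_indexK k))) conj_D _ _ (near gd)).
    by move=> u x; apply: dot_reindex; [exact: shift_indexK|exact: unshift_indexK].
  by move=> x /andP[uv x0]; apply: (lead_type_shift _ x0 uv).
have s2 : m UV = m (lead_type true false) + m (lead_type true true).
  rewrite /m (bigID (lead_type true false)) /=; congr (_ + _); apply: eq_bigl => x.
    by rewrite /UV; case: (lead_type true false x); rewrite ?andbF.
  rewrite /UV; have := @lead_type_disjoint k x.
  by case: (lead_type true false x); case: (lead_type true true x) => //= h; rewrite h.
have s3 : m UV <= m E + m (fun x => x (false, i0) != 0).
  rewrite /m (bigID (fun x : V => x (false, i0) == 0)) /= lerD2l.
  rewrite [leRHS](bigID UV) /= [X in X <= _](eq_bigl (fun x : V =>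
    (x (false, i0) != 0) && UV x)); last by move=> x; rewrite andbC.
  by rewrite lerDl sumr_ge0 // => x _; apply: mass_ge0.
exact: (shift_mass_bound s1 s2 s3 le_a).
Qed.

Let mas0_ge : (1 - 6 * kappa - 3 / 4000) * (cV ^+ 2 * M) <= mas 0.
Proof.
have tot : \sum_x mas x = cV ^+ 2 * M := parseval actM act1 t F.
have : \sum_x mas x <= mas 0 + (m (lead_type true false) + m (lead_type true true)
   + m (lead_type false true)).
  rewrite (bigD1 (0 : V)) //= lerD2l.
  have mE E : m E = \sum_x (if E x then mas x else 0) by rewrite /m big_mkcond.
  rewrite big_mkcond !mE -!big_split /=; apply: ler_sum => x _.
  have := mass_ge0 act t F x; rewrite -/(mas x) => m0.
  case: ifP => [/lead_type_cover/or3P[] ->|_]; do ?case: ifP => _; lra.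
rewrite tot => h; exact: (zero_mass_bound le_s le_E le_D h).
Qed.

(** The translations reach all of [H] from [y.2], and [X] has fewer points. So some [u0] fixes [y.1]
    and moves [y.2]; otherwise the choice [U] of translations would inject [H] into [X]. As [W] is a
    partial function of its first coordinate, [u] and [u + u0] never both bring [y] into [W]. *)
Let half y : y \in W -> (2 * #|[set u : V | act (t u) y \in W]| <= #|{: V}|)%N.
Proof.
move=> yW; have [u0 ux uh] : exists2 u0 : V, (t u0).1 y.1 = y.1 & (t u0).2 y.2 <> y.2.
  have tr h' : exists u : V, (t u).2 y.2 == h'.
    have [i1 [i2 [m1 [m2 e]]]] := transH y.2 h'.
    have mk i : (i %% k < k)%N by rewrite ltn_mod order_gt0.
    have em i : trans1 g (i %% k) = trans1 g i by rewrite /trans1 expg_mod_order.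
    have t0 : t 0 = 1%g by apply: (mulgI (t 0)); rewrite -tD addr0 mulg1.
    have [u1 e1] : exists u1, (t u1).2 = (trans1 gH i1 ^+ m1)%g.
      case: (m1); last by exists 0; rewrite t0.
      exists (basis (false, Ordinal (mk i1))).
      have -> : t (basis (false, Ordinal (mk i1))) = trans1 g i1.
        by rewrite /t tau_basis -em.
      exact: trans1_pair2.
    have [u2 e2] : exists u2, (t u2).2 = (trans2 gH i2 ^+ m2)%g.
      case: (m2); last by exists 0; rewrite t0.
      exists (basis (true, Ordinal (mk i2))).
      have -> : t (basis (true, Ordinal (mk i2))) = trans2 g i2.
        by rewrite /t tau_basis /trans2 -em.
      exact: trans2_pair2.
    by exists (u1 + u2); rewrite tD -e -e1 -e2.
  pose U h' := xchoose (tr h').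
  have UP h' : (t (U h')).2 y.2 = h' := eqP (xchooseP (tr h')).
  case: (boolP [exists u : V, ((t u).1 y.1 == y.1) && ((t u).2 y.2 != y.2)]).
    by case/existsP => u /andP[/eqP ? /eqP ?]; exists u.
  move=> /existsPn no; exfalso; move: ltXH; rewrite ltnNge => /negP; apply.
  apply: (leq_card (fun h' => (t (U h')).1 y.1)) => h h' e.
  have := no (U h + U h'); rewrite tD !permM /= e.
  rewrite -permM -[((t (U h')).1 * (t (U h')).1)%g]/((t (U h') * t (U h'))%g.1).
  rewrite -tD F2ffun_addrr.
  have -> : t 0 = 1%g by apply: (mulgI (t 0)); rewrite -tD addr0 mulg1.
  rewrite /= perm1 eqxx /= negbK UP => /eqP e2.
  have : (t (U h')).2 ((t (U h')).2 h) = (t (U h')).2 y.2 by rewrite e2.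
  rewrite -permM -[((t (U h')).2 * (t (U h')).2)%g]/((t (U h') * t (U h'))%g.2).
  rewrite -tD F2ffun_addrr.
  have -> : t 0 = 1%g by apply: (mulgI (t 0)); rewrite -tD addr0 mulg1.
  by rewrite /= perm1 UP.
pose S := [set u : V | act (t u) y \in W].
pose sh (u : V) : V := u + u0.
pose S' := sh @: S.
have dis : [disjoint S & S'].
  rewrite disjoint_subset; apply/subsetP => u uS; rewrite inE; apply/imsetP => -[v vS e].
  move: uS vS; rewrite !inE e /sh addrC tD actM => uW vW.
  have : act (t v) (act (t u0) y) = act (t v) y by apply: funW => //=; rewrite ux.
  by case=> _ /perm_inj.
have := cardsUI S S'; rewrite (disjoint_setI0 dis) cards0 addn0.
by rewrite (card_imset _ (addIr u0 : injective sh)) mul2n -addnn => <-; exact: max_card.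
Qed.

Lemma rigidity : W = set0.
Proof.
have le : mas 0 <= 1 / 2 * (cV ^+ 2 * M).
  rewrite /mas (mass0 actM act1 tD).
  have -> : \sum_y \sum_u F y * F (act (t u) y) =
     \sum_(y in W) #|[set u : V | act (t u) y \in W]|%:R.
    rewrite [RHS]big_mkcond; apply: eq_bigr => y _; rewrite -mulr_sumr /F.
    case: (y \in W); rewrite ?mul0r // mul1r -sum1_card natr_sum [RHS]big_mkcond.
    by apply: eq_bigr => u _; rewrite inE; case: (_ \in _).
  have : \sum_(y in W) #|[set u : V | act (t u) y \in W]|%:R <= \sum_(y in W) (cV / 2).
    by apply: ler_sum => y /half; rewrite -(ler_nat R) natrM; exact: le_half_of_double.
  rewrite sumr_const -[_ *+ #|W|]mulr_natr -ME -/cV => h.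
  exact: half_mass_scale (ler0n R #|{: V}|) h.
have cV0 : 0 < cV ^+ 2 by rewrite exprn_gt0 // ltr0n; apply/card_gt0P; exists 0.
apply/eqP; rewrite -cards_eq0 -(eqr_nat R) -ME; apply/eqP.
have M0 : 0 <= M by rewrite ME ler0n.
have : (1 - 6 * kappa - 3 / 4000) * (cV ^+ 2 * M) <= 1 / 2 * (cV ^+ 2 * M).
  exact: le_trans mas0_ge le.
exact: zero_of_mass_bounds.
Qed.

End Rigidity.

End RigidityTheory.

(** * Encoding gamma-sets as graphs *)

Definition gen_of_nat (i : nat) : gen := nth ga [:: ga; gd; gt; gs; ge] i.

Definition port_letter (r : nat) : letter :=
  (gen_of_nat ((r - 2) %/ 4), r %% 4 == 0).
Definition port_target (r : nat) : nat := if r %% 4 == 0 then r - 2 else r + 2.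

(* A point of a gamma-set becomes a path with vertices 0, ..., 21; at vertex
   [2 + 4 i] starts the edge for the generator [i], ending at vertex
   [4 + 4 i] of the path of the image point. *)
Definition nbrs (r : nat) : seq (option letter * nat) :=
  (if 0 < r then [:: (None, r.-1)] else [::]) ++
  (if r < 21 then [:: (None, r.+1)] else [::]) ++
  (if [&& ~~ odd r, 2 <= r & r <= 20]
   then [:: (Some (port_letter r), port_target r)] else [::]).

Definition rdeg (r : nat) : nat := size (nbrs r).

Definition inv_letter (l : letter) : letter := (l.1, ~~ l.2).
Definition out_port (l : letter) : nat := if l.2 then 4 + 4 * l.1 else 2 + 4 * l.1.
Definition in_port (l : letter) : nat := if l.2 then 2 + 4 * l.1 else 4 + 4 * l.1.

Lemma all_nat (n : nat) (p : pred nat) : all p (iota 0 n) -> forall r, r < n -> p r.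
Proof. by move=> /allP h r rn; apply: h; rewrite mem_iota. Qed.

Lemma nbrs_bound r m : r < 22 -> m \in nbrs r -> m.2 < 22.
Proof.
move=> r22; move: m; apply/allP; move: r r22.
by apply: (@all_nat 22 (fun r => all (fun m => m.2 < 22) (nbrs r))).
Qed.

Lemma nbrs_sym r m : r < 22 -> m \in nbrs r ->
  (omap inv_letter m.1, r) \in nbrs m.2.
Proof.
move=> r22; move: m; apply/allP; move: r r22.
by apply: (@all_nat 22 (fun r => all (fun m => (omap inv_letter m.1, r) \in nbrs m.2) (nbrs r))).
Qed.

(** This and the distinctness of the positions of the neighbours exclude loops and double edges even
    where a generator fixes a point. *)
Lemma nbrs_irr r : r < 22 -> r \notin map snd (nbrs r).
Proof. by move: r; apply: (@all_nat 22 (fun r => r \notin map snd (nbrs r))). Qed.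

Lemma nbrs_uniq r : r < 22 -> uniq (map snd (nbrs r)).
Proof. by move: r; apply: (@all_nat 22 (fun r => uniq (map snd (nbrs r)))). Qed.

Lemma rdeg_le3 r : rdeg r <= 3.
Proof. by rewrite /rdeg /nbrs; do 3!case: ifP. Qed.

Lemma nbrs_succ r : r < 21 -> (None, r.+1) \in nbrs r.
Proof. by rewrite /nbrs => ->; rewrite !mem_cat mem_head orbT. Qed.

(** Both ends of the path have degree 1, but the neighbour of vertex 21 is a port, of degree 3, and
    that of vertex 0 is not. This orients the path. *)
Lemma nbrs_start r m : r < 22 -> m \in nbrs r -> rdeg r = 1 -> rdeg m.2 = 2 ->
  r = 0 /\ m = (None, 1).
Proof.
move=> r22 mr d1 d2.
have := @all_nat 22 (fun r => all (fun m =>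
  (rdeg r == 1) && (rdeg m.2 == 2) ==> (r == 0) && (m == (None, 1))) (nbrs r)).
move=> /(_ isT r r22)/allP/(_ m mr); rewrite d1 d2 /= => /andP[/eqP-> /eqP->].
by [].
Qed.

(** A port edge joins two even vertices of degree 3, whereas the vertex after a port on the path has
    degree 2, or 1 at the end. Degrees alone thus tell the path from the port edges, which is why
    ports occupy only even positions. *)
Lemma nbrs_next r m : r < 20 -> m \in nbrs r.+1 -> m <> (None, r) ->
  rdeg m.2 = rdeg r.+2 -> m = (None, r.+2).
Proof.
move=> r22 mr mn d.
have := @all_nat 20 (fun r => all (fun m =>
  [|| m == (None, r), m == (None, r.+2) | rdeg m.2 != rdeg r.+2]) (nbrs r.+1)).
move=> /(_ isT r r22)/allP/(_ m mr); rewrite d eqxx orbF.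
by case/orP => /eqP.
Qed.

Lemma nbrs_port (l : letter) m : m \in nbrs (out_port l) -> m.2 = in_port l ->
  m = (Some l, in_port l).
Proof.
case: l => -[i i5] b.
have h : all (fun b => all (fun j => all (fun m => (m.2 == (if b then 2 + 4 * j else 4 + 4 * j)%N)
  ==> (m == (Some (gen_of_nat j, b), (if b then 2 + 4 * j else 4 + 4 * j)%N)))
  (nbrs (if b then 4 + 4 * j else 2 + 4 * j))) (iota 0 5)) [:: true; false].
  by vm_compute.
have bi : b \in [:: true; false] by case: b.
have {h}:= allP h b bi => /all_nat/(_ i i5)/allP/(_ m) h.
rewrite /out_port /in_port /= => /h /implyP {}h /eqP/h/eqP ->.
congr (Some (_, _), _); apply: val_inj => /=.
by case: i i5 {h} => [|[|[|[|[|]]]]].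
Qed.

Lemma port_nbrs (l : letter) : (Some l, in_port l) \in nbrs (out_port l).
Proof.
case: l => -[i i5] b; have e : Ordinal i5 = gen_of_nat i.
  by apply: val_inj; case: i i5 => [|[|[|[|[|]]]]].
rewrite e; case: i {e} i5 => [|[|[|[|[|]]]]] // _; by case: b.
Qed.

Lemma out_port_lt l : out_port l < 22.
Proof. by case: l => -[i i5] []; rewrite /out_port /=; lia. Qed.
Lemma in_port_lt l : in_port l < 22.
Proof. by case: l => -[i i5] []; rewrite /in_port /=; lia. Qed.

Section Encoding.
Variables (P : finType) (g : gen -> {perm P}).

Definition move (m : option letter) : {perm P} :=
  if m is Some l then lval g l else 1%g.

Definition nbl (v : P * 'I_22) : seq (P * 'I_22) :=
  [seq (move m.1 v.1, inord m.2) | m <- nbrs v.2].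

Lemma nblP (v w : P * 'I_22) :
  reflect (exists2 m, m \in nbrs v.2 & w.1 = move m.1 v.1 /\ w.2 = m.2 :> nat)
          (w \in nbl v).
Proof.
apply: (iffP mapP) => -[m mv].
  by move=> ->; exists m => //=; rewrite inordK // (nbrs_bound (ltn_ord v.2)).
case: w => w1 w2 /= [-> e]; exists m => //; congr (_, _); apply: val_inj.
by rewrite /= inordK // (nbrs_bound (ltn_ord v.2)).
Qed.

Lemma move_inv m x : move (omap inv_letter m) (move m x) = x.
Proof.
case: m => [[i b]|] /=; last by rewrite !perm1.
by rewrite /lval /=; case: b; rewrite /= ?permK ?permKV.
Qed.

Lemma nbl_sym v w : (w \in nbl v) = (v \in nbl w).
Proof.
wlog: v w / w \in nbl v.
  move=> h; apply/idP/idP => hh; first by rewrite -h.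
  by rewrite -h.
move=> h; rewrite h; apply/esym/nblP; case/nblP: h => m mv [e1 e2].
exists (omap inv_letter m.1, (v.2 : nat)); last by rewrite /= e1 move_inv.
by rewrite e2; apply: (nbrs_sym (ltn_ord v.2)).
Qed.

Lemma nbl_irr v : (v \in nbl v) = false.
Proof.
apply/nblP => -[m mv [_ e]].
have := map_f snd mv; rewrite -e; apply/negP.
exact: nbrs_irr (ltn_ord v.2).
Qed.

Lemma nbl_uniq v : uniq (nbl v).
Proof.
have h : map (fun w : P * 'I_22 => w.2 : nat) (nbl v) = map snd (nbrs v.2).
  rewrite -map_comp; apply/eq_in_map => m mv /=.
  by rewrite inordK // (nbrs_bound (ltn_ord v.2)).
by apply: (@map_uniq _ _ (fun w : P * 'I_22 => w.2 : nat));
   rewrite h nbrs_uniq.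
Qed.

Lemma size_nbl v : size (nbl v) = rdeg v.2.
Proof. by rewrite size_map. Qed.

Variables (N : nat) (kap : 'I_N -> P * 'I_22).

Definition eG : sgraph N :=
  @SGraph N (fun u v => kap v \in nbl (kap u))
    (fun u v => nbl_sym (kap u) (kap v)) (fun v => nbl_irr (kap v)).

Hypothesis kapB : bijective kap.

Lemma card_nbhd_eG v : #|nbhd eG v| = rdeg (kap v).2.
Proof.
rewrite -size_nbl; case: kapB => kinv kK kK'.
rewrite -(card_uniqP (nbl_uniq (kap v))).
have -> : nbhd eG v = kinv @: [set w in nbl (kap v)].
  apply/setP => w; rewrite inE /=; apply/idP/imsetP => [h|[u]].
    by exists (kap w); rewrite ?inE ?kK.
  by rewrite inE => h ->; rewrite kK'.
by rewrite card_imset ?cardsE //; exact: can_inj kK'.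
Qed.

Lemma eG_degree : max_degree_le 3 eG.
Proof. by move=> v; rewrite card_nbhd_eG rdeg_le3. Qed.

End Encoding.

(** A path is recognised by degrees and absence of backtracking only, so the notion makes sense in
    any graph and is visible within a bounded radius. The values of [c] from 22 on are arbitrary. *)
Definition gadget N (G : sgraph N) (p : 'I_N) (c : nat -> 'I_N) : Prop :=
  [/\ c 0 = p, forall r, r < 22 -> #|nbhd G (c r)| = rdeg r,
      forall r, r < 21 -> G (c r) (c r.+1) & forall r, r < 20 -> c r != c r.+2].

Definition arcl N (G : sgraph N) (l : letter) (p p' : 'I_N) : Prop :=
  exists c c', [/\ gadget G p c, gadget G p' c' & G (c (out_port l)) (c' (in_port l))].

Section EncodingGadgets.
Variables (P : finType) (g : gen -> {perm P}) (N : nat) (kap : 'I_N -> P * 'I_22).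
Hypothesis kapB : bijective kap.
Local Notation G := (eG g kap).

Lemma gadget_eG p c : gadget G p c ->
  exists x, forall r, r < 22 -> kap (c r) = (x, inord r).
Proof.
case=> c0 dg ad nb.
have d r : r < 22 -> rdeg (kap (c r)).2 = rdeg r by move=> h; rewrite -(card_nbhd_eG g kapB) dg.
have pair (v : P * 'I_22) x r : r < 22 -> v.1 = x -> v.2 = r :> nat -> v = (x, inord r).
  by case: v => v1 v2 r22 /= -> e; congr (_, _); apply: val_inj; rewrite /= inordK.
exists (kap (c 0)).1 => r; set x := (kap (c 0)).1.
suff h q : q < 21 -> kap (c q) = (x, inord q) /\ kap (c q.+1) = (x, inord q.+1).
  by case: r => [|r] r22; [case: (h 0)|case: (h r)].
elim: q => [|q IH] q21.
  have /nblP[m m0 [e1 e2]] := ad 0 isT.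
  have [z0 em] : (kap (c 0)).2 = 0 :> nat /\ m = (None, 1).
    apply: (nbrs_start _ m0); first exact: ltn_ord.
    - by rewrite d.
    - by rewrite -e2 d.
  split; first exact: pair.
  by apply: pair => //; rewrite ?e1 ?e2 em //= perm1.
have [e e'] := IH (ltnW q21); split=> //.
have /nblP[m mq [e1 e2]] := ad q.+1 q21.
rewrite e' /= inordK in mq e1; last by lia.
have q20 : q < 20 by lia.
have em : m = (None, q.+2).
  apply: (nbrs_next q20) => // [em|]; last by rewrite -e2 d.
  have /eqP[] := nb q q20; apply: (bij_inj kapB).
  by rewrite e; apply/esym/pair; rewrite ?e1 ?e2 ?em ?perm1 //; lia.
by apply: pair; rewrite ?e1 ?e2 ?em ?perm1.
Qed.

Lemma eG_gadget p x : kap p = (x, inord 0) -> exists c, gadget G p c.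
Proof.
case: (kapB) => kinv kK kK' kp; exists (fun r => kinv (x, inord r)); split.
- by rewrite -kp kK.
- by move=> r r22; rewrite card_nbhd_eG // kK' /= inordK.
- move=> r r21 /=; rewrite !kK'; apply/nblP; exists (None, r.+1).
    by rewrite /= inordK ?nbrs_succ //; lia.
  by rewrite /= perm1 inordK.
move=> r r20; apply/eqP => /(can_inj kK') [] /(congr1 val) /=.
by rewrite !inordK; lia.
Qed.

Lemma arcl_eG l p p' : arcl G l p p' -> exists x,
  kap p = (x, inord 0) /\ kap p' = (lval g l x, inord 0).
Proof.
case=> c [c' [gc gc']]; have [x cx] := gadget_eG gc; have [y cy] := gadget_eG gc'.
case: gc gc' => <- _ _ _ [<- _ _ _] /nblP [m].
rewrite cx ?out_port_lt // cy ?in_port_lt //= !inordK ?out_port_lt ?in_port_lt //.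
move=> mo [e1 e2]; exists x; rewrite cx // cy //; split=> //.
by move: e1; rewrite (nbrs_port mo (esym e2)) /= => ->.
Qed.

Lemma eG_arcl l p p' x : kap p = (x, inord 0) -> kap p' = (lval g l x, inord 0) ->
  arcl G l p p'.
Proof.
move=> kp kp'; have [c gc] := eG_gadget kp; have [c' gc'] := eG_gadget kp'.
exists c, c'; split=> //; have [y cy] := gadget_eG gc; have [y' cy'] := gadget_eG gc'.
have ex : y = x by have := cy 0 isT; case: gc => -> _ _ _; rewrite kp => -[].
have ex' : y' = lval g l x by have := cy' 0 isT; case: gc' => -> _ _ _; rewrite kp' => -[].
rewrite /= cy ?out_port_lt // cy' ?in_port_lt //; apply/nblP.
exists (Some l, in_port l); first by rewrite /= inordK ?out_port_lt // port_nbrs.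
by rewrite /= inordK ?in_port_lt // ex ex'.
Qed.

Lemma gadget_start_eG p c : gadget G p c -> exists x, kap p = (x, inord 0).
Proof. by move=> gc; have [x cx] := gadget_eG gc; exists x; case: gc => <- _ _ _; exact: cx. Qed.
End EncodingGadgets.

(** * Local embeddings *)

Section Balls.
Variables (N : nat) (G : sgraph N).

Fixpoint ball (v : 'I_N) (r : nat) : {set 'I_N} :=
  if r is r'.+1 then ball v r' :|: \bigcup_(w in ball v r') nbhd G w else [set v].

Lemma ballS v r : ball v r \subset ball v r.+1.
Proof. exact: subsetUl. Qed.

Lemma ball_le v r q w : r <= q -> w \in ball v r -> w \in ball v q.
Proof.
elim: q => [|q IH]; first by rewrite leqn0 => /eqP ->.
rewrite leq_eqVlt ltnS => /orP[/eqP -> //|rq /(IH rq)]; exact/subsetP/ballS.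
Qed.

Lemma ball_adj v r w u : w \in ball v r -> G w u -> u \in ball v r.+1.
Proof. by move=> wr wu; rewrite inE; apply/orP; right; apply/bigcupP; exists w; rewrite // inE. Qed.

Lemma ball_center v r : v \in ball v r.
Proof. by apply: (@ball_le v 0) => //; rewrite inE. Qed.

Lemma card_ball v r : max_degree_le 3 G -> #|ball v r| <= 4 ^ r.
Proof.
move=> dG; elim: r => [|r IH]; first by rewrite cards1.
rewrite expnS mulSn; apply: leq_trans (leq_card_setU _ _) _; apply: leq_add => //.
apply: leq_trans (_ : 3 * #|ball v r| <= _); last by rewrite leq_mul2l.
rewrite -[#|ball v r|]sum1_card big_distrr /=.
apply: leq_trans (_ : \sum_(w in ball v r) #|nbhd G w| <= _).
  elim/big_ind2: _ => [|A a B b hA hB|w _]; rewrite ?cards0 //.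
  by apply: leq_trans (leq_card_setU _ _) _; apply: leq_add.
by apply: leq_sum => w _; rewrite muln1 dG.
Qed.

Lemma ball_path v r (c : nat -> 'I_N) k : c 0 \in ball v r ->
  (forall i, i < k -> G (c i) (c i.+1)) -> forall i, i <= k -> c i \in ball v (r + i).
Proof.
move=> c0 ad; elim=> [|i IH] ik; first by rewrite addn0.
by rewrite addnS; apply: ball_adj (ad _ ik); apply: IH; apply: ltnW.
Qed.
End Balls.

Section Gadgets.
Variables (N : nat) (G : sgraph N).

Lemma gadget_ball v r p c : gadget G p c -> p \in ball G v r ->
  forall q, q < 22 -> c q \in ball G v (r + q).
Proof.
by case=> c0 _ ad _ pv q q22; apply: (@ball_path _ _ _ _ c 21) => //; rewrite c0.
Qed.

Lemma gadget_ball_start v r p c q : gadget G p c -> q < 22 -> c q \in ball G v r ->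
  p \in ball G v (r + q).
Proof.
case=> c0 _ ad _ q22 cv.
have -> : p = (fun i => c (q - i)) q by rewrite subnn.
apply: (@ball_path _ _ _ _ (fun i => c (q - i)) q) => //; first by rewrite subn0.
move=> i iq; rewrite edge_sym (_ : q - i = (q - i.+1).+1); last by lia.
by apply: ad; lia.
Qed.

(** At most 21 steps to the port, one along the edge, and at most 21 back to the other start. *)
Lemma arcl_ball v r l p p' : arcl G l p p' -> p \in ball G v r -> p' \in ball G v (r + 44).
Proof.
case=> c [c' [gc gc' e]] pv; have o22 := out_port_lt l; have i22 := in_port_lt l.
have := ball_adj (gadget_ball gc pv o22) e => /(gadget_ball_start gc' i22).
by apply: ball_le; lia.
Qed.

Lemma arcl_sym l p p' : arcl G l p p' -> arcl G (inv_letter l) p' p.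
Proof.
case=> c [c' [gc gc' e]]; exists c', c; split=> //.
by move: e; rewrite edge_sym; case: l => i [].
Qed.
End Gadgets.

(** Injectivity extends one step beyond the ball of radius [R], so that the neighbours of its
    vertices stay distinct and degrees are preserved there. *)
Definition lembed N M (G : sgraph N) (G' : sgraph M) (v : 'I_N) (R : nat)
    (f : 'I_N -> 'I_M) : Prop :=
  {in ball G v R.+1 &, injective f} /\
  forall w, w \in ball G v R -> f @: nbhd G w = nbhd G' (f w).

(** * Gadgets and arcs under local embeddings *)

Section Transfer.
Variables (N M : nat) (G : sgraph N) (G' : sgraph M) (v : 'I_N) (R : nat).
Variable f : 'I_N -> 'I_M.
Hypothesis fL : lembed G G' v R f.

Lemma lembed_adj w u : w \in ball G v R -> G w u -> G' (f w) (f u).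
Proof.
case: fL => _ h wv wu; have : f u \in nbhd G' (f w) by rewrite -h // imset_f // inE.
by rewrite inE.
Qed.

Lemma lembed_lift w y : w \in ball G v R -> G' (f w) y -> exists2 u, G w u & f u = y.
Proof.
case: fL => _ h wv wy; have : y \in nbhd G' (f w) by rewrite inE.
by rewrite -h // => /imsetP[u]; rewrite inE => ? ->; exists u.
Qed.

Lemma lembed_deg w : w \in ball G v R -> #|nbhd G' (f w)| = #|nbhd G w|.
Proof.
case: fL => fI h wv; rewrite -h // card_in_imset // => x y; rewrite !inE => wx wy.
by apply: fI; apply: ball_adj wv _.
Qed.

Lemma gadget_push p c r : r + 22 <= R -> p \in ball G v r -> gadget G p c ->
  gadget G' (f p) (f \o c).
Proof.
move=> rR pv gc; have cb := gadget_ball gc pv.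
have cR q : q < 22 -> c q \in ball G v R by move=> q22; apply: ball_le (cb _ q22); lia.
case: gc => c0 dg ad nb; split=> [|q q22|q q21|q q20] /=.
- by rewrite c0.
- by rewrite lembed_deg ?dg ?cR.
- by apply: lembed_adj; [apply: cR; lia|apply: ad].
have := nb q q20; apply: contra => /eqP e; apply/eqP; case: fL => fI _.
by apply: fI e; apply: (@ball_le _ _ _ R) => //; apply: cR; lia.
Qed.

Lemma path_lift p (c' : nat -> 'I_M) r k : r + k <= R.+1 -> p \in ball G v r -> c' 0 = f p ->
  (forall i, i < k -> G' (c' i) (c' i.+1)) ->
  exists c : nat -> 'I_N, [/\ c 0 = p, forall i, i < k -> G (c i) (c i.+1) &
    forall i, i <= k -> f (c i) = c' i].
Proof.
move=> rR pv c0 ad.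
(* The default [p] is not taken in the first [k] steps, where [main] shows that a neighbour above
   the next vertex exists. *)
pose c := fix c i := if i is i'.+1 then odflt p [pick u | G (c i') u && (f u == c' i)]
                     else p.
have main i : i <= k -> [/\ c i \in ball G v (r + i), f (c i) = c' i
                         & forall j, j < i -> G (c j) (c j.+1)].
  elim: i => [|i IH] ik; first by rewrite addn0.
  have [cb fc adc] := IH (ltnW ik).
  have ciR : c i \in ball G v R by apply: ball_le cb; lia.
  have [u cu fu] : exists2 u, G (c i) u & f u = c' i.+1.
    by apply: lembed_lift ciR _; rewrite fc; apply: ad.
  have [e1 e2] : G (c i) (c i.+1) /\ f (c i.+1) = c' i.+1.
    rewrite /=; case: pickP => [w /andP[? /eqP ?] //|/(_ u)].
    by rewrite cu fu eqxx.
  split=> //; first by rewrite addnS; apply: ball_adj cb e1.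
  by move=> j; rewrite ltnS leq_eqVlt => /orP[/eqP -> //|/adc].
exists c; split=> // i ik; last by case: (main i ik).
by case: (main i.+1 ik) => _ _; apply.
Qed.

Lemma gadget_lift p c' r : r + 22 <= R -> p \in ball G v r -> gadget G' (f p) c' ->
  exists2 c, gadget G p c & forall q, q < 22 -> f (c q) = c' q.
Proof.
move=> rR pv [c0 dg ad nb].
have [|c [c00 adc fc]] := @path_lift p c' r 21 _ pv c0 ad; first by lia.
have fc' q : q < 22 -> f (c q) = c' q by move=> q22; apply: fc.
exists c => //; split=> // q q22.
  rewrite -lembed_deg ?fc' ?dg //.
  have : c q \in ball G v (r + q) by apply: (@ball_path _ _ _ _ c 21); rewrite ?c00.
  by apply: ball_le; lia.
have := nb q q22; apply: contra => /eqP e.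
by rewrite -!fc' ?e //; lia.
Qed.

Lemma arcl_push l p p' r : r + 70 <= R -> p \in ball G v r -> arcl G l p p' ->
  arcl G' l (f p) (f p').
Proof.
move=> rR pv pa; have pv' := arcl_ball pa pv; case: pa => c [c' [gc gc' e]].
exists (f \o c), (f \o c'); split.
- by apply: gadget_push pv gc; lia.
- by apply: gadget_push pv' gc'; lia.
apply: lembed_adj e => //; have := gadget_ball gc pv (out_port_lt l).
by apply: ball_le; have := out_port_lt l; lia.
Qed.

Lemma arcl_lift l p y r : r + 70 <= R -> p \in ball G v r -> arcl G' l (f p) y ->
  exists2 p', arcl G l p p' & f p' = y.
Proof.
move=> rR pv [d [d' [gd' gy e]]]; have o22 := out_port_lt l; have i22 := in_port_lt l.
have [|c gc fc] := gadget_lift _ pv gd'; first by lia.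
have cv := gadget_ball gc pv o22.
have [w cw fw] : exists2 w, G (c (out_port l)) w & f w = d' (in_port l).
  by apply: lembed_lift; [apply: ball_le cv; lia|rewrite fc].
have wv := ball_adj cv cw.
(* The start of the second gadget is not known yet: it is found by lifting the path backwards from
   the port [w]. The gadget is then lifted forwards from that start, and injectivity of [f] brings
   it back to [w]. *)
have [|||c1 [c10 ad1 fc1]] := @path_lift w (fun i => d' (in_port l - i)) _ (in_port l) _ wv.
- by lia.
- by rewrite fw subn0.
- case: gy => _ _ ad _ i iq; rewrite edge_sym (_ : in_port l - i = (in_port l - i.+1).+1).
    by apply: ad; lia.
  by lia.
set p' := c1 (in_port l).
have fp' : f p' = y by rewrite /p' fc1 // subnn; case: gy.
have pv' : p' \in ball G v ((r + out_port l).+1 + 22).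
  have := @ball_path _ G v _ c1 (in_port l) _ ad1 _ (leqnn _).
  by rewrite c10 => /(_ _ wv); apply: ball_le; lia.
have [||c' gc' fc'] := @gadget_lift p' d' _ _ pv' _; [by lia|by rewrite fp'|].
exists p' => //; exists c, c'; split=> //.
suff -> : c' (in_port l) = w by [].
case: fL => fI _; apply: fI; last by rewrite fc'.
- by have := gadget_ball gc' pv' i22; apply: ball_le; lia.
- by apply: ball_le wv; lia.
Qed.

End Transfer.

(** * Decoding *)

(** Everything small that occurs in no encoding on [N] vertices is forbidden, so encodings of
    gamma-sets are free by construction. The content is the converse, that a free graph contains a
    gamma-set. *)
Definition forb (s : nat) : Defs.family := fun N F =>
  msize F <= s /\
  forall (P : finType) (g : gen -> {perm P}) (kap : 'I_N -> P * 'I_22),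
    gamma g -> bijective kap -> ~ exists f, embedding (F := F) (eG g kap) f.

Definition locally_gamma N (G : sgraph N) (R : nat) : Prop := forall v : 'I_N,
  exists (P : finType) (g : gen -> {perm P}) (kap : 'I_N -> P * 'I_22)
         (f : 'I_N -> 'I_N),
    [/\ gamma g, bijective kap & lembed G (eG g kap) v R f].

(** * Balls as marked graphs *)

Section BallGraph.
Variables (N : nat) (G : sgraph N) (v : 'I_N) (R : nat).
Let B := ball G v R.+1.
Definition ball_edge (i j : 'I_#|B|) : bool := G (enum_val i) (enum_val j).
Lemma ball_edge_sym : symmetric ball_edge.
Proof. by move=> i j; apply: edge_sym. Qed.
Lemma ball_edge_irr : irreflexive ball_edge.
Proof. by move=> i; apply: edge_irr. Qed.
(** Interior vertices are full, which fixes their neighbourhoods exactly. Vertices of the outer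
    sphere may have neighbours outside the ball and can only be partial. *)
Definition ball_graph : marked_graph :=
  @MarkedGraph #|B| (SGraph ball_edge_sym ball_edge_irr)
    (fun i => if enum_val i \in ball G v R then Full else Partial).

Lemma ball_graph_embedding : embedding (F := ball_graph) G (@enum_val _ (mem B)).
Proof.
split=> [|i]; first exact: enum_val_inj.
have sub : [set enum_val j | j in nbhd1 ball_graph i] \subset nbhd1 G (enum_val i).
  apply/subsetP => _ /imsetP[j + ->]; rewrite !inE => /orP[/eqP ->|]; first by rewrite eqxx.
  by rewrite /= /ball_edge => ->; rewrite orbT.
rewrite /=; case: ifP => // iv; apply/eqP; rewrite eqEsubset sub andbT.
apply/subsetP => w wi; have wB : w \in B.
  move: wi; rewrite in_setU1 => /orP[/eqP ->|]; first exact: enum_valP.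
  by rewrite inE; exact: ball_adj iv.
apply/imsetP; exists (enum_rank_in wB w); last by rewrite enum_rankK_in.
move: wi; rewrite !inE /= /ball_edge enum_rankK_in // => /orP[/eqP e|->].
  by apply/orP; left; apply/eqP/enum_val_inj; rewrite enum_rankK_in.
by rewrite orbT.
Qed.
End BallGraph.

(** The ball around [v] embeds into [G] and hence is not forbidden. Being small, it must then embed
    into some encoding, and that embedding is the local one sought. *)
Lemma forb_locally s R N (G : sgraph N) : F_free (forb s N) G ->
  (forall v, #|ball G v R.+1| <= s) -> locally_gamma G R.
Proof.
move=> free card v.
have : ~ forb s N (ball_graph G v R).
  by move=> /free; apply; exists (@enum_val _ (mem (ball G v R.+1))); apply: ball_graph_embedding.
move=> /not_andP [/(_ (card v)) //|] /existsNP[P] /existsNP[g] /existsNP[kap].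
move=> /not_implyP[gg] /not_implyP[kB] /contrapT[h [hI hE]].
have vB : v \in ball G v R.+1 by apply: ball_center.
(* Vertices outside the ball are treated like [v]; a local embedding does not look at them. *)
exists P, g, kap, (fun w => h (enum_rank_in vB w)); split=> //; split.
  move=> x y xB yB /hI e; rewrite -(enum_rankK_in vB xB) -(enum_rankK_in vB yB).
  by rewrite e.
move=> w wv; have wB : w \in ball G v R.+1 by apply: ball_le wv.
have := hE (enum_rank_in vB w); rewrite /= enum_rankK_in // wv => e.
have irr (M : nat) (K : sgraph M) u : nbhd K u = nbhd1 K u :\ u.
  apply/setP => z; rewrite !inE; case: (eqVneq z u) => [->|] //=.
  by rewrite edge_irr.
rewrite [RHS]irr e; apply/setP => z; apply/imsetP/setD1P => [[u]|].
  rewrite inE => wu ->; have uB := ball_adj wv wu; split.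
    apply/eqP => /hI e'; have : u = w.
      by rewrite -(enum_rankK_in vB uB) e' enum_rankK_in.
    by move=> e''; rewrite e'' edge_irr in wu.
  apply/imsetP; exists (enum_rank_in vB u) => //.
  by rewrite !inE /= /ball_edge !enum_rankK_in // wu orbT.
case=> zw /imsetP[j]; rewrite !inE => /orP[/eqP ->|]; first by move=> e'; rewrite e' eqxx in zw.
rewrite /= /ball_edge enum_rankK_in // => wj ->; exists (enum_val j); rewrite ?inE //.
by rewrite enum_valK_in.
Qed.

Definition start_point N (G : sgraph N) : pred 'I_N :=
  fun p => `[< exists c, gadget G p c >].

(** * The gamma-set of start points *)

Section Decode.
Variables (N : nat) (G : sgraph N).
Hypothesis loc : locally_gamma G 400.
Local Notation X := {p : 'I_N | start_point G p}.

Lemma arcl_exists l (p : 'I_N) : start_point G p -> exists p', arcl G l p p'.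
Proof.
move=> /asboolP[c gc]; have [P [g [kap [f [gg kB fL]]]]] := loc p.
have [x kx] := gadget_start_eG kB (gadget_push (r := 0) fL isT (ball_center _ _ _) gc).
case: (kB) => kinv kK kK'.
have [|p' ? _] := arcl_lift (l := l) (r := 0) (y := kinv (lval g l x, inord 0)) fL isT (ball_center G p 0).
  by apply: (eG_arcl kB kx); rewrite kK'.
by exists p'.
Qed.

Lemma arcl_push_eG (v p p' : 'I_N) l r (P : finType) (g : gen -> {perm P})
    (kap : 'I_N -> P * 'I_22) (f : 'I_N -> 'I_N) x :
  bijective kap -> lembed G (eG g kap) v 400 f -> r + 70 <= 400 -> p \in ball G v r ->
  arcl G l p p' -> kap (f p) = (x, inord 0) -> kap (f p') = (lval g l x, inord 0).
Proof.
move=> kB fL rR pv /(arcl_push fL rR pv) /(arcl_eG kB)[y [-> ->]].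
by case=> ->.
Qed.

Lemma arcl_fun l (p p1 p2 : 'I_N) : arcl G l p p1 -> arcl G l p p2 -> p1 = p2.
Proof.
move=> a1 a2; have [P [g [kap [f [gg kB fL]]]]] := loc p.
have [c [_ [gc _ _]]] := a1.
have [x kx] := gadget_start_eG kB (gadget_push (r := 0) fL isT (ball_center _ _ _) gc).
have e1 := arcl_push_eG (r := 0) kB fL isT (ball_center _ _ _) a1 kx.
have e2 := arcl_push_eG (r := 0) kB fL isT (ball_center _ _ _) a2 kx.
have b1 := arcl_ball (r := 0) a1 (ball_center _ _ _).
have b2 := arcl_ball (r := 0) a2 (ball_center _ _ _).
case: fL => fI _; apply: fI; [exact: ball_le b1|exact: ball_le b2|].
by apply: (bij_inj kB); rewrite e1 e2.
Qed.

Lemma arcl_start l p p' : arcl G l p p' -> start_point G p /\ start_point G p'.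
Proof. by case=> c [c' [gc gc' _]]; split; apply/asboolP; [exists c|exists c']. Qed.

Lemma next_ex l (p : X) : exists p' : X, `[< arcl G l (val p) (val p') >].
Proof.
have [p' a] := arcl_exists l (valP p); have [_ sp'] := arcl_start a.
by exists (exist _ p' sp'); apply/asboolP.
Qed.
Definition next l (p : X) : X := xchoose (next_ex l p).
Lemma nextP l p : arcl G l (val p) (val (next l p)).
Proof. exact/asboolP/(xchooseP (next_ex l p)). Qed.

Lemma next_inj i : injective (next (i, false)).
Proof.
move=> p q e; apply: val_inj; have := arcl_sym (nextP (i, false) p).
by rewrite e => /arcl_fun; apply; apply: arcl_sym (nextP _ _).
Qed.

Definition gX (i : gen) : {perm X} := perm (@next_inj i).

Lemma lval_gX l p : arcl G l (val p) (val (lval gX l p)).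
Proof.
case: l => i []; rewrite /lval /=; last by rewrite permE; apply: nextP.
have := arcl_sym (nextP (i, false) ((gX i)^-1%g p)).
by rewrite -[next _ _](permE (@next_inj i)) permKV.
Qed.

Lemma gX_arcl i (p p' : X) : arcl G (i, false) (val p) (val p') -> gX i p = p'.
Proof.
by move=> a; apply: val_inj; apply: arcl_fun a; apply: (lval_gX (i, false) p).
Qed.

Lemma wval_gX (v : 'I_N) (P : finType) (g : gen -> {perm P})
    (kap : 'I_N -> P * 'I_22) (f : 'I_N -> 'I_N) (w : word) r x (p : X) :
  bijective kap -> lembed G (eG g kap) v 400 f -> r + 44 * size w + 70 <= 400 ->
  val p \in ball G v r -> kap (f (val p)) = (x, inord 0) ->
  val (wval gX w p) \in ball G v (r + 44 * size w) /\
  kap (f (val (wval gX w p))) = (wval g w x, inord 0).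
Proof.
move=> kB fL; elim: w r x p => [|l w IH] r x p rR pv kp.
  by rewrite /= muln0 addn0 !perm1.
rewrite /= in rR.
have a := lval_gX l p.
have := IH (r + 44) (lval g l x) (lval gX l p); rewrite /wval /= !permM -!/(wval _ _).
case; first by lia.
- exact: arcl_ball a pv.
- by apply: (arcl_push_eG kB fL _ pv a kp); lia.
by move=> b e; split=> //; apply: ball_le b; lia.
Qed.

(** Each side of a relator has at most five letters, so following it needs radius 5 * 44 + 70 = 290,
    below 400. The local model satisfies the relator, and injectivity of [f] pulls the equality
    back. *)
Lemma gamma_gX : gamma gX.
Proof.
move=> i; set rl := nth _ _ i.
have /andP[s1 s2] : (size rl.1 <= 5) && (size rl.2 <= 5).
  have /all_nthP h : all (fun r : word * word => (size r.1 <= 5) && (size r.2 <= 5)) relators by [].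
  case: (ltnP i (size relators)) => [/h|]; first by apply.
  by move=> si; rewrite /rl nth_default.
apply/permP => p; have [P [g [kap [f [gg kB fL]]]]] := loc (val p).
have /asboolP[c gc] := valP p.
have [x kx] := gadget_start_eG kB (gadget_push (r := 0) fL isT (ball_center _ _ _) gc).
have [|b1 e1] := wval_gX (r := 0) (w := rl.1) kB fL _ (ball_center _ _ _) kx; first by lia.
have [|b2 e2] := wval_gX (r := 0) (w := rl.2) kB fL _ (ball_center _ _ _) kx; first by lia.
apply: val_inj; case: fL => fI _; apply: fI.
- by apply: ball_le b1; lia.
- by apply: ball_le b2; lia.
by apply: (bij_inj kB); rewrite e1 e2 (gg i).
Qed.

(** Gadgets of distinct start points are disjoint: two that share a vertex have starts within
    distance 50, so one local model sees both, and there the shared vertex determines the point. *)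
Lemma card_start : #|{: X}| * 22 <= N.
Proof.
have cE (p : X) : exists c, gadget G (val p) c by apply/asboolP/(valP p).
pose c (p : X) := projT1 (cid (cE p)).
have cP p : gadget G (val p) (c p) by exact: (projT2 (cid (cE p))).
pose h (z : X * 'I_22) := c z.1 z.2.
have hI : injective h.
  case=> p r [q t]; rewrite /h /= => e.
  have [P [g [kap [f [gg kB fL]]]]] := loc (val p).
  have gp := gadget_push (r := 0) fL isT (ball_center _ _ _) (cP p).
  have qb : val q \in ball G (val p) 50.
    have := gadget_ball (r := 0) (cP p) (ball_center _ _ _) (ltn_ord r); rewrite e.
    move=> /(gadget_ball_start (cP q) (ltn_ord t)); apply: ball_le.
    by have := ltn_ord r; have := ltn_ord t; lia.
  have gq := gadget_push (r := 50) fL isT qb (cP q).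
  have [x ex] := gadget_eG kB gp; have [y ey] := gadget_eG kB gq.
  have := ex r (ltn_ord r); rewrite /= e -[f _]/((f \o c q) t) (ey t (ltn_ord t)).
  case=> exy /(congr1 val) /=; rewrite !inordK ?ltn_ord // => ert.
  suff epq : p = q by rewrite epq; congr (_, _); apply: val_inj.
  apply: val_inj; case: fL => fI _; apply: fI.
  - exact: ball_center.
  - exact: ball_le qb.
  apply: (bij_inj kB); have := ex 0 isT; have := ey 0 isT.
  by case: gp => -> _ _ _; case: gq => -> _ _ _ -> ->; rewrite exy.
by have := leq_card h hI; rewrite card_prod !card_ord.
Qed.
End Decode.

(** * Distance to the property *)

Section FirstReturn.
Variables (H : finType) (g : {perm H}) (A : pred H).
Local Notation S := {x : H | A x}.

Lemma return_ex (x : S) : exists m, A ((g ^+ m.+1)%g (val x)).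
Proof.
exists #[g]%g.-1; rewrite prednK ?order_gt0 // expg_order perm1; exact: valP.
Qed.

Definition return_time x := ex_minn (return_ex x).

Lemma returnP x : A ((g ^+ (return_time x).+1)%g (val x)).
Proof. by rewrite /return_time; case: ex_minnP. Qed.

Lemma return_min x m : A ((g ^+ m.+1)%g (val x)) -> return_time x <= m.
Proof. by rewrite /return_time; case: ex_minnP => k _ h /h. Qed.

(** After points are deleted, the first return keeps each generator a permutation and changes it
    only where the image was deleted; the relators may fail near such points. *)
Definition first_return (x : S) : S := Sub _ (returnP x).

Lemma first_return_inj : injective first_return.
Proof.
move=> x y /(congr1 val) /=.
wlog le : x y / return_time x <= return_time y.
  by move=> h e; case/orP: (leq_total (return_time x) (return_time y)) => l;
     [apply: h|apply/esym/h].
rewrite -(subnK le) -addnS expgD permM => /perm_inj.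
case: (posnP (return_time y - return_time x)) => [->|d0 e].
  by rewrite expg0 perm1 => /val_inj.
have : A ((g ^+ (return_time y - return_time x).-1.+1)%g (val y)).
  by rewrite prednK // -e; exact: valP.
by move/return_min; lia.
Qed.

Definition return_perm : {perm S} := perm first_return_inj.

Lemma return_permP (x y : S) : g (val x) = val y -> return_perm x = y.
Proof.
move=> e; apply: val_inj; rewrite permE /=.
have -> : return_time x = 0.
  by apply/eqP; rewrite -leqn0; apply: return_min; rewrite expg1 e; exact: valP.
by rewrite expg1.
Qed.
End FirstReturn.

Lemma card_changed N (G G' : sgraph N) :
  #|[set v | nbhd G v != nbhd G' v]| <= 2 * edit_distance G G'.
Proof.
set S := [set p : 'I_N * 'I_N | (p.1 < p.2) && (G p.1 p.2 != G' p.1 p.2)].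
have sub : [set v | nbhd G v != nbhd G' v] \subset (fst @: S) :|: (snd @: S).
  apply/subsetP => v; rewrite inE => ne.
  have [u vu] : exists u, G v u != G' v u.
    apply/existsP; apply: contraNT ne; rewrite negb_exists => /forallP h.
    by apply/eqP/setP => u; rewrite !inE; apply/eqP; rewrite -[_ == _]negbK h.
  rewrite inE; case: (ltngtP v u) => [lt|lt|/val_inj e].
  - by apply/orP; left; apply/imsetP; exists (v, u); rewrite ?inE ?lt.
  - apply/orP; right; apply/imsetP; exists (u, v); rewrite ?inE ?lt //=.
    by rewrite !(edge_sym _ u).
  - by move: vu; rewrite e !edge_irr.
apply: leq_trans (subset_leq_card sub) _.
apply: leq_trans (leq_card_setU _ _) _; rewrite mul2n -addnn.
by apply: leq_add; apply: leq_imset_card.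
Qed.

(** * Distance of a punctured plane from locally gamma graphs *)

Section Far.
Variables (H P : finType) (gH : gen -> {perm H}) (g : gen -> {perm P}).
Variables (emb : P -> H) (N : nat) (kap : 'I_N -> P * 'I_22) (G : sgraph N).
Hypotheses (hH : gamma gH) (embI : injective emb).
Hypothesis transH : forall h h' : H, exists i1 i2 : nat, exists m1 m2 : bool,
  ((trans1 gH i1 ^+ m1 * trans2 gH i2 ^+ m2)%g : {perm H}) h = h'.
Hypothesis gemb : forall i x y, gH i (emb x) = emb y -> g i x = y.
Hypothesis kapB : bijective kap.
Hypothesis loc : locally_gamma G 400.
Hypothesis ltPH : #|P| < #|H|.

Local Notation NO := (eG g kap).
Local Notation X := {p : 'I_N | start_point G p}.

Let same v := nbhd G v == nbhd NO v.
Definition clean (x : P) : bool := [forall v, ((kap v).1 == x) ==> same v].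

Lemma card_clean : #|P| - 2 * edit_distance NO G <= #|[set x | clean x]|.
Proof.
rewrite leq_subLR addnC -cardsT.
have sub : [set: P] \subset [set x | clean x] :|: [set (kap v).1 | v in [set v | ~~ same v]].
  apply/subsetP => x _; rewrite !inE; case: (boolP (clean x)) => //= /forallPn[v].
  rewrite negb_imply => /andP[/eqP <- h]; apply: imset_f; by rewrite inE.
apply: leq_trans (subset_leq_card sub) _; apply: leq_trans (leq_card_setU _ _) _.
rewrite leq_add2l; apply: leq_trans (leq_imset_card _ _) _.
apply: leq_trans (card_changed NO G); apply: subset_leq_card.
by apply/subsetP => v; rewrite !inE eq_sym.
Qed.

Lemma clean_gadget x p : clean x -> kap p = (x, inord 0) ->
  exists2 c, gadget G p c & forall r, r < 22 -> kap (c r) = (x, inord r).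
Proof.
move=> cx kp; have [c gc] := eG_gadget g kapB kp.
have [y cy] := gadget_eG kapB gc.
have ey : y = x by have := cy 0 isT; case: (gc) => -> _ _ _; rewrite kp => -[].
rewrite {}ey in cy; exists c => //.
have sm r : r < 22 -> nbhd G (c r) = nbhd NO (c r).
  by move=> r22; apply/eqP; move/forallP/(_ (c r)): cx; rewrite cy // eqxx.
case: gc => c0 dg ad nb; split=> // r r22; first by rewrite sm // dg.
have : c r.+1 \in nbhd G (c r) by rewrite sm ?inE ?ad //; lia.
by rewrite inE.
Qed.

Lemma clean_arcl i x y p q : clean x -> clean y -> g i x = y ->
  kap p = (x, inord 0) -> kap q = (y, inord 0) -> arcl G (i, false) p q.
Proof.
move=> cx cy gxy kp kq; have [c gc ec] := clean_gadget cx kp.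
have [d gd' ed] := clean_gadget cy kq; exists c, d; split=> //.
have o22 := out_port_lt (i, false); have i22 := in_port_lt (i, false).
have : d (in_port (i, false)) \in nbhd G (c (out_port (i, false))).
  move/forallP/(_ (c (out_port (i, false)))): cx; rewrite ec // eqxx => /eqP ->.
  rewrite inE /= ec // ed //; apply/nblP; exists (Some (i, false), in_port (i, false)).
    by rewrite /= inordK // port_nbrs.
  by rewrite /= inordK.
by rewrite inE.
Qed.

(** [W] pairs the start point of each clean path, a point of the decoded set [X], with its image in
    [H]. It leaves out of [H] only the deleted points and the at most twice [edit_distance NO G]
    spoilt ones, so the assumption makes it almost invariant and rigidity makes it empty. *)
Lemma edit_distance_large :
  2000 * (#|H| - #|P| + 2 * edit_distance NO G) <= #|P| - 2 * edit_distance NO G ->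
  #|P| <= 2 * edit_distance NO G.
Proof.
move=> le; have cc := card_clean.
pose W := [set w : X * H | [exists x, [&& clean x, w.2 == emb x
   & kap (val w.1) == (x, inord 0)]]].
have WP w : w \in W -> exists x, [/\ clean x, w.2 = emb x & kap (val w.1) = (x, inord 0)].
  by rewrite inE => /existsP[x /and3P[? /eqP ? /eqP ?]]; exists x.
have cleanW x : clean x -> exists2 w, w \in W & w.2 = emb x.
  move=> cx; case: (kapB) => kinv kK kK'.
  have kp : kap (kinv (x, inord 0)) = (x, inord 0) by rewrite kK'.
  have [c gc _] := clean_gadget cx kp.
  have sp : start_point G (kinv (x, inord 0)) by apply/asboolP; exists c.
  exists (exist (start_point G) _ sp, emb x) => //; rewrite inE; apply/existsP; exists x.
  by rewrite cx /= kp !eqxx.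
have W2 : {in W &, injective (fun w : X * H => w.2)}.
  move=> [p h] [q h'] /WP[x [cx /= -> kp]] /WP[y [cy /= -> kq]] /embI e.
  rewrite e in kp *; congr (_, _); apply/val_inj/(bij_inj kapB).
  by rewrite kp kq.
have W1 : {in W &, forall w w', w.1 = w'.1 -> w = w'}.
  move=> w w' wW wW' e; apply: W2 => //.
  case: (WP w wW) => x [_ -> kx]; case: (WP w' wW') => y [_ -> ky].
  by move: ky; rewrite -e kx => -[->].
have snd_image : [set w.2 | w in W] = emb @: [set x | clean x].
  apply/setP => h; apply/imsetP/imsetP => [[w wW ->]|[x]].
    by case: (WP w wW) => x [cx -> _]; exists x; rewrite ?inE.
  by rewrite inE => /cleanW[w wW <-] ->; exists w.
have cW : #|W| = #|[set x | clean x]|.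
  by rewrite -(card_in_imset W2) snd_image card_imset.
suff W0 : W = set0 by move: cc; rewrite -cW W0 cards0; lia.
have ltXH : #|{: X}| < #|H|.
  have eN : N = #|P| * 22 by have := bij_eq_card kapB; rewrite card_prod !card_ord.
  have : #|{: X}| * 22 <= #|P| * 22 by rewrite -eN; exact: card_start.
  by rewrite leq_pmul2r // => h; apply: leq_ltn_trans h ltPH.
apply: (@rigidity rat _ _ (gX loc) gH (gamma_gX loc) hH ltXH transH W W1) => i.
set Bd := [set w in W | _].
(* A pair leaves [W] only if its image in [H] is not a clean point: between clean points the arc
   survives in [G], and the decoded generator follows it. *)
have cB : #|Bd| <= #|H| - #|W|.
  have -> : #|H| - #|W| = #|~: (emb @: [set x | clean x])|.
    by rewrite [RHS]cardsCs setCK card_imset // cW.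
  have inj : {in Bd &, injective (fun w : X * H => gH i w.2)}.
    by move=> w w'; rewrite !inE => /andP[wW _] /andP[wW' _] /perm_inj; apply: W2; rewrite inE.
  rewrite -(card_in_imset inj); apply: subset_leq_card; apply/subsetP => _ /imsetP[w wB ->].
  rewrite inE; apply/imsetP => -[y]; rewrite inE => cy e.
  move: wB; rewrite in_set => /andP[wW /negP]; apply.
  have [x [cx e2 kx]] := WP w wW; rewrite e2 in e *.
  have gxy := gemb e; have [[q h] qW /= eh] := cleanW y cy.
  have [y' [_ /= eh' kq]] := WP _ qW.
  have ey : y' = y by apply: embI; rewrite -eh' eh.
  rewrite {}ey in kq.
  have -> // : (gX loc i w.1, gH i (emb x)) = (q, h).
  rewrite e eh; congr (_, _); apply: gX_arcl.
  exact: (clean_arcl cx cy gxy kx kq).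
have : #|W| <= #|P| by rewrite cW; apply: max_card.
move: cc le cB ltPH; rewrite -cW; move: #|W| #|P| #|H| #|Bd| (edit_distance _ _).
by clear=> *; lia.
Qed.
End Far.

(** * The affine plane over a field of characteristic 2 *)

Section PlaneTheory.
Local Open Scope ring_scope.

(** As the powers of [gf_gen] exhaust the nonzero elements, every nonzero translation of one
    coordinate is a single conjugate of [a] by a power of [D]. The condition on [1 + gf_gen] makes
    [T] invertible and excludes the field with two elements. *)
Record gen_field := GenField {
  gf_sort :> finFieldType;
  gf_gen : gf_sort;
  gf_char2 : 1 + 1 = 0 :> gf_sort;
  gf_gen0 : gf_gen != 0;
  gf_gen1 : 1 + gf_gen != 0;
  gf_span : forall y : gf_sort, y != 0 -> exists i : nat, y = gf_gen ^+ i }.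

Lemma gen_field_exists k : (1 < k)%N -> exists K : gen_field, #|K| = (2 ^ k)%N.
Proof.
move=> k1; have [K charK cardK] := @PrimePowerField 2 k isT (ltnW k1).
have /cyclicP[s sE] := field_unit_group_cyclic [set: {unit K}]%G.
have char2 : 1 + 1 = 0 :> K by have := pcharf0 charK; rewrite mulr2n.
have span (y : K) : y != 0 -> exists i : nat, y = val s ^+ i.
  rewrite -unitfE => yU; have : FinRing.Unit yU \in [set: {unit K}] by rewrite inE.
  rewrite -[[set: _]]/(gval [set: {unit K}]%G) sE => /cycleP[i /(congr1 val)].
  by rewrite FinRing.val_unitX => e; exists i.
have s0 : val s != 0 by rewrite -unitfE; exact: (valP s).
have s1 : 1 + val s != 0.
  apply/negP => /eqP e; have es : val s = 1.
    by apply: (addrI 1); rewrite e char2.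
  have : (#|K| <= 2)%N.
    have c2 : (#|[set 0%R; 1%R : K]| <= 2)%N by rewrite cards2; case: (_ != _).
    apply: leq_trans c2.
    rewrite -cardsT; apply: subset_leq_card; apply/subsetP => y _; rewrite !inE.
    case: (eqVneq y 0) => //= /span[i ->]; by rewrite es expr1n eqxx.
  by rewrite cardK leqNgt -{1}(expn1 2) ltn_exp2l // k1.
by exists (GenField char2 s0 s1 span).
Qed.

Section Plane.
Variable K : gen_field.
Local Notation s := (gf_gen K).
Local Notation H := (K * K)%type.

Let s0 : s != 0 := gf_gen0 K.
Let t0 : 1 + s != 0 := gf_gen1 K.

Definition fa (z : H) : H := (z.1 + 1, z.2).
Definition fd (z : H) : H := (z.1 * s, z.2).
Definition ft (z : H) : H := (z.1 * (1 + s), z.2).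
Definition fs (z : H) : H := (z.2, z.1).
Definition fe (z : H) : H := (z.1, z.1 + z.2).
Definition faV (z : H) : H := (z.1 - 1, z.2).
Definition fdV (z : H) : H := (z.1 / s, z.2).
Definition ftV (z : H) : H := (z.1 / (1 + s), z.2).
Definition feV (z : H) : H := (z.1, z.2 - z.1).

Lemma faK : cancel fa faV. Proof. by case=> x y; rewrite /faV /= addrK. Qed.
Lemma fdK : cancel fd fdV. Proof. by case=> x y; rewrite /fdV /= mulfK. Qed.
Lemma ftK : cancel ft ftV. Proof. by case=> x y; rewrite /ftV /= mulfK. Qed.
Lemma fsK : cancel fs fs. Proof. by case. Qed.
Lemma feK : cancel fe feV. Proof. by case=> x y; rewrite /feV /= addrC addKr. Qed.

Definition plane_gens (i : gen) : {perm H} :=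
  match val i with
  | 0 => perm (can_inj faK) | 1 => perm (can_inj fdK) | 2 => perm (can_inj ftK)
  | 3 => perm (can_inj fsK) | _ => perm (can_inj feK) end.
Local Notation g := plane_gens.

Lemma perm_canV (f fV : H -> H) (fK : cancel f fV) z : (perm (can_inj fK))^-1%g z = fV z.
Proof.
by apply: (@perm_inj _ (perm (can_inj fK))); rewrite permKV permE (canF_sym fK).
Qed.

Lemma plane_gamma : gamma g.
Proof.
have c2 := gf_char2 K.
have ea z : g ga z = fa z by rewrite permE.
have ed z : g gd z = fd z by rewrite permE.
have et z : g gt z = ft z by rewrite permE.
have es z : g gs z = fs z by rewrite permE.
have ee z : g ge z = fe z by rewrite permE.
have edV z : (g gd)^-1%g z = fdV z by apply: perm_canV.
have etV z : (g gt)^-1%g z = ftV z by apply: perm_canV.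
have eeV z : (g ge)^-1%g z = feV z by apply: perm_canV.
move=> i; apply/permP => -[x y].
do 11?[case: i => [|i]]; rewrite /= ?nth_nil //=;
  rewrite /wval /lval /= !permM ?perm1 ?(ea, ed, et, es, ee, edV, etV, eeV);
  rewrite /fa /fd /ft /fs /fe /fdV /ftV /feV /=; congr (_, _) => //;
  try by (field || ring).
- by rewrite -addrA c2 addr0.
- have e1 : (x / (1 + s) + 1) * (1 + s) = x + (1 + s) by rewrite mulrDl mulfVK // mul1r.
  have e2 : ((x + 1) / s + 1) * s = x + 1 + s by rewrite mulrDl mulfVK // mul1r.
  by rewrite e1 e2 addrA.
Qed.

Lemma plane_trans1 i z : trans1 g i z = (z.1 + s ^+ i, z.2).
Proof.
have ed y : g gd y = fd y by rewrite permE.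
have edV y : (g gd)^-1%g y = fdV y by apply: perm_canV.
elim: i z => [|i IH] z; first by rewrite /trans1 expg0 conjg1 expr0 permE.
have -> : trans1 g i.+1 = (trans1 g i ^ g gd)%g by rewrite /trans1 expgSr conjgM.
rewrite conjgE 2!permM ed edV IH /fd /fdV /= exprSr mulrDl mulfVK //.
Qed.

Lemma plane_trans2 i z : trans2 g i z = (z.1, z.2 + s ^+ i).
Proof.
have es y : g gs y = fs y by rewrite permE.
have esV y : (g gs)^-1%g y = fs y by apply: perm_canV.
by rewrite /trans2 conjgE 2!permM es esV plane_trans1.
Qed.

Lemma plane_transitive (h h' : H) : exists i1 i2 : nat, exists m1 m2 : bool,
  ((trans1 g i1 ^+ m1 * trans2 g i2 ^+ m2)%g : {perm H}) h = h'.
Proof.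
have step (x y : K) : exists i : nat, exists m : bool, x + (s ^+ i) *+ m = y.
  case: (eqVneq (y - x) 0) => [/eqP|/(@gf_span K)[i e]].
    by rewrite subr_eq0 => /eqP ->; exists 0%N, false; rewrite mulr0n addr0.
  by exists i, true; rewrite mulr1n -e addrC subrK.
have [i1 [m1 e1]] := step h.1 h'.1; have [i2 [m2 e2]] := step h.2 h'.2.
exists i1, i2, m1, m2; rewrite permM; case: h e1 e2 => x y /= e1 e2.
have -> : (trans1 g i1 ^+ m1)%g (x, y) = (h'.1, y).
  case: m1 e1 => /= <-; last by rewrite expg0 perm1 mulr0n addr0.
  by rewrite expg1 plane_trans1.
have -> : (trans2 g i2 ^+ m2)%g (h'.1, y) = (h'.1, h'.2).
  case: m2 e2 => /= <-; last by rewrite expg0 perm1 mulr0n addr0.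
  by rewrite expg1 plane_trans2.
by case: (h').
Qed.

Definition affine_form (f : H -> K) : Prop :=
  exists a b c : K, forall z, f z = a * z.1 + b * z.2 + c.
Definition affine_map (f : H -> H) : Prop :=
  affine_form (fun z => (f z).1) /\ affine_form (fun z => (f z).2).

Lemma affine_comp f h : affine_map f -> affine_map h -> affine_map (fun z => h (f z)).
Proof.
move=> [[a [b [c e1]]] [a' [b' [c' e2]]]].
case=> [[x [y [u e3]]] [x' [y' [u' e4]]]]; split.
  exists (x * a + y * a'), (x * b + y * b'), (x * c + y * c' + u) => z.
  by rewrite e3 e1 e2; ring.
exists (x' * a + y' * a'), (x' * b + y' * b'), (x' * c + y' * c' + u') => z.
by rewrite e4 e1 e2; ring.
Qed.

Lemma plane_affine (w : word) : affine_map (wval g w).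
Proof.
elim: w => [|l w IH].
  by split; [exists 1, 0, 0|exists 0, 1, 0] => z; rewrite perm1 /=; ring.
have al : affine_map (lval g l).
  have E (f : H -> H) (p : {perm H}) : affine_map f -> p =1 f -> affine_map p.
    move=> [[a [b [c e1]]] [a' [b' [c' e2]]]] e; split; [exists a, b, c|exists a', b', c'];
    by move=> z; rewrite e ?e1 ?e2.
  have mk (f : H -> H) a b c a' b' c' :
    (forall x y, f (x, y) = (a * x + b * y + c, a' * x + b' * y + c')) -> affine_map f.
    by move=> e; split; [exists a, b, c|exists a', b', c'] => -[x y]; rewrite e.
  case: l => -[[|[|[|[|[|]]]]] //= i5] [] /=; rewrite /lval /=.
  - apply: (E faV); last exact: perm_canV.
    by apply: (mk _ 1 0 (-1) 0 1 0) => x y; congr (_, _) => /=; ring.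
  - apply: (E fa); last exact: permE.
    by apply: (mk _ 1 0 1 0 1 0) => x y; congr (_, _) => /=; ring.
  - apply: (E fdV); last exact: perm_canV.
    by apply: (mk _ s^-1 0 0 0 1 0) => x y; congr (_, _) => /=; ring.
  - apply: (E fd); last exact: permE.
    by apply: (mk _ s 0 0 0 1 0) => x y; congr (_, _) => /=; ring.
  - apply: (E ftV); last exact: perm_canV.
    by apply: (mk _ (1 + s)^-1 0 0 0 1 0) => x y; congr (_, _) => /=; ring.
  - apply: (E ft); last exact: permE.
    by apply: (mk _ (1 + s) 0 0 0 1 0) => x y; congr (_, _) => /=; ring.
  - apply: (E fs); last exact: perm_canV.
    by apply: (mk _ 0 1 0 1 0 0) => x y; congr (_, _) => /=; ring.
  - apply: (E fs); last exact: permE.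
    by apply: (mk _ 0 1 0 1 0 0) => x y; congr (_, _) => /=; ring.
  - apply: (E feV); last exact: perm_canV.
    by apply: (mk _ 1 0 0 (-1) 1 0) => x y; congr (_, _) => /=; ring.
  - apply: (E fe); last exact: permE.
    by apply: (mk _ 1 0 0 1 1 0) => x y; congr (_, _) => /=; ring.
have [[a [b [c e1]]] [a' [b' [c' e2]]]] := affine_comp al IH.
by split; [exists a, b, c|exists a', b', c'] => z; rewrite /wval /= permM.
Qed.

Lemma card_affine_zero f z0 : affine_form f -> f z0 != 0 ->
  (#|[set z : H | f z == 0%R]| <= #|K|)%N.
Proof.
case=> a [b [c e]] nz; case: (eqVneq a 0) => [a0|a0]; last first.
  rewrite -(card_in_imset (f := snd)); first exact: max_card.
  move=> [x y] [x' y']; rewrite !inE !e /= => /eqP h /eqP h' yy; congr (_, _) => //.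
  apply: (mulfI a0); apply: (addIr (b * y + c)); rewrite !addrA h yy h' //.
case: (eqVneq b 0) => [b0|b0]; last first.
  rewrite -(card_in_imset (f := fst)); first exact: max_card.
  move=> [x y] [x' y']; rewrite !inE !e /= => /eqP h /eqP h' xx; congr (_, _) => //.
  by apply: (mulfI b0); apply: (addrI (a * x)); apply: (addIr c); rewrite h xx h'.
rewrite (_ : [set z | _] = set0) ?cards0 //; apply/setP => z; rewrite !inE.
by move: nz; rewrite !e a0 b0 !mul0r => /negPf.
Qed.

(** Two distinct affine maps differ in some coordinate, and the zeros of a nonzero affine form fill
    at most a line: [#|K|] of the [#|K| ^ 2] points. *)
Lemma card_plane_agree (w w' : word) : wval g w != wval g w' ->
  (#|[set z : H | wval g w z == wval g w' z]| <= #|K|)%N.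
Proof.
move=> ne; have [z0 ne0] : exists z, wval g w z != wval g w' z.
  apply/existsP; apply: contraNT ne; rewrite negb_exists => /forallP h.
  by apply/eqP/permP => z; apply/eqP; rewrite -[_ == _]negbK h.
have [[a [b [c e1]]] [a' [b' [c' e2]]]] := plane_affine w.
have [[x [y [u e3]]] [x' [y' [u' e4]]]] := plane_affine w'.
pose f1 (z : H) := (wval g w z).1 - (wval g w' z).1.
pose f2 (z : H) := (wval g w z).2 - (wval g w' z).2.
have af1 : affine_form f1.
  by exists (a - x), (b - y), (c - u) => z; rewrite /f1 e1 e3; ring.
have af2 : affine_form f2.
  by exists (a' - x'), (b' - y'), (c' - u') => z; rewrite /f2 e2 e4; ring.
have : (f1 z0 != 0) || (f2 z0 != 0).
  apply: contraNT ne0; rewrite negb_or !negbK !subr_eq0 => /andP[/eqP p /eqP q].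
  by case: (wval g w z0) (wval g w' z0) p q => ? ? [? ?] /= -> ->.
case/orP => [/(card_affine_zero af1)|/(card_affine_zero af2)]; apply: leq_trans;
  apply: subset_leq_card; apply/subsetP => z; rewrite !inE => /eqP h;
  by rewrite /f1 /f2 h subrr.
Qed.
End Plane.

End PlaneTheory.

(** * Indistinguishable oracles *)

Lemma onth_zip (T1 T2 : eqType) (s1 : seq T1) (s2 : seq T2) i x y :
  onth s1 i = Some x -> onth s2 i = Some y -> (x, y) \in zip s1 s2.
Proof.
elim: s1 s2 i => [|x1 s1 IH] [|x2 s2] [|i] //=.
  by case=> -> [->]; rewrite mem_head.
by move=> h1 h2; rewrite inE (IH _ _ h1 h2) orbT.
Qed.

Lemma card_fibers (T U : finType) (E : {set T}) (f : T -> U) :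
  #|E| = \sum_u #|[set x in E | f x == u]|.
Proof.
rewrite -sum1_card (partition_big f xpredT) //=; apply: eq_bigr => u _.
by rewrite -sum1_card; apply: eq_bigl => x; rewrite inE.
Qed.

Section Good.
Variables (N : nat) (nb1 nb2 : oracle N).
Local Notation pairs := (seq ('I_N * 'I_N)).

Definition spread (S : pairs) : pairs :=
  S ++ flatten [seq zip (nb1 p.1) (nb2 p.2) | p <- S].
Definition matching (S : pairs) : Prop :=
  {in S &, forall p q, (p.1 == q.1) = (p.2 == q.2)}.

(* The two oracles look alike up to distance [r] from the given pairs. *)
Fixpoint good (r : nat) (S : pairs) : Prop :=
  matching S /\
  (if r is r'.+1 then
     {in S, forall p, size (nb1 p.1) = size (nb2 p.2)} /\ good r' (spread S)
   else True).

Definition reach (r : nat) (S : pairs) : pairs := iter r spread S.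

Lemma spreadP (S : pairs) q : reflect (q \in S \/
  exists2 p, p \in S & q \in zip (nb1 p.1) (nb2 p.2)) (q \in spread S).
Proof.
rewrite mem_cat; apply: (iffP orP) => -[h|h]; try by left.
  by right; case/flatten_mapP: h => p pS qp; exists p.
by right; apply/flatten_mapP; case: h => p pS qp; exists p.
Qed.

Lemma spread_sub (S S' : pairs) : {subset S <= S'} -> {subset spread S <= spread S'}.
Proof.
move=> h q /spreadP[/h qS|[p /h pS qp]]; apply/spreadP; first by left.
by right; exists p.
Qed.

Lemma good_sub r (S S' : pairs) : {subset S <= S'} -> good r S' -> good r S.
Proof.
elim: r S S' => [|r IH] S S' h /= [m]; first by split=> // p q /h pS /h; apply: m.
case=> sz gd; split; first by move=> p q /h pS /h; apply: m.
by split; [move=> p /h; apply: sz|apply: IH gd; apply: spread_sub].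
Qed.

Lemma mem_spread (S : pairs) : {subset S <= spread S}.
Proof. by move=> p pS; apply/spreadP; left. Qed.

Lemma good_le q r S : q <= r -> good r S -> good q S.
Proof.
elim: r q S => [|r IH] [|q] // S; first by move=> _ [].
by rewrite ltnS /= => qr [m [sz gd]]; do 2!split=> //; apply: IH gd.
Qed.

Lemma reachS r S : {subset S <= reach r S}.
Proof.
elim: r => [|r IH] p pS //; apply: mem_spread; exact: IH.
Qed.

Lemma reach_le q r S : q <= r -> {subset reach q S <= reach r S}.
Proof. by move=> qr p pq; rewrite -(subnK qr) /reach iterD; apply: reachS. Qed.

Definition separate r (S S' : pairs) : Prop :=
  forall p q, p \in reach r S -> q \in reach r S' -> p.1 != q.1 /\ p.2 != q.2.

(** Within [r] steps the two explored regions stay apart on both sides, so no coincidence arises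
    between them. *)
Lemma good_cat r (S S' : pairs) : good r S -> good r S' -> separate r S S' ->
  good r (S ++ S').
Proof.
elim: r S S' => [|r IH] S S'.
  move=> [m _] [m' _] sp; split=> // p q; rewrite !mem_cat.
  case/orP => pS /orP[] qS; [exact: m| | |exact: m'].
    by have [/negPf -> /negPf ->] := sp p q pS qS.
  by have [] := sp q p qS pS; rewrite eq_sym => /negPf ->; rewrite eq_sym => /negPf ->.
move=> /= [m [sz gd]] [m' [sz' gd']] sp.
have h : good r (spread S ++ spread S').
  by apply: IH => // p q; rewrite /reach -!iterSr; apply: sp.
split.
  have ms p : p \in S ++ S' -> p \in spread S ++ spread S'.
    by rewrite mem_cat (mem_cat p (spread S)) => /orP[]/mem_spread ->; rewrite ?orbT.
  by case: r {IH gd gd' sp} h => [|r] [h _] p q /ms pS /ms; apply: h.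
split; first by move=> p; rewrite mem_cat => /orP[/sz|/sz'].
apply: good_sub h => p; rewrite (mem_cat p (spread S)) => /spreadP[|[q]].
  by rewrite mem_cat => /orP[]/mem_spread ->; rewrite ?orbT.
rewrite mem_cat => /orP[] qS pq; apply/orP; [left|right]; apply/spreadP; right; by exists q.
Qed.

Lemma size_reach r S : (forall v, size (nb1 v) <= 3) ->
  size (reach r S) <= 4 ^ r * size S.
Proof.
move=> d3; elim: r => [|r IH]; first by rewrite mul1n.
have : forall S', size (spread S') <= 4 * size S'.
  move=> S'; rewrite size_cat size_flatten /shape -map_comp.
  elim: S' => //= p S' IH'; have := d3 p.1.
  have := size_zip (nb1 p.1) (nb2 p.2); rewrite /shape /=; lia.
by move=> /(_ (reach r S)) h; apply: leq_trans h _; rewrite expnS -mulnA leq_mul2l IH.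
Qed.

Section Graphs.
Variables (G1 G2 : sgraph N).
Hypotheses (rep1 : represents nb1 G1) (rep2 : represents nb2 G2).

Lemma mem_nb1 v u : (u \in nb1 v) = G1 v u.
Proof. by rewrite (perm_mem (rep1 v)) mem_enum inE. Qed.
Lemma mem_nb2 v u : (u \in nb2 v) = G2 v u.
Proof. by rewrite (perm_mem (rep2 v)) mem_enum inE. Qed.

Lemma mem_zip_proj (T1 T2 : eqType) (s1 : seq T1) (s2 : seq T2) p :
  p \in zip s1 s2 -> p.1 \in s1 /\ p.2 \in s2.
Proof.
elim: s1 s2 => [|x s1 IH] [|y s2] //=; rewrite !inE => /orP[/eqP ->|/IH[-> ->]].
  by rewrite !eqxx.
by rewrite !orbT.
Qed.

Lemma reach_ball r v v' p : p \in reach r [:: (v, v')] ->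
  p.1 \in ball G1 v r /\ p.2 \in ball G2 v' r.
Proof.
elim: r p => [|r IH] p; first by rewrite inE => /eqP ->; rewrite !inE !eqxx.
move=> /spreadP[/IH[h1 h2]|[q /IH[h1 h2] /mem_zip_proj[]]].
  by split; [apply: ball_le h1|apply: ball_le h2].
by rewrite mem_nb1 mem_nb2 => e1 e2; split; [apply: ball_adj h1 e1|apply: ball_adj h2 e2].
Qed.
End Graphs.
End Good.

Lemma ball_sym N (G : sgraph N) v w r : w \in ball G v r -> v \in ball G w r.
Proof.
have trans u x y q : u \in ball G x 1 -> y \in ball G u q -> y \in ball G x q.+1.
  move=> ux; elim: q y => [|q IH] y; first by rewrite inE => /eqP ->.
  rewrite [ball G u q.+1]/= => /setUP[/IH|/bigcupP[z zu]]; first exact: ball_le.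
  by rewrite inE => zy; apply: ball_adj zy; exact: IH.
elim: r w => [|r IH] w; first by rewrite !inE eq_sym.
rewrite [ball G v r.+1]/= => /setUP[/IH|/bigcupP[z /IH zv]]; first exact: ball_le.
rewrite inE edge_sym => wz; apply: trans zv.
by apply: ball_adj wz; rewrite inE.
Qed.

(** * Counting the relabellings that a deterministic algorithm accepts *)

Section Counting.
Variable N : nat.
Local Notation state := (seq ('I_N * ('I_N * 'I_N))).

Definition lab (nb : oracle N) (pi : 'S_N) : oracle N :=
  fun l => map pi (nb (pi^-1%g l)).

Fixpoint depth_le d (m : nat) (A : query_alg N d) : Prop :=
  match A with
  | Answer _ => True
  | Query _ _ k => if m is m'.+1 then forall a, depth_le m' (k a) else False
  end.

(** An entry [(l, (y, y'))] of a state records that the label [l] was revealed, standing for [y] in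
    the first graph and [y'] in the second; [side] selects the graph. *)
Definition agree (side : 'I_N * 'I_N -> 'I_N) (S : state) (pi : 'S_N) : bool :=
  all (fun z => pi (side z.2) == z.1) S.
Definition accset d (nb : oracle N) side (A : query_alg N d) (S : state) : {set 'S_N} :=
  [set pi | agree side S pi && accepts A (lab nb pi)].

Lemma card_agree side (S : state) : uniq [seq side z.2 | z <- S] ->
  #|[set pi | agree side S pi]| <= (N - size S)`!.
Proof.
move=> un; case: (set_0Vmem [set pi | agree side S pi]) => [->|[p0]].
  by rewrite cards0.
rewrite inE => a0; set Vs := [set x in [seq side z.2 | z <- S]].
have cV : #|~: Vs| = N - size S.
  rewrite cardsCs setCK card_ord; congr (_ - _).
  by rewrite cardsE (card_uniqP un) size_map.
rewrite -cV -card_perm -(card_imset _ (mulIg p0^-1%g)); apply: subset_leq_card.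
apply/subsetP => _ /imsetP[p + ->]; rewrite inE => ap.
apply/subsetP => x; rewrite !inE; apply: contra => /mapP[z zS ->].
rewrite permM (eqP (allP ap z zS)) -(eqP (allP a0 z zS)) permK; exact: eqxx.
Qed.

Lemma agree_fiber side (S : state) l z :
  [set pi in [set pi | agree side S pi] | pi (side z) == l] =
  [set pi | agree side ((l, z) :: S) pi].
Proof. by apply/setP => pi; rewrite !inE /= andbC. Qed.

Lemma agree_taken side (S : state) l z :
  l \in [seq w.1 | w <- S] -> side z \notin [seq side w.2 | w <- S] ->
  #|[set pi | agree side ((l, z) :: S) pi]| = 0.
Proof.
case/mapP => w wS -> zS; apply/eqP; rewrite cards_eq0; apply/eqP/setP => pi.
rewrite !inE /=; apply/negP => /andP[/eqP e /allP a].
have /eqP e' := a w wS; move: zS; rewrite -e' in e.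
by move/perm_inj: e => ->; rewrite map_f.
Qed.

Lemma card_fresh (L : seq 'I_N) : uniq L -> #|[pred l | l \notin L]| = N - size L.
Proof.
move=> u; have := cardC (mem L); rewrite card_ord (card_uniqP u).
rewrite (eq_card (B := predC (mem L))); last first.
  by move=> l; rewrite !inE.
move=> e; have le : size L <= N := leq_trans (leq_addr _ _) (eq_leq e).
by apply: (@addnI (size L)); rewrite subnKC.
Qed.

Lemma fact_fresh (L : seq 'I_N) : uniq L -> size L < N ->
  (N - size L)`! = \sum_(l | l \notin L) (N - (size L).+1)`!.
Proof.
move=> u lt; rewrite sum_nat_const card_fresh // -[in LHS](@prednK (N - size L)).
  by rewrite factS prednK ?subnS // subn_gt0.
by rewrite subn_gt0.
Qed.

Lemma size_uniq_le (L : seq 'I_N) : uniq L -> size L <= N.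
Proof. by move=> /card_uniqP <-; rewrite -[X in _ <= X](card_ord N) max_card. Qed.

Lemma card_agreeE side (S : state) : uniq [seq z.1 | z <- S] ->
  uniq [seq side z.2 | z <- S] -> #|[set pi | agree side S pi]| = (N - size S)`!.
Proof.
elim: S => [|[l z] S IH] /=.
  by move=> _ _; rewrite subn0 -card_Sn -cardsT; apply: eq_card => pi; rewrite !inE.
move=> /andP[lS uS] /andP[zS uz]; have eS := IH uS uz.
pose c l := #|[set pi | agree side ((l, z) :: S) pi]|.
pose L := [seq z.1 | z <- S].
have sL : size L = size S by rewrite size_map.
have ltS : size S < N.
  by have := @size_uniq_le (l :: L); rewrite /= lS uS sL; apply.
have tot : \sum_(l | l \notin L) c l = \sum_(l | l \notin L) (N - (size S).+1)`!.
  rewrite -sL -fact_fresh ?sL // -eS (card_fibers _ (fun pi : 'S_N => pi (side z))).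
  rewrite [RHS](bigID (fun l => l \in L)) /= [X in _ = X + _]big1 ?add0n.
    by apply: eq_bigr => l' _; rewrite /c agree_fiber.
  by move=> l' l'L; rewrite agree_fiber agree_taken.
have le l' : l' \notin L -> c l' <= (N - (size S).+1)`!.
  by move=> _; apply: (@card_agree side ((l', z) :: S)); rewrite /= zS.
have [_] := leqif_sum (fun l' l'L => leqif_eq (le l' l'L)).
by rewrite tot eqxx => /esym/forall_inP/(_ l lS)/eqP.
Qed.

Lemma accset_known d nb side v i (k : option 'I_N -> query_alg N d) (S : state) y y' :
  (v, (y, y')) \in S ->
  accset nb side (Query v i k) S =
  [set pi | agree side S pi &&
     accepts (k (omap pi (onth (nb (side (y, y'))) i))) (lab nb pi)].
Proof.
move=> vS; apply/setP => pi; rewrite !inE; apply: andb_id2l => /allP/(_ _ vS)/eqP /= e.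
by rewrite /= (_ : lab nb pi v = map pi (nb (side (y, y')))) ?onth_map // /lab -e permK.
Qed.

Lemma accset_taken side d nb (A : query_alg N d) (S : state) l z :
  l \in [seq w.1 | w <- S] -> side z \notin [seq side w.2 | w <- S] ->
  #|accset nb side A ((l, z) :: S)| = 0.
Proof.
case/mapP => w wS -> zS; apply/eqP; rewrite cards_eq0; apply/eqP/setP => pi.
rewrite !inE /=; apply/negP => /andP[/andP[/eqP e /allP a] _].
have /eqP e' := a w wS; move: zS; rewrite -e' in e.
by move/perm_inj: e => ->; rewrite map_f.
Qed.

Variables (nb1 nb2 : oracle N) (D : nat).

Definition okstate (m : nat) (S : state) : Prop :=
  [/\ uniq [seq z.1 | z <- S], uniq [seq z.2.1 | z <- S],
      uniq [seq z.2.2 | z <- S] & good nb1 nb2 m [seq z.2 | z <- S]].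

Variables (q : nat) (Bad : state -> {set 'I_N}).
Hypothesis card_Bad : forall S, size S <= 2 * q -> D * #|Bad S| <= N - size S.
Hypothesis Bad_fresh : forall m S y, m <= q -> okstate m S -> y \notin Bad S ->
  [/\ y \notin [seq z.2.1 | z <- S], y \notin [seq z.2.2 | z <- S] &
      good nb1 nb2 m ((y, y) :: [seq z.2 | z <- S])].
Hypothesis qN : 2 * q < N.

Let acc1 := @accset 3 nb1 fst.
Let acc2 := @accset 3 nb2 snd.

(** A query at a revealed label gets answers that are paired with each other. Either the neighbour
    already has the same label on both sides, or the same fresh labels are possible on both sides
    and the sums are compared term by term. *)
Lemma count_known m v i k (S : state) y y' :
  (forall a (S : state), okstate m S -> size S + 2 * m <= 2 * q ->
    D * #|acc1 (k a) S| <= D * #|acc2 (k a) S| + m * (N - size S)`!) ->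
  okstate m.+1 S -> (v, (y, y')) \in S -> size S + 2 * m < 2 * q ->
  D * #|acc1 (Query v i k) S| <= D * #|acc2 (Query v i k) S| + m * (N - size S)`!.
Proof.
move=> IH ok vS sS; have [u0 u1 u2 gd] := ok.
have okm : okstate m S by split=> //; apply: good_le gd.
rewrite /acc1 /acc2 !(accset_known _ _ _ _ vS) /=.
have [mS [sz gdm]] := gd.
have yS : (y, y') \in [seq z.2 | z <- S] by apply/mapP; exists (v, (y, y')).
have := sz _ yS => /= esz.
case e1: (onth (nb1 y) i) => [z|]; last first.
  have e2 : onth (nb2 y') i = None.
    by apply: onth_default; rewrite -esz -onthNE e1.
  rewrite e2 /=; apply: IH => //; lia.
case e2: (onth (nb2 y') i) => [z'|]; last first.
  by move: (onthTE (nb1 y) i) (onthTE (nb2 y') i); rewrite e1 e2 esz => <-.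
have zsp : (z, z') \in spread nb1 nb2 [seq z.2 | z <- S].
  by apply/spreadP; right; exists (y, y') => //; apply: onth_zip e1 e2.
have msp : matching (spread nb1 nb2 [seq z.2 | z <- S]) by case: (m) gdm => [|?] [].
rewrite /=.
have mt w : w \in S -> (w.2.1 == z) = (w.2.2 == z').
  by move=> wS; apply: (msp w.2 (z, z')) => //; apply/mem_spread/map_f.
case: (boolP (z \in [seq w.2.1 | w <- S])) => [/mapP[w wS ew]|zS].
  have ew' : z' = w.2.2 by apply/esym/eqP; rewrite -mt // ew.
  have -> : [set pi : 'S_N | agree fst S pi && accepts (k (Some (pi z))) (lab nb1 pi)]
      = acc1 (k (Some w.1)) S.
    apply/setP => pi; rewrite !inE; apply: andb_id2l => /allP/(_ _ wS)/eqP <-.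
    by rewrite ew.
  have -> : [set pi : 'S_N | agree snd S pi && accepts (k (Some (pi z'))) (lab nb2 pi)]
      = acc2 (k (Some w.1)) S.
    apply/setP => pi; rewrite !inE; apply: andb_id2l => /allP/(_ _ wS)/eqP <-.
    by rewrite ew'.
  by apply: IH => //; lia.
have zS' : z' \notin [seq w.2.2 | w <- S].
  by apply: contra zS => /mapP[w wS e]; apply/mapP; exists w => //; apply/esym/eqP; rewrite mt // e.
pose L := [seq w.1 | w <- S].
have sumE side nb : side (z, z') \notin [seq side w.2 | w <- S] ->
    #|[set pi : 'S_N | agree side S pi &&
      accepts (k (Some (pi (side (z, z'))))) (lab nb pi)]| =
    \sum_(l | l \notin L) #|accset nb side (k (Some l)) ((l, (z, z')) :: S)|.
  move=> zn; rewrite (card_fibers _ (fun pi : 'S_N => pi (side (z, z')))).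
  have e l : #|[set pi in [set pi : 'S_N | agree side S pi &&
      accepts (k (Some (pi (side (z, z'))))) (lab nb pi)] | pi (side (z, z')) == l]|
      = #|accset nb side (k (Some l)) ((l, (z, z')) :: S)|.
    apply: eq_card => pi; rewrite !inE /= andbC andbA.
    by case: eqP => //= ->.
  under eq_bigr do rewrite e.
  rewrite (bigID (fun l => l \in L)) /= big1 ?add0n // => l lL.
  exact: accset_taken.
rewrite (sumE fst nb1) // (sumE snd nb2) //.
have fS : (N - size S)`! = \sum_(l | l \notin L) (N - (size S).+1)`!.
  by rewrite -(size_map fst S) fact_fresh // size_map; lia.
rewrite fS !big_distrr -big_split /=; apply: leq_sum => l lL.
apply: (IH _ ((l, (z, z')) :: S)); last by rewrite /=; lia.
split=> //=; [by rewrite lL|by rewrite zS|by rewrite zS'|].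
apply: good_sub gdm => p; rewrite inE => /orP[/eqP -> //|]; exact: mem_spread.
Qed.

Lemma count_accept m A (S : state) : depth_le m A -> m <= q ->
  okstate m S -> size S + 2 * m <= 2 * q ->
  D * #|acc1 A S| <= D * #|acc2 A S| + m * (N - size S)`!.
Proof.
have Ans b T m' : okstate m' T -> D * #|acc1 (Answer _ _ b) T| <= D * #|acc2 (Answer _ _ b) T|.
  case=> u0 u1 u2 _; rewrite leq_mul2l /acc1 /acc2 /accset /=.
  case: b; last by rewrite (eq_card0 (A := [set pi | _])) ?orbT // => pi; rewrite inE andbF.
  have E side : #|[set pi | agree side T pi && true]| = #|[set pi | agree side T pi]|.
    by apply: eq_card => pi; rewrite !inE andbT.
  by rewrite !E !card_agreeE ?leqnn ?orbT.
elim: m A S => [|m IH] A S dA mq ok sS.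
  case: A dA => // b _; rewrite mul0n addn0; exact: Ans ok.
case: A dA => [b _|v i k /= dk].
  by apply: leq_trans (leq_addr _ _); exact: Ans ok.
have [u0 u1 u2 gd] := ok.
have IHk a (S' : state) : okstate m S' -> size S' + 2 * m <= 2 * q ->
    D * #|acc1 (k a) S'| <= D * #|acc2 (k a) S'| + m * (N - size S')`!.
  by move=> ok' sS'; apply: IH => //; apply: ltnW.
case: (boolP (v \in [seq w.1 | w <- S])) => [/mapP[[v' [y y']] wS /= ->]|vS].
  apply: leq_trans (count_known i IHk ok wS _) _; first by lia.
  by rewrite leq_add2l leq_mul2r leqnSn orbT.
have sumE side nb : (forall y, side (y, y) = y) -> #|accset nb side (Query v i k) S| =
    \sum_y #|accset nb side (Query v i k) ((v, (y, y)) :: S)|.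
  move=> sd; rewrite (card_fibers _ (fun pi : 'S_N => pi^-1%g v)).
  apply: eq_bigr => y _; apply: eq_card => pi; rewrite !inE /= sd andbC andbA.
  by congr (_ && _ && _); apply/eqP/eqP => <-; rewrite ?permKV ?permK.
have ltS : size S < N by lia.
have fS : (N - size S)`! = (N - size S) * (N - (size S).+1)`!.
  by rewrite -[in LHS](@prednK (N - size S)) ?factS ?prednK ?subnS //; lia.
rewrite /acc1 /acc2 (sumE fst nb1) // (sumE snd nb2) //.
pose c1 y := #|accset nb1 fst (Query v i k) ((v, (y, y)) :: S)|.
pose c2 y := #|accset nb2 snd (Query v i k) ((v, (y, y)) :: S)|.
change (D * (\sum_y c1 y) <= D * (\sum_y c2 y) + m.+1 * (N - size S)`!).
set F := (N - (size S).+1)`!.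
have bad y : c1 y <= F.
  apply: leq_trans (_ : #|[set pi | agree fst ((v, (y, y)) :: S) pi]| <= _).
    by apply: subset_leq_card; apply/subsetP => pi; rewrite !inE => /andP[].
  case: (boolP (y \in [seq z.2.1 | z <- S])) => yS; last first.
    by apply: (@card_agree fst ((v, (y, y)) :: S)); rewrite /= yS.
  rewrite eq_card0 // => pi; rewrite !inE /=; apply/negP => /andP[/eqP e /allP a].
  case/mapP: yS => w wS ey; move: vS; rewrite -e ey (eqP (a w wS)).
  by rewrite map_f.
have okB y : y \notin Bad S -> okstate m.+1 ((v, (y, y)) :: S).
  by move=> /(Bad_fresh mq ok)[y1 y2 gy]; split=> //=; apply/andP.
have fresh y : y \notin Bad S -> D * c1 y <= D * c2 y + m * F.
  move=> yB; apply: (@count_known m v i k ((v, (y, y)) :: S) y y IHk (okB y yB)).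
    exact: mem_head.
  by rewrite /=; lia.
have sum1 : D * \sum_(y in Bad S) c1 y <= (N - size S)`!.
  apply: leq_trans (_ : D * (#|Bad S| * F) <= _).
    rewrite leq_mul2l -sum_nat_const; apply/orP; right; exact: leq_sum.
  by rewrite fS mulnA leq_mul2r card_Bad ?orbT //; lia.
have sum2 : D * \sum_(y | y \notin Bad S) c1 y <=
    D * (\sum_y c2 y) + m * (N - size S)`!.
  apply: leq_trans (_ : \sum_(y | y \notin Bad S) (D * c2 y + m * F) <= _).
    by rewrite big_distrr; apply: leq_sum => y; exact: fresh.
  rewrite big_split /= -big_distrr /=; apply: leq_add.
    by rewrite leq_mul2l [leqRHS](bigID (mem (Bad S))) /= leq_addl orbT.
  rewrite sum_nat_const mulnCA leq_mul2l fS leq_mul2r; apply/orP; right; apply/orP; right.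
  rewrite -(size_map (fun z => z.2.1) S) -card_fresh //; apply: subset_leq_card.
  by apply/subsetP => y; rewrite !inE => /(Bad_fresh mq ok)[].
by rewrite (bigID (mem (Bad S))) /= mulnDr mulSn addnCA; exact: leq_add sum1 sum2.
Qed.
End Counting.

(** * Generic points *)

Section Oracle.
Variables (P : finType) (g : gen -> {perm P}) (N : nat).
Variables (kap : 'I_N -> P * 'I_22) (kinv : P * 'I_22 -> 'I_N).
Hypotheses (kK : cancel kap kinv) (kK' : cancel kinv kap).

Definition onb : oracle N := fun u => map kinv (nbl g (kap u)).

Lemma onb_represents : represents onb (eG g kap).
Proof.
move=> v; apply: uniq_perm; rewrite ?enum_uniq //.
  by rewrite map_inj_uniq ?nbl_uniq //; exact: can_inj kK'.
move=> u; rewrite mem_enum inE /= -{1}(kK u) mem_map //; exact: can_inj kK'.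
Qed.

Lemma size_onb v : size (onb v) <= 3.
Proof. by rewrite size_map size_nbl rdeg_le3. Qed.
End Oracle.

Lemma wval_rcons (gT : finGroupType) (g : gen -> gT) w l :
  wval g (rcons w l) = (wval g w * lval g l)%g.
Proof. by elim: w => [|m w IH] /=; rewrite ?mulg1 ?mul1g // IH mulgA. Qed.

Section Alike.
Variables (Q1 Q2 : finType) (g1 : gen -> {perm Q1}) (g2 : gen -> {perm Q2}).
Variables (N : nat) (kap1 : 'I_N -> Q1 * 'I_22) (kinv1 : Q1 * 'I_22 -> 'I_N).
Variables (kap2 : 'I_N -> Q2 * 'I_22) (kinv2 : Q2 * 'I_22 -> 'I_N).
Hypotheses (k1K : cancel kap1 kinv1) (k1K' : cancel kinv1 kap1).
Hypotheses (k2K : cancel kap2 kinv2) (k2K' : cancel kinv2 kap2).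
Local Notation nb1 := (onb g1 kap1 kinv1).
Local Notation nb2 := (onb g2 kap2 kinv2).

Definition alike R (x : Q1) (x' : Q2) : Prop :=
  forall w w' : word, size w <= R -> size w' <= R ->
  (wval g1 w x == wval g1 w' x) = (wval g2 w x' == wval g2 w' x').

(** Exploration reaches only paths of points given by short words, at equal positions on both sides,
    so two vertices coincide exactly when two words agree at the base point. *)
Lemma alike_good_from R x x' r t (S : seq ('I_N * 'I_N)) : alike R x x' -> t + r <= R ->
  (forall p, p \in S -> exists w rho, [/\ size w <= t,
     kap1 p.1 = (wval g1 w x, rho) & kap2 p.2 = (wval g2 w x', rho)]) ->
  good nb1 nb2 r S.
Proof.
move=> al; elim: r t S => [|r IH] t S tR inv.
  split=> // p q /inv[w [rho [sw e1 e2]]] /inv[w' [rho' [sw' e1' e2']]].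
  rewrite -(can_eq k1K) -(can_eq k2K) e1 e1' e2 e2' !xpair_eqE al //; lia.
split.
  move=> p q /inv[w [rho [sw e1 e2]]] /inv[w' [rho' [sw' e1' e2']]].
  rewrite -(can_eq k1K) -(can_eq k2K) e1 e1' e2 e2' !xpair_eqE al //; lia.
split.
  by move=> p /inv[w [rho [_ e1 e2]]]; rewrite !size_map e1 e2.
apply: (IH t.+1); first by rewrite addSnnS.
move=> q /spreadP[/inv[w [rho [sw e1 e2]]]|[p /inv[w [rho [sw e1 e2]]]]].
  by exists w, rho; split=> //; apply: leqW.
rewrite /onb e1 e2 /nbl -!map_comp /= zip_map => /mapP[m _ ->] /=.
rewrite !k1K' !k2K'; case: m => -[l|] q' /=.
  by exists (rcons w l), (inord q'); rewrite size_rcons !wval_rcons !permM.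
by exists w, (inord q'); rewrite !perm1; split=> //; apply: leqW.
Qed.

Lemma alike_good R x x' rho u u' : alike R x x' -> kap1 u = (x, rho) -> kap2 u' = (x', rho) ->
  good nb1 nb2 R [:: (u, u')].
Proof.
move=> al e1 e2; apply: (@alike_good_from R x x' R 0) => // p.
by rewrite inE => /eqP ->; exists [::], rho; rewrite /= !perm1.
Qed.
End Alike.

(** The pattern is a parameter independent of the set acted on, so that points of planes over
    different fields can be compared. *)
Definition generic (P : finType) (g : gen -> {perm P}) R (pat : word -> word -> bool) (x : P) :=
  forall w w' : word, size w <= R -> size w' <= R ->
  (wval g w x == wval g w' x) = pat w w'.

Lemma generic_alike (Q1 Q2 : finType) (g1 : gen -> {perm Q1}) (g2 : gen -> {perm Q2}) R pat x x' :
  generic g1 R pat x -> generic g2 R pat x' -> alike g1 g2 R x x'.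
Proof. by move=> h1 h2 w w' sw sw'; rewrite h1 // h2. Qed.

(** * Generic points of planes, of copies and of punctured planes *)

Section PlaneGeneric.
Variables (K : gen_field) (R : nat).
Local Notation H := (K * K)%type.
Local Notation g := (@plane_gens K).
Local Notation bw := {bseq R of letter}.
Definition nwords := #|{: bw}|.

Definition plane_pat (w w' : word) : bool := wval g w == wval g w'.

Definition plane_bad : {set H} :=
  \bigcup_(p : bw * bw | ~~ plane_pat p.1 p.2) [set z | wval g p.1 z == wval g p.2 z].

Lemma card_bigcup_le (T I : finType) (A : pred I) (F : I -> {set T}) c :
  (forall i, A i -> #|F i| <= c) -> #|\bigcup_(i | A i) F i| <= #|I| * c.
Proof.
move=> h; apply: leq_trans (_ : \sum_(i | A i) #|F i| <= _).
  elim/big_ind2: _ => [|X a Y b hX hY|i _]; rewrite ?cards0 //.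
  by apply: leq_trans (leq_card_setU _ _) _; apply: leq_add.
apply: (@leq_trans (\sum_(i | A i) c)); first exact: leq_sum.
by rewrite sum_nat_const leq_mul2r max_card orbT.
Qed.

Lemma card_plane_bad : #|plane_bad| <= nwords * nwords * #|K|.
Proof.
rewrite -card_prod; apply: card_bigcup_le => -[w w'] /=; exact: card_plane_agree.
Qed.

Lemma plane_generic z : z \notin plane_bad -> generic g R plane_pat z.
Proof.
move=> zb w w' sw sw'; case: (boolP (plane_pat w w')) => [/eqP ->|ne]; first exact: eqxx.
apply: contraNF zb => e; apply/bigcupP; exists (Bseq sw, Bseq sw') => //.
by rewrite inE.
Qed.
End PlaneGeneric.

Section Copies.
Variables (c : nat) (P : finType) (g : gen -> {perm P}).
Definition copy_fun i (z : 'I_c * P) : 'I_c * P := (z.1, g i z.2).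
Lemma copy_inj i : injective (copy_fun i).
Proof. by case=> a x [b y] [-> /perm_inj ->]. Qed.
Definition copies (i : gen) : {perm 'I_c * P} := perm (@copy_inj i).

Lemma wval_copies w z : wval copies w z = (z.1, wval g w z.2).
Proof.
elim: w z => [|l w IH] [a x] /=; first by rewrite !perm1.
rewrite !permM IH; case: l => i [] /=; rewrite /lval /=.
  have -> : (copies i)^-1%g (a, x) = (a, (g i)^-1%g x).
    by apply: (@perm_inj _ (copies i)); rewrite permKV permE /copy_fun /= permKV.
  by [].
by rewrite permE.
Qed.

Lemma gamma_copies : gamma g -> gamma copies.
Proof. by move=> gg i; apply/permP => z; rewrite !wval_copies gg. Qed.

Lemma generic_copies R pat z : generic g R pat z.2 -> generic copies R pat z.
Proof. by move=> h w w' sw sw'; rewrite !wval_copies xpair_eqE eqxx h. Qed.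
End Copies.

Section Removal.
Variables (H : finType) (gH : gen -> {perm H}) (A : pred H).
Local Notation P := {x : H | A x}.
Definition removal (i : gen) : {perm P} := return_perm (gH i) A.

Lemma lval_removal l (x y : P) : lval gH l (val x) = val y -> lval removal l x = y.
Proof.
case: l => i []; rewrite /lval /= => e; last exact: return_permP.
apply: (@perm_inj _ (removal i)); rewrite permKV; apply/esym; apply: return_permP.
by rewrite /= -e permKV.
Qed.

Lemma wval_removal R (x : P) w :
  (forall w, size w <= R -> A (wval gH w (val x))) -> size w <= R ->
  val (wval removal w x) = wval gH w (val x).
Proof.
move=> al; elim/last_ind: w => [|w l IH]; first by rewrite !perm1.
rewrite size_rcons => sw; rewrite !wval_rcons !permM.
have Al : A (wval gH (rcons w l) (val x)) by apply: al; rewrite size_rcons.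
have -> : lval removal l (wval removal w x) = exist A _ Al.
  by apply: lval_removal; rewrite /= wval_rcons permM IH //; exact: ltnW.
by rewrite /= wval_rcons permM.
Qed.

Lemma generic_removal R pat (x : P) : generic gH R pat (val x) ->
  (forall w, size w <= R -> A (wval gH w (val x))) -> generic removal R pat x.
Proof.
move=> ge al w w' sw sw'; rewrite -ge // -!(wval_removal al) //.
Qed.
End Removal.

Section RemovalBad.
Variables (H : finType) (gH : gen -> {perm H}) (R : nat) (Del : {set H}).
Definition near_del : {set H} :=
  \bigcup_(w : {bseq R of letter}) ((wval gH w)^-1%g @: Del).
Lemma card_near_del : #|near_del| <= nwords R * #|Del|.
Proof. by apply: card_bigcup_le => w _; apply: leq_imset_card. Qed.
Lemma near_delP z w : z \notin near_del -> size w <= R -> wval gH w z \notin Del.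
Proof.
move=> zn sw; apply: contra zn => h; apply/bigcupP; exists (Bseq sw) => //.
by apply/imsetP; exists (wval gH w z); rewrite ?permK.
Qed.
End RemovalBad.

(** * Hard instances *)

Lemma eq_card_bij (A B : finType) : #|A| = #|B| ->
  exists f : A -> B, exists h : B -> A, cancel f h /\ cancel h f.
Proof.
move=> e; exists (fun x => enum_val (cast_ord e (enum_rank x))).
exists (fun y => enum_val (cast_ord (esym e) (enum_rank y))).
by split=> x; rewrite enum_valK ?cast_ordK ?cast_ordKV enum_rankK.
Qed.

(** Applied to the coincidence patterns of words of length at most [R] over larger and larger
    fields. *)
Lemma pigeonhole_infinite (T : finType) (f : nat -> T) :
  exists t, forall m, exists2 j, m <= j & f j = t.
Proof.
apply: contrapT => /forallNP h.
have h' t : exists m, forall j, m <= j -> f j <> t.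
  by have /existsNP[m hm] := h t; exists m => j mj e; apply: hm; exists j.
have [b hb] := choice h'.
by apply: (hb (f (\max_t b t)) (\max_t b t)) => //; apply: leq_bigmax.
Qed.

(** The constant [C] does not depend on the radius [R] and the scarcity [M] of bad vertices, so one
    distance parameter serves all query bounds. [hfar] ranges over all identifications [kap] because
    the algorithm is given relabelled graphs. *)
Record hard_instance (C R M : nat) := HardInstance {
  hN : nat; hQ1 : finType; hQ2 : finType;
  hg1 : gen -> {perm hQ1}; hg2 : gen -> {perm hQ2};
  hk1 : 'I_hN -> hQ1 * 'I_22; hi1 : hQ1 * 'I_22 -> 'I_hN;
  hk2 : 'I_hN -> hQ2 * 'I_22; hi2 : hQ2 * 'I_22 -> 'I_hN;
  hk1K : cancel hk1 hi1; hk1K' : cancel hi1 hk1;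
  hk2K : cancel hk2 hi2; hk2K' : cancel hi2 hk2;
  hgamma : gamma hg1;
  hrole : forall u, (hk1 u).2 = (hk2 u).2;
  hB1 : {set 'I_hN}; hB2 : {set 'I_hN};
  hbad : M * (#|hB1| + #|hB2| + 1) <= hN;
  hgood : forall u u', u \notin hB1 -> u' \notin hB2 -> (hk1 u).2 = (hk2 u').2 ->
    good (onb hg1 hk1 hi1) (onb hg2 hk2 hi2) R [:: (u, u')];
  hclass : forall rho, #|[set u | (hk1 u).2 == rho]| * 22 = hN;
  hfar : forall kap : 'I_hN -> hQ2 * 'I_22, bijective kap ->
    forall G : sgraph hN, locally_gamma G 400 ->
    hN <= C * edit_distance (eG hg2 kap) G }.

Section Roles.
Variables (Q : finType) (N : nat) (kap : 'I_N -> Q * 'I_22).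
Hypothesis kapB : bijective kap.

Lemma card_points (B : {set Q}) : #|[set u | (kap u).1 \in B]| <= #|B| * 22.
Proof.
rewrite -(card_imset _ (bij_inj kapB)).
apply: leq_trans (_ : #|setX B [set: 'I_22]| <= _).
  apply: subset_leq_card; apply/subsetP => _ /imsetP[u + ->].
  by rewrite !inE andbT.
by rewrite cardsX cardsT card_ord.
Qed.

Lemma card_role rho : #|[set u | (kap u).2 == rho]| = #|Q|.
Proof.
rewrite -(card_imset _ (bij_inj kapB)).
have -> : kap @: [set u | (kap u).2 == rho] = setX [set: Q] [set rho].
  case: (kapB) => kinv kK kK'; apply/setP => z; apply/imsetP/idP => [[u]|].
    by rewrite inE => /eqP e ->; rewrite !inE e eqxx.
  by rewrite !inE => /eqP e; exists (kinv z); rewrite ?inE kK' ?e ?eqxx.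
by rewrite cardsX cardsT cards1 muln1.
Qed.
End Roles.

(** Here [a] and [b] are the sizes of the two fields and [W] the number of short words.
    [c * (W * W * a)] bounds the nongeneric points in the copies, [W * W * b] those of the large
    plane, and [W * (a * a)] the points near a deletion. *)
Lemma instance_arith M W a b c :
  4 * M * (W * W) <= a -> 8 * M * (W * W) <= b -> 8 * M * (W * (a * a)) <= b ->
  8 * M <= b -> c * (a * a) = b * b - a * a -> 4001 * (a * a) <= b ->
  M * ((c * (W * W * a)) * 22 + (W * W * b + W * (a * a)) * 22 + 1) <= c * (a * a) * 22.
Proof.
move=> h1 h2 h3 h4 h5 h6.
have T1 : 4 * (M * (c * (W * W * a))) <= c * (a * a).
  have -> : 4 * (M * (c * (W * W * a))) = c * (a * (4 * M * (W * W))) by lia.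
  by rewrite !leq_mul2l h1 !orbT.
have bb : b <= b * b by case: (b) => // n; lia.
have T2 : 8 * (M * (W * W * b)) <= b * b.
  have -> : 8 * (M * (W * W * b)) = 8 * M * (W * W) * b by lia.
  by rewrite leq_mul2r h2 orbT.
have T3 : 8 * (M * (W * (a * a))) <= b * b by apply: leq_trans bb; rewrite mulnA.
have T4 : 8 * M <= b * b := leq_trans h4 bb.
have T5 : 4001 * (a * a) <= b * b := leq_trans h6 bb.
have -> : M * ((c * (W * W * a)) * 22 + (W * W * b + W * (a * a)) * 22 + 1) =
  M * (c * (W * W * a)) * 22 + (M * (W * W * b) + M * (W * (a * a))) * 22 + M by lia.
move: T1 T2 T3 T4 T5 h5; move: (M * (c * _)) (M * (W * W * b)) (M * (W * (a * a))).
by move: (c * (a * a)) (a * a) (b * b); clear=> *; lia.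
Qed.

Lemma hard_instance_exists : exists C : nat, forall R M : nat,
  exists _ : hard_instance C R M, True.
Proof.
(* With p points left and edit distance e, either p <= 2 e or rigidity does not apply and 4002 e > p
   - 2000 a^2. The latter is at least p / 2 as b^2 >= 4001 a^2, and each point has 22 vertices. *)
exists (4002 * 2 * 22) => R M.
have [Kf Kc] : exists Kf : nat -> gen_field, forall k, #|Kf k| = 2 ^ k.+2.
  by have [Kf h] := choice (fun k => gen_field_exists (isT : 1 < k.+2)); exists Kf.
pose W := nwords R.
pose pat k := [set p : {bseq R of letter} * {bseq R of letter} | plane_pat (Kf k) p.1 p.2].
have [t0 inf] := pigeonhole_infinite pat.
have big m k : m <= k -> m <= 2 ^ k.+2.
  by move=> mk; apply: ltnW; apply: (@leq_ltn_trans k.+2); [lia|exact: ltn_expl].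
have [j jm pj] := inf (4 * M * (W * W)).
set a := 2 ^ j.+2; have ha : 4 * M * (W * W) <= a by apply: big.
(* The large field is chosen after the small one: [b] has to dominate the number [a * a] of deleted
   points even after multiplication by [M] and [W]. *)
pose m0 := j + 8 * M * (W * W) + 8 * M * (W * (a * a)) + 8 * M + 4001 * (a * a).
have [k km pk] := inf m0; set b := 2 ^ k.+2.
have hb : m0 <= b by apply: big.
have jk : j <= k by rewrite /m0 in km; lia.
pose c := 4 ^ (k - j) - 1.
have ebb : b * b = 4 ^ (k - j) * (a * a).
  rewrite /a /b -!expnD (_ : 4 = 2 ^ 2) // -expnM -expnD; congr (2 ^ _); lia.
have ec : c * (a * a) = b * b - a * a by rewrite ebb /c mulnBl mul1n.
have n_gt0 : 0 < a * a by rewrite muln_gt0 expn_gt0.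
have leab : 4001 * (a * a) <= b * b.
  apply: (@leq_trans b); first by apply: leq_trans hb; rewrite /m0; lia.
  by rewrite leq_pmull // expn_gt0.
pose Kj := Kf j; pose Kk := Kf k; pose H := (Kk * Kk)%type.
have cH : #|{: H}| = b * b by rewrite card_prod Kc.
pose Del : {set H} := [set x in take (a * a) (enum {: H})].
have cDel : #|Del| = a * a.
  rewrite cardsE (card_uniqP _) ?take_uniq ?enum_uniq // size_takel // -cardE cH.
  by lia.
pose A : pred H := fun x => x \notin Del.
pose Q1 := ('I_c * (Kj * Kj))%type; pose Q2 := {x : H | A x}.
have cQ1 : #|{: Q1}| = c * (a * a) by rewrite !card_prod card_ord !Kc.
have cQ2 : #|{: Q2}| = c * (a * a).
  rewrite card_sig ec -cH -cDel -(cardC (mem Del)) addKn.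
  by apply: eq_card => x; rewrite !inE.
pose g1 := copies c (@plane_gens Kj) : gen -> {perm Q1}.
pose g2 := removal (@plane_gens Kk) A : gen -> {perm Q2}.
pose n := c * (a * a); pose N := n * 22.
have [b1 [b1' [b1K b1K']]] : exists f : 'I_n -> Q1, exists h, cancel f h /\ cancel h f.
  by apply: eq_card_bij; rewrite card_ord cQ1.
have [b2 [b2' [b2K b2K']]] : exists f : 'I_n -> Q2, exists h, cancel f h /\ cancel h f.
  by apply: eq_card_bij; rewrite card_ord cQ2.
(* A single [k0] underlies both identifications, so each vertex has the same position on its path in
   both graphs, as [hrole] demands. *)
have [k0 [k0' [k0K k0K']]] :
    exists f : 'I_N -> 'I_n * 'I_22, exists h, cancel f h /\ cancel h f.
  by apply: eq_card_bij; rewrite card_prod !card_ord.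
pose kap1 u := (b1 (k0 u).1, (k0 u).2); pose kinv1 z := k0' (b1' z.1, z.2).
pose kap2 u := (b2 (k0 u).1, (k0 u).2); pose kinv2 z := k0' (b2' z.1, z.2).
have k1K : cancel kap1 kinv1 by move=> u; rewrite /kinv1 /= b1K -surjective_pairing k0K.
have k1K' : cancel kinv1 kap1 by case=> x r; rewrite /kap1 /kinv1 k0K' /= b1K'.
have k2K : cancel kap2 kinv2 by move=> u; rewrite /kinv2 /= b2K -surjective_pairing k0K.
have k2K' : cancel kinv2 kap2 by case=> x r; rewrite /kap2 /kinv2 k0K' /= b2K'.
have k1B : bijective kap1 by exists kinv1.
have k2B : bijective kap2 by exists kinv2.
pose B1 : {set Q1} := [set z | z.2 \in plane_bad Kj R].
pose B2 : {set Q2} := [set z | (val z \in plane_bad Kk R) ||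
                               (val z \in near_del (@plane_gens Kk) R Del)].
have cB1 : #|B1| <= c * (W * W * a).
  have -> : B1 = setX [set: 'I_c] (plane_bad Kj R) by apply/setP => z; rewrite !inE.
  rewrite cardsX cardsT card_ord leq_mul2l; apply/orP; right.
  by have := card_plane_bad Kj R; rewrite Kc.
have cB2 : #|B2| <= W * W * b + W * (a * a).
  rewrite -(card_imset _ val_inj).
  apply: leq_trans (_ : #|plane_bad Kk R :|: near_del (@plane_gens Kk) R Del| <= _).
    by apply: subset_leq_card; apply/subsetP => _ /imsetP[z + ->]; rewrite !inE.
  apply: leq_trans (leq_card_setU _ _) _; apply: leq_add.
    by have := card_plane_bad Kk R; rewrite Kc.
  by have := card_near_del (@plane_gens Kk) R Del; rewrite cDel.
have gen1 z : z \notin B1 -> generic g1 R (plane_pat Kj) z.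
  by rewrite inE => h; apply: generic_copies; apply: plane_generic.
have gen2 z : z \notin B2 -> generic g2 R (plane_pat Kj) z.
  rewrite inE negb_or => /andP[h1 h2]; apply: generic_removal => [w w' sw sw'|w sw].
    rewrite (plane_generic h1) //.
    have : (Bseq sw, Bseq sw') \in pat k = ((Bseq sw, Bseq sw') \in pat j) by rewrite pj pk.
    by rewrite !inE.
  exact: near_delP h2 sw.
pose Bd1 := [set u | (kap1 u).1 \in B1]; pose Bd2 := [set u | (kap2 u).1 \in B2].
have hbad : M * (#|Bd1| + #|Bd2| + 1) <= N.
  apply: leq_trans (instance_arith ha _ _ _ ec _); last 4 first.
  - by apply: leq_trans hb; rewrite /m0; lia.
  - by apply: leq_trans hb; rewrite /m0; lia.
  - by apply: leq_trans hb; rewrite /m0; lia.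
  - by apply: leq_trans hb; rewrite /m0; lia.
  rewrite leq_mul2l; apply/orP; right; rewrite leq_add2r; apply: leq_add.
    by apply: leq_trans (card_points k1B B1) _; rewrite leq_mul2r cB1 orbT.
  by apply: leq_trans (card_points k2B B2) _; rewrite leq_mul2r cB2 orbT.
have hgood u u' : u \notin Bd1 -> u' \notin Bd2 -> (kap1 u).2 = (kap2 u').2 ->
    good (onb g1 kap1 kinv1) (onb g2 kap2 kinv2) R [:: (u, u')].
  rewrite [u \in _]inE [u' \in _]inE => /gen1 h1 /gen2 h2 e.
  apply: (alike_good k1K k1K' k2K k2K' (generic_alike h1 h2) (rho := (kap1 u).2)).
    exact: surjective_pairing.
  by rewrite e; exact: surjective_pairing.
have hclass rho : #|[set u | (kap1 u).2 == rho]| * 22 = N.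
  by rewrite card_role // cQ1.
have hfar (kap : 'I_N -> Q2 * 'I_22) : bijective kap ->
    forall G : sgraph N, locally_gamma G 400 ->
    N <= 4002 * 2 * 22 * edit_distance (eG g2 kap) G.
  move=> kB G loc; set e := edit_distance _ _.
  have gemb i (x y : Q2) : @plane_gens Kk i (val x) = val y -> g2 i x = y.
    exact: return_permP.
  have lt : #|{: Q2}| < #|{: H}| by rewrite cQ2 cH ec; lia.
  have := edit_distance_large (@plane_gamma Kk) val_inj (@plane_transitive Kk) gemb kB loc lt.
  rewrite cQ2 cH -/e /N /n ec; move: leab n_gt0; move: (a * a) (b * b) e.
  by clear=> x y e; lia.
by exists (HardInstance k1K k1K' k2K k2K' (gamma_copies c (@plane_gamma Kj))
  (fun u => erefl (k0 u).2) hbad hgood hclass hfar).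
Qed.

(** * Tester lower bound *)

Section Property.
Variable s : nat.

Lemma F_free_iso (Fs : marked_graph -> Prop) n (G H : sgraph n) :
  isomorphic G H -> F_free Fs G -> F_free Fs H.
Proof.
move=> [h hB hE] free F FF [f [fI fE]]; apply: (free F FF).
case: hB => h' hK hK'.
have h'I : injective h' := can_inj hK'.
have nE u : nbhd1 G (h' u) = h' @: nbhd1 H u.
  apply/setP => w; rewrite -[in RHS](hK w) (mem_imset _ _ h'I) !inE hE hK'.
  by rewrite (can2_eq hK hK').
exists (h' \o f); split; first exact: inj_comp.
move=> v; have := fE v; rewrite /= nE.
have cE (A : {set 'I_(msize F)}) : (h' \o f) @: A = h' @: (f @: A).
  by rewrite -imset_comp.
case: (mark v) => [->|e|]; rewrite !cE //.
  by rewrite -(imsetI (in2W h'I)) e.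
exact: imsetS.
Qed.

Lemma gsf_degree n (G : sgraph n) : bounded_free 3 (forb s n) G -> max_degree_le 3 G.
Proof. by case. Qed.

Lemma gsf_iso n (G H : sgraph n) : isomorphic G H ->
  bounded_free 3 (forb s n) G -> bounded_free 3 (forb s n) H.
Proof.
move=> iso [dG fG]; split; last exact: F_free_iso fG.
case: iso => h hB hE v; case: (hB) => h' hK hK'.
apply: leq_trans (dG (h' v)); rewrite -(card_imset _ (can_inj hK')).
apply: subset_leq_card; apply/subsetP => _ /imsetP[u + ->].
by rewrite !inE hE !hK'.
Qed.

Definition gsf_property : property 3 :=
  @Property 3 (fun n => @bounded_free 3 (forb s n) n) gsf_degree gsf_iso.

Lemma gsf_property_local : GSF_local gsf_property.
Proof. by exists (forb s), s => n; split=> // F []. Qed.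

Lemma eG_mem (Q : finType) (g : gen -> {perm Q}) N (kap : 'I_N -> Q * 'I_22) :
  gamma g -> bijective kap -> gsf_property N (eG g kap).
Proof.
move=> gg kB; split; first exact: eG_degree.
by move=> F [_ h]; apply: h.
Qed.

Hypothesis s_ball : forall n (G : sgraph n) v, max_degree_le 3 G -> #|ball G v 401| <= s.

Lemma gsf_locally n (G : sgraph n) : gsf_property n G -> locally_gamma G 400.
Proof. by case=> dG fG; apply: forb_locally fG _ => v; apply: s_ball. Qed.

(** Closeness would bound the edit distance by 3 N / (4 (C + 1)), the 3 being the degree bound,
    whereas [hfar] requires N <= C e. The successor keeps the denominator nonzero. *)
Lemma instance_far (R : realType) C r M (I : hard_instance C r M) (eps : R)
    (kap : 'I_(hN I) -> hQ2 I * 'I_22) :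
  (0 < M)%N -> (eps <= 1 / (4 * C.+1%:R))%R -> bijective kap ->
  far_from 3 eps (eG (hg2 I) kap) (gsf_property (hN I)).
Proof.
move=> M0 le_eps kB [H mH le_e].
have := hfar kB (gsf_locally mH); set e := edit_distance _ _.
have N0 : (0 < hN I)%N.
  by apply: leq_trans (hbad I); rewrite muln_gt0 M0 addn1.
rewrite -(ler_nat R) natrM => far.
have c0 : (0 < C.+1%:R :> R)%R by rewrite ltr0n.
have n0 : (0 < (hN I)%:R :> R)%R by rewrite ltr0n.
have le2 : (e%:R <= 1 / (4 * C.+1%:R) * 3 * (hN I)%:R :> R)%R.
  apply: le_trans le_e _; rewrite ler_wpM2r // ?ler0n // ler_wpM2r //.
have le3 : (4 * C.+1%:R * e%:R <= 3 * (hN I)%:R :> R)%R.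
  have aux (c n : R) : (0 < c -> 3 * n = 4 * c * (1 / (4 * c) * 3 * n))%R.
    by move=> h; field; rewrite gt_eqF.
  by rewrite (aux _ ((hN I)%:R)%R c0) ler_wpM2l // mulr_ge0 // ltW.
have le4 : (C%:R * e%:R <= C.+1%:R * e%:R :> R)%R by rewrite ler_wpM2r ?ler0n // ler_nat.
move: far le3 le4 n0; rewrite -mulrA.
set x := (C%:R * e%:R)%R; set y := (C.+1%:R * e%:R)%R; clearbody x y; lra.
Qed.
End Property.

Section Truncation.
Variables (N d : nat).
(** The query bound of a tester concerns only oracles that represent graphs, while the counting
    needs a bound along every branch. Cutting the tree at depth [m] provides it without affecting
    the genuine runs. *)
Fixpoint truncate (m : nat) (A : query_alg N d) : query_alg N d :=
  match A with
  | Answer b => Answer _ _ b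
  | Query v i k => if m is m'.+1 then Query v i (fun a => truncate m' (k a))
                   else Answer _ _ false
  end.

Lemma truncate_depth m A : depth_le m (truncate m A).
Proof. by elim: A m => [b|v i k IH] [|m] //= a; apply: IH. Qed.

Lemma truncate_accepts m A nb : num_queries A nb <= m ->
  accepts (truncate m A) nb = accepts A nb.
Proof. by elim: A m => [b|v i k IH] [|m] //=; rewrite ltnS; apply: IH. Qed.
End Truncation.

Lemma good_nil N (nb1 nb2 : oracle N) r : good nb1 nb2 r [::].
Proof. by elim: r => [|r IH]; split. Qed.

Lemma avoid_arith q M a b1 b2 t f r n : a <= b1 + b2 + f -> M * (b1 + b2 + 1) <= n ->
  r * f.+1 + (2 * q).+1 <= M -> t <= 2 * q -> r * a <= n - t.
Proof.
move=> ca hb ml st.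
have h1 : r * a <= r * (b1 + b2 + f) by rewrite leq_mul2l ca orbT.
have h2 : (r * f.+1 + (2 * q).+1) * (b1 + b2 + 1) <= M * (b1 + b2 + 1).
  by rewrite leq_mul2r ml orbT.
nia.
Qed.

(** * Acceptance of the two graphs of a hard instance *)

Section Comparison.
Variables (C q M : nat) (I : hard_instance C q M).
Local Notation N := (hN I).
Local Notation nb1 := (onb (hg1 I) (@hk1 _ _ _ I) (@hi1 _ _ _ I)).
Local Notation nb2 := (onb (hg2 I) (@hk2 _ _ _ I) (@hi2 _ _ _ I)).
Local Notation G1 := (eG (hg1 I) (@hk1 _ _ _ I)).
Local Notation G2 := (eG (hg2 I) (@hk2 _ _ _ I)).

(** The total error [q / fresh_ratio] is below 1/4, less than the gap between 2/3 and 1/3. *)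
Definition fresh_ratio := 4 * q.+1.
(** At most [2 * q] revealed pairs reach [4 ^ q * (2 * q)] pairs, and each of these excludes a ball
    of at most [4 ^ q] vertices in either graph. *)
Definition fresh_size := 4 ^ q * (2 * q) * (2 * 4 ^ q).
Hypothesis M_large : fresh_ratio * fresh_size.+1 + (2 * q).+1 <= M.

Let k1B : bijective (@hk1 _ _ _ I) := Bijective (@hk1K _ _ _ I) (@hk1K' _ _ _ I).
Let k2B : bijective (@hk2 _ _ _ I) := Bijective (@hk2K _ _ _ I) (@hk2K' _ _ _ I).

Definition avoid (S : seq ('I_N * ('I_N * 'I_N))) : {set 'I_N} :=
  hB1 I :|: hB2 I :|: \bigcup_(p <- reach nb1 nb2 q [seq z.2 | z <- S])
     (ball G1 p.1 q :|: ball G2 p.2 q).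

Lemma card_bigcup_seq (T : finType) (J : eqType) (r : seq J) (F : J -> {set T}) c :
  (forall j, #|F j| <= c) -> #|\bigcup_(j <- r) F j| <= size r * c.
Proof.
move=> h; elim: r => [|j r IH]; first by rewrite big_nil cards0.
rewrite big_cons /= mulSn; apply: leq_trans (leq_card_setU _ _) _.
exact: leq_add.
Qed.

Lemma card_avoid S : size S <= 2 * q -> fresh_ratio * #|avoid S| <= N - size S.
Proof.
move=> sS; have cA : #|avoid S| <= #|hB1 I| + #|hB2 I| + fresh_size.
  apply: leq_trans (leq_card_setU _ _) _; apply: leq_add; first exact: leq_card_setU.
  apply: leq_trans (card_bigcup_seq _ (c := 2 * 4 ^ q) _) _.
    move=> p; apply: leq_trans (leq_card_setU _ _) _; rewrite mul2n -addnn.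
    by apply: leq_add; apply: card_ball; exact: eG_degree.
  rewrite /fresh_size leq_mul2r; apply/orP; right.
  apply: (leq_trans (size_reach nb2 q _ (size_onb _ _ _))).
  by rewrite size_map leq_mul2l sS orbT.
exact: avoid_arith cA (hbad I) M_large sS.
Qed.

Lemma ltqN : 2 * q < N.
Proof.
have hb := hbad I; apply: leq_trans hb; apply: leq_trans (_ : M <= _).
  by apply: leq_trans M_large; rewrite leq_addl.
by rewrite leq_pmulr // addn1.
Qed.

Lemma avoid_fresh m S y : m <= q -> okstate nb1 nb2 m S -> y \notin avoid S ->
  [/\ y \notin [seq z.2.1 | z <- S], y \notin [seq z.2.2 | z <- S] &
      good nb1 nb2 m ((y, y) :: [seq z.2 | z <- S])].
Proof.
move=> mq [_ _ _ gd]; rewrite !inE !negb_or -andbA => /and3P[y1 y2 yb].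
have far p : p \in reach nb1 nb2 q [seq z.2 | z <- S] ->
    y \notin ball G1 p.1 q /\ y \notin ball G2 p.2 q.
  move=> pr; apply/andP; rewrite -negb_or; apply: contra yb => h.
  by rewrite bigcup_seq; apply/bigcupP; exists p => //; rewrite inE.
split.
- apply/mapP => -[z zS ey]; have /far[] : z.2 \in reach nb1 nb2 q [seq z.2 | z <- S].
    by apply/reachS/map_f.
  by rewrite -ey ball_center.
- apply/mapP => -[z zS ey]; have /far[_] : z.2 \in reach nb1 nb2 q [seq z.2 | z <- S].
    by apply/reachS/map_f.
  by rewrite -ey ball_center.
rewrite -cat1s; apply: good_cat => //.
  by apply: good_le mq _; apply: hgood => //; exact: hrole.
move=> p p' /(reach_ball (onb_represents _ (@hk1K _ _ _ I) (@hk1K' _ _ _ I))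
  (onb_represents _ (@hk2K _ _ _ I) (@hk2K' _ _ _ I)))[b1 b2] /(reach_le mq)/far[f1 f2].
split; [apply: contra f1|apply: contra f2] => /eqP <-; apply/ball_sym;
 [exact: ball_le b1|exact: ball_le b2].
Qed.

Lemma compare_accept (A : query_alg N 3) : depth_le q A ->
  fresh_ratio * #|[set pi : 'S_N | accepts A (lab nb1 pi)]| <=
  fresh_ratio * #|[set pi : 'S_N | accepts A (lab nb2 pi)]| + q * N`!.
Proof.
move=> dA; have := @count_accept N nb1 nb2 fresh_ratio q avoid card_avoid avoid_fresh ltqN
  q A [::] dA (leqnn q).
rewrite subn0; apply => //; split=> //.
exact: good_nil.
Qed.

Lemma lab_represents1 pi : represents (lab nb1 pi) (eG (hg1 I) (@hk1 _ _ _ I \o pi^-1%g)).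
Proof.
have -> : lab nb1 pi = onb (hg1 I) (@hk1 _ _ _ I \o pi^-1%g) (pi \o @hi1 _ _ _ I).
  by apply: funext => l; rewrite /lab /onb -map_comp.
apply: onb_represents => z /=; first by rewrite hk1K permKV.
by rewrite permK hk1K'.
Qed.

Lemma lab_represents2 pi : represents (lab nb2 pi) (eG (hg2 I) (@hk2 _ _ _ I \o pi^-1%g)).
Proof.
have -> : lab nb2 pi = onb (hg2 I) (@hk2 _ _ _ I \o pi^-1%g) (pi \o @hi2 _ _ _ I).
  by apply: funext => l; rewrite /lab /onb -map_comp.
apply: onb_represents => z /=; first by rewrite hk2K permKV.
by rewrite permK hk2K'.
Qed.

Lemma lab_bij1 (pi : 'S_N) : bijective (@hk1 _ _ _ I \o pi^-1%g).
Proof. by apply: bij_comp k1B _; exists pi => z; rewrite ?permK ?permKV. Qed.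
Lemma lab_bij2 (pi : 'S_N) : bijective (@hk2 _ _ _ I \o pi^-1%g).
Proof. by apply: bij_comp k2B _; exists pi => z; rewrite ?permK ?permKV. Qed.

End Comparison.

Section NotTestable.
Variables (R : realType) (s C : nat).
Hypothesis s_ball : forall n (G : sgraph n) v, max_degree_le 3 G -> #|ball G v 401| <= s.
Hypothesis inst : forall r M : nat, exists _ : hard_instance C r M, True.
Local Open Scope ring_scope.

(** The tester has to succeed on every relabelling, hence on average. Exchanging the sums over
    relabellings and random choices reduces the claim to deterministic algorithms, as in Yao's
    principle. *)
Lemma gsf_not_testable : ~ testable R (gsf_property s).
Proof.
case=> qf test; pose eps : R := 1 / (4 * C.+1%:R).
have eps0 : 0 < eps by rewrite divr_gt0 // mulr_gt0 ?ltr0n.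
pose q := qf eps; pose M := (fresh_ratio q * (fresh_size q).+1 + (2 * q).+1)%N.
have [I _] := inst q M.
have [T [[acc rej] qb]] := test (hN I) eps eps0.
set N := hN I in T acc rej qb.
pose nb1 := onb (hg1 I) (@hk1 _ _ _ I) (@hi1 _ _ _ I).
pose nb2 := onb (hg2 I) (@hk2 _ _ _ I) (@hi2 _ _ _ I).
pose a1 (w : sample T) := #|[set pi : 'S_N | accepts (alg w) (lab nb1 pi)]|.
pose a2 (w : sample T) := #|[set pi : 'S_N | accepts (alg w) (lab nb2 pi)]|.
have cmp w : (fresh_ratio q * a1 w <= fresh_ratio q * a2 w + q * N`!)%N.
  have := compare_accept (leqnn M) (truncate_depth q (alg w)).
  congr (_ * _ <= _ * _ + _)%N; apply: eq_card => pi; rewrite !inE truncate_accepts //.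
    by apply: (qb w _ _ (lab_represents1 pi)); apply: eG_degree; exact: lab_bij1.
  by apply: (qb w _ _ (lab_represents2 pi)); apply: eG_degree; exact: lab_bij2.
have cS : (#|{: 'S_N}| = N`!)%N by rewrite -card_Sn; apply: eq_card.
have sumE (nb : oracle N) : \sum_(pi : 'S_N) accept_prob T (lab nb pi) =
    \sum_(w : sample T) prob w * #|[set pi : 'S_N | accepts (alg w) (lab nb pi)]|%:R.
  have -> : \sum_(pi : 'S_N) accept_prob T (lab nb pi) = \sum_(pi : 'S_N)
      \sum_(w : sample T) (if accepts (alg w) (lab nb pi) then prob w else 0).
    by apply: eq_bigr => pi _; rewrite /accept_prob big_mkcond.
  rewrite exchange_big /=; apply: eq_bigr => w _.
  rewrite -sum1_card natr_sum mulr_sumr [RHS]big_mkcond; apply: eq_bigr => pi _.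
  by rewrite inE mulr1.
have rejE nb : reject_prob T nb = 1 - accept_prob T nb.
  rewrite /reject_prob /accept_prob -(prob_sum1 T).
  by rewrite [X in _ = X - _](bigID (fun w => accepts (alg w) nb)) /= addrAC subrr add0r.
have s1 : 2 / 3 * N`!%:R <= \sum_w prob w * (a1 w)%:R.
  rewrite -sumE -cS -sum1_card natr_sum mulr_sumr; apply: ler_sum => pi _; rewrite mulr1.
  by apply: (acc _ _ (lab_represents1 pi)); apply: eG_mem (hgamma I) (lab_bij1 pi).
have s2 : \sum_w prob w * (a2 w)%:R <= 1 / 3 * N`!%:R.
  rewrite -sumE -cS -sum1_card natr_sum mulr_sumr; apply: ler_sum => pi _; rewrite mulr1.
  have : 2 / 3 <= reject_prob T (lab nb2 pi).
    apply: (rej _ _ (lab_represents2 pi)); first by apply: eG_degree; exact: lab_bij2.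
    by apply: (instance_far s_ball) (lab_bij2 pi) => //; rewrite /M addnS.
  rewrite rejE; lra.
have s3 : (fresh_ratio q)%:R * \sum_w prob w * (a1 w)%:R <=
    (fresh_ratio q)%:R * \sum_w prob w * (a2 w)%:R + q%:R * N`!%:R.
  have -> : q%:R * N`!%:R = \sum_(w : sample T) prob w * (q%:R * N`!%:R) :> R.
    by rewrite -mulr_suml prob_sum1 mul1r.
  rewrite !mulr_sumr -big_split /=; apply: ler_sum => w _.
  rewrite ![_ * (prob w * _)]mulrCA -mulrDr; apply: ler_wpM2l; first exact: prob_ge0.
  by rewrite -!natrM -natrD ler_nat cmp.
have f0 : 0 < (N`!%:R : R) by rewrite ltr0n fact_gt0.
have r0 : 0 <= ((fresh_ratio q)%:R : R) by rewrite ler0n.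
have s1' := ler_wpM2l r0 s1; have s2' := ler_wpM2l r0 s2.
have eD : (fresh_ratio q)%:R = 4 * q%:R + 4 :> R.
  by rewrite /fresh_ratio mulnS natrD natrM addrC.
have : (fresh_ratio q)%:R * (2 / 3 * N`!%:R) <=
    (fresh_ratio q)%:R * (1 / 3 * N`!%:R) + q%:R * N`!%:R :> R.
  by apply: le_trans s1' _; apply: le_trans s3 _; rewrite lerD2r.
rewrite eD; have q0 : 0 <= (q%:R : R) by rewrite ler0n.
have := mulr_ge0 q0 (ltW f0); move: (N`!%:R) (q%:R : R) f0 q0 => F Q f0 q0 QF.
nra.
Qed.
End NotTestable.

(** * Propagation *)

Lemma zip_ex2 (T1 T2 : eqType) (s1 : seq T1) (s2 : seq T2) y : size s1 = size s2 ->
  y \in s2 -> exists x, (x, y) \in zip s1 s2.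
Proof.
elim: s1 s2 => [|x s1 IH] [|z s2] //= [e]; rewrite inE => /orP[/eqP ->|/(IH _ e)[x' h]].
  by exists x; rewrite mem_head.
by exists x'; rewrite inE h orbT.
Qed.

Lemma zip_ex1 (T1 T2 : eqType) (s1 : seq T1) (s2 : seq T2) x : size s1 = size s2 ->
  x \in s1 -> exists y, (x, y) \in zip s1 s2.
Proof.
elim: s1 s2 => [|z s1 IH] [|y s2] //= [e]; rewrite inE => /orP[/eqP ->|/(IH _ e)[y' h]].
  by exists y; rewrite mem_head.
by exists y'; rewrite inE h orbT.
Qed.

(** * Transferring embeddings between graphs that look alike *)

Section Lifting.
Variables (N : nat) (nb1 nb2 : oracle N) (G1 G2 : sgraph N).
Hypotheses (rep1 : represents nb1 G1) (rep2 : represents nb2 G2).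

Lemma good_reach r t S : good nb1 nb2 (t + r) S -> good nb1 nb2 r (reach nb1 nb2 t S).
Proof.
elim: t S => [|t IH] S; first by [].
rewrite /reach iterSr => -[_ [_ h]].
exact: IH h.
Qed.

Lemma reach_walk2 r t S p z : good nb1 nb2 (t + r) S -> p \in reach nb1 nb2 t S ->
  z \in ball G2 p.2 r -> exists x, (x, z) \in reach nb1 nb2 (t + r) S.
Proof.
elim: r z => [|r IH] z gd pr.
  by rewrite inE addn0 => /eqP ->; exists p.1; rewrite -surjective_pairing.
rewrite [ball _ _ _]/= => /setUP[zb|/bigcupP[w wb]].
  have [|x h] := IH z _ pr zb; first by apply: good_le gd; lia.
  by exists x; apply: reach_le h; lia.
have [|x h] := IH w _ pr wb; first by apply: good_le gd; lia.
rewrite inE => wz.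
have [_ [sz _]] : good nb1 nb2 1 (reach nb1 nb2 (t + r) S).
  by apply: good_reach; rewrite -addnA addn1.
have [|y yz] := zip_ex2 (sz _ h) (_ : z \in nb2 (x, w).2).
  by rewrite /= (mem_nb2 rep2).
exists y; rewrite addnS; apply/spreadP; right; by exists (x, w).
Qed.

(** Since the matching extends to neighbours, [G1] and [G2] agree on the edges and on the non-edges
    between paired vertices, as semifull vertices require; paired neighbour lists of equal size
    handle the full ones. *)
Lemma embedding_transfer (F : marked_graph) (f h : 'I_(msize F) -> 'I_N) S :
  good nb1 nb2 1 S -> (forall v, (h v, f v) \in S) ->
  embedding (F := F) G2 f -> embedding (F := F) G1 h.
Proof.
move=> [mS [sz [msp _]]] hS [fI fE].
have hI : injective h.
  move=> v w e; apply: fI; apply/eqP.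
  by rewrite -(mS (h v, f v) (h w, f w)) //= e.
have hsp v : (h v, f v) \in spread nb1 nb2 S by apply: mem_spread.
have fw v w : (h w, f w) \in zip (nb1 (h v)) (nb2 (f v)) \/ ~~ G2 (f v) (f w) /\ ~~ G1 (h v) (h w).
  case: (boolP (G2 (f v) (f w))) => g2.
    left; have [|x xz] := zip_ex2 (sz _ (hS v)) (_ : f w \in nb2 (h v, f v).2).
      by rewrite /= (mem_nb2 rep2).
    have xsp : (x, f w) \in spread nb1 nb2 S by apply/spreadP; right; exists (h v, f v).
    have := msp (x, f w) (h w, f w) xsp (hsp w); rewrite /= eqxx => /eqP e.
    by rewrite -e.
  case: (boolP (G1 (h v) (h w))) => g1; last by right.
  left; have [|y yz] := zip_ex1 (sz _ (hS v)) (_ : h w \in nb1 (h v, f v).1).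
    by rewrite /= (mem_nb1 rep1).
  have ysp : (h w, y) \in spread nb1 nb2 S by apply/spreadP; right; exists (h v, f v).
  have := msp (h w, y) (h w, f w) ysp (hsp w); rewrite /= eqxx => /esym/eqP e.
  by rewrite -e.
have adj v w : G1 (h v) (h w) = G2 (f v) (f w).
  case: (fw v w) => [/mem_zip_proj[]|[/negPf -> /negPf ->]] //.
  by rewrite /= (mem_nb1 rep1) (mem_nb2 rep2) => -> ->.
have n1 v w : (h w \in nbhd1 G1 (h v)) = (f w \in nbhd1 G2 (f v)).
  by rewrite !inE adj (inj_eq hI) (inj_eq fI).
split=> // v; have := fE v; case: (mark v) => e.
- apply/eqP; rewrite eqEsubset; apply/andP; split; last first.
    apply/subsetP => _ /imsetP[w wF ->]; rewrite n1 e; exact: imset_f.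
  apply/subsetP => x; rewrite in_setU1 => /orP[/eqP ->|].
    by apply: imset_f; rewrite !inE eqxx.
  rewrite inE => xv; have [|y xy] := zip_ex1 (sz _ (hS v)) (_ : x \in nb1 (h v, f v).1).
    by rewrite /= (mem_nb1 rep1).
  have : y \in nbhd1 G2 (f v).
    by case/mem_zip_proj: (xy) => _; rewrite /= (mem_nb2 rep2) !inE => ->; rewrite orbT.
  rewrite e => /imsetP[w wF ey]; apply/imsetP; exists w => //; apply/eqP.
  have xsp : (x, y) \in spread nb1 nb2 S by apply/spreadP; right; exists (h v, f v).
  by rewrite (msp (x, y) (h w, f w) xsp (hsp w)) /= ey.
- apply/setP => x; rewrite inE; apply/andP/imsetP.
    case=> xv /imsetP[w _ ex]; exists w => //; rewrite ex n1 in xv.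
    have : f w \in f @: nbhd1 F v by rewrite -e inE xv imset_f ?inE.
    by rewrite (mem_imset _ _ fI).
  case=> w wF ->; split; last by rewrite imset_f ?inE.
  have : f w \in f @: nbhd1 F v by rewrite imset_f.
  by rewrite -e n1 inE => /andP[].
apply/subsetP => _ /imsetP[w wF ->]; rewrite n1; apply: (subsetP e); exact: imset_f.
Qed.
End Lifting.

Lemma fresh_arith M a b1 b2 x c n : a <= b1 + x -> M * (b1 + b2 + 1) <= n ->
  22 * (x + 1) <= M -> c * 22 = n -> a < c.
Proof.
move=> ca hb ml e.
have : 22 * (x + 1) * (b1 + b2 + 1) <= M * (b1 + b2 + 1) by rewrite leq_mul2r ml orbT.
nia.
Qed.

Section Cover.
Variables (C R M : nat) (I : hard_instance C R M).
Local Notation N := (hN I).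
Local Notation nb1 := (onb (hg1 I) (@hk1 _ _ _ I) (@hi1 _ _ _ I)).
Local Notation nb2 := (onb (hg2 I) (@hk2 _ _ _ I) (@hi2 _ _ _ I)).
Local Notation G1 := (eG (hg1 I) (@hk1 _ _ _ I)).
Local Notation G2 := (eG (hg2 I) (@hk2 _ _ _ I)).

Let k1B : bijective (@hk1 _ _ _ I) := Bijective (@hk1K _ _ _ I) (@hk1K' _ _ _ I).
Let rep1 : represents nb1 G1 := onb_represents _ (@hk1K _ _ _ I) (@hk1K' _ _ _ I).
Let rep2 : represents nb2 G2 := onb_represents _ (@hk2K _ _ _ I) (@hk2K' _ _ _ I).

Fixpoint lift_size (m : nat) : nat :=
  if m is m'.+1 then 4 ^ R * lift_size m' + 1 else 0.

Lemma lift_size_mono m : lift_size m <= lift_size m.+1.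
Proof.
rewrite /=; apply: leq_trans (leq_addr _ _); rewrite leq_pmull // expn_gt0 //.
Qed.

Lemma fresh_vertex (r t : nat) S rho : r <= R -> size S <= t ->
  22 * (4 ^ R * t * 4 ^ R + 1) <= M ->
  exists u, [/\ (@hk1 _ _ _ I u).2 = rho, u \notin hB1 I &
    forall p, p \in reach nb1 nb2 r S -> u \notin ball G1 p.1 r].
Proof.
move=> rR sS ML; pose A := hB1 I :|: \bigcup_(p <- reach nb1 nb2 r S) ball G1 p.1 r.
have cA : #|A| <= #|hB1 I| + 4 ^ R * t * 4 ^ R.
  apply: leq_trans (leq_card_setU _ _) _; rewrite leq_add2l.
  apply: leq_trans (card_bigcup_seq _ (c := 4 ^ R) _) _.
    move=> p; apply: leq_trans (card_ball _ _ (eG_degree _ k1B)) _.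
    by rewrite leq_exp2l.
  rewrite leq_mul2r; apply/orP; right.
  apply: (leq_trans (size_reach nb2 _ _ (size_onb _ _ _))).
  by apply: leq_mul => //; rewrite leq_exp2l.
have lt : #|A| < #|[set u | (@hk1 _ _ _ I u).2 == rho]|.
  exact: fresh_arith cA (hbad I) ML (hclass I rho).
have : ~~ ([set u | (@hk1 _ _ _ I u).2 == rho] \subset A).
  by apply: contraL lt => /subset_leq_card; rewrite -leqNgt.
case/subsetPn => u; rewrite inE => /eqP ur; rewrite inE negb_or => /andP[u1 u2].
exists u; split=> // p pr; apply: contra u2 => h.
by rewrite bigcup_seq; apply/bigcupP; exists p.
Qed.

(** The marked graph may be disconnected, so its vertices are lifted one at a time. If [v] lies
    within [2 * r] of what is lifted, the walk to it lifts and radius [r] remains; otherwise a fresh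
    partner far away is chosen. Either way [3 * r] is consumed to keep [r], hence the powers of
    3. *)
Lemma lift_vertices (vs : seq 'I_N) r : 22 * (4 ^ R * lift_size (size vs) * 4 ^ R + 1) <= M ->
  all (fun v => v \notin hB2 I) vs -> 3 ^ size vs * r <= R ->
  exists S, [/\ good nb1 nb2 r S, size S <= lift_size (size vs) &
    forall v, v \in vs -> exists u, (u, v) \in S].
Proof.
elim: vs r => [|v vs IH] r /= ML; first by move=> _ _; exists [::]; split=> //; exact: good_nil.
move=> /andP[vB vsB] rR.
have [|||S [gd sS hS]] := IH (3 * r).
- apply: leq_trans ML; rewrite leq_mul2l /= leq_add2r leq_mul2r leq_mul2l.
  by have := lift_size_mono (size vs); rewrite /= => ->; rewrite !orbT.
- exact: vsB.
- by rewrite mulnA -expnSr.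
have r3 : r <= 3 * r by lia.
have rR' : 3 * r <= R.
  by apply: leq_trans rR; rewrite expnSr -mulnA leq_pmull // expn_gt0.
case: (pselect (exists u, (u, v) \in reach nb1 nb2 (2 * r) S)) => [[u uv]|no].
  exists (reach nb1 nb2 (2 * r) S); split.
  - by apply: good_reach; rewrite (_ : 2 * r + r = 3 * r) //; lia.
  - apply: (leq_trans (size_reach nb2 _ _ (size_onb _ _ _))).
    apply: leq_trans (leq_addr _ _); apply: leq_mul => //.
    by rewrite leq_exp2l //; lia.
  move=> w; rewrite inE => /orP[/eqP ->|/hS[u' h]]; first by exists u.
  by exists u'; apply: reachS.
have [||u [ur uB uf]] := @fresh_vertex r (lift_size (size vs)) S (@hk2 _ _ _ I v).2 _ sS.
- by lia.
- apply: leq_trans ML; rewrite leq_mul2l /= leq_add2r leq_mul2r leq_mul2l.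
  by have := lift_size_mono (size vs); rewrite /= => ->; rewrite !orbT.
exists ((u, v) :: S); split.
- rewrite -cat1s; apply: good_cat.
  + by apply: (@good_le _ _ _ r R); [lia|apply: hgood].
  + exact: good_le r3 gd.
  move=> p p' /(reach_ball rep1 rep2)[b1 b2] p'S; split.
    apply: contra (uf _ p'S) => /eqP <-; exact: ball_sym.
  apply/negP => /eqP e; apply: no.
  have [||x h] := @reach_walk2 _ nb1 nb2 G2 rep2 r r S p' v _ p'S.
  - by apply: good_le gd; lia.
  - by rewrite -e; apply: ball_sym.
  by exists x; rewrite mul2n -addnn.
- by rewrite /= addn1 ltnS; apply: leq_trans sS _; rewrite leq_pmull // expn_gt0.
move=> w; rewrite inE => /orP[/eqP ->|/hS[u' h]]; first by exists u; rewrite mem_head.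
by exists u'; rewrite inE h orbT.
Qed.

(** [F] is an arbitrary small marked graph, so the bad vertices cover the forbidden configurations
    of every family defining the property, not only of [forb]. *)
Lemma bad_covers (F : marked_graph) f (k : nat) : msize F <= k ->
  22 * (4 ^ R * lift_size k * 4 ^ R + 1) <= M -> 3 ^ k <= R ->
  embedding (F := F) G2 f -> (forall v, f v \notin hB2 I) ->
  exists h, embedding (F := F) G1 h.
Proof.
move=> mk ML kR fE fB; pose vs := [seq f v | v <- enum 'I_(msize F)].
have svs : size vs = msize F by rewrite size_map size_enum_ord.
have mono a b : a <= b -> lift_size a <= lift_size b.
  move=> /subnK <-; elim: (b - a) => // c IH; apply: leq_trans IH _.
  exact: lift_size_mono.
have [|||S [gd _ hS]] := @lift_vertices vs 1.
- apply: leq_trans ML; rewrite leq_mul2l /= leq_add2r leq_mul2r leq_mul2l.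
  by rewrite svs mono ?orbT.
- by apply/allP => _ /mapP[v _ ->].
- by rewrite muln1 svs; apply: leq_trans kR; rewrite leq_exp2l.
have ex v : exists u, (u, f v) \in S by apply: hS; apply: map_f; rewrite mem_enum.
pose h v := xchoose (ex v).
exists h; apply: (embedding_transfer rep1 rep2 gd _ fE) => v.
exact: (xchooseP (ex v)).
Qed.
End Cover.

Section Propagating.
Variables (R : realType) (s C : nat).
Hypothesis s_ball : forall n (G : sgraph n) v, max_degree_le 3 G -> #|ball G v 401| <= s.
Hypothesis inst : forall r M : nat, exists _ : hard_instance C r M, True.
Local Open Scope ring_scope.

Lemma gsf_propagating : ~ non_propagating R (gsf_property s).
Proof.
case=> Fs [k loc] [tau [tau01 tau_mono tau_small tau_close]].
pose eps : R := 1 / (4 * C.+1%:R).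
have eps0 : 0 < eps by rewrite divr_gt0 // mulr_gt0 ?ltr0n.
have [beta /andP[b0 b1] tb] := tau_small eps eps0.
pose r := (3 ^ k)%N.
have [m mb] : exists m : nat, beta^-1 < m%:R.
  by exists (Num.bound beta^-1); apply: archi_boundP; rewrite invr_ge0 ltW.
(* The summand [m] exceeds the inverse of [beta], so that the covering set has density at most
   [beta]. *)
pose M := (22 * (4 ^ r * lift_size r k * 4 ^ r + 1) + m)%N.
have [I _] := inst r M.
pose G1 := eG (hg1 I) (@hk1 _ _ _ I); pose G2 := eG (hg2 I) (@hk2 _ _ _ I).
have k1B : bijective (@hk1 _ _ _ I) by exists (@hi1 _ _ _ I); [exact: hk1K|exact: hk1K'].
have k2B : bijective (@hk2 _ _ _ I) by exists (@hi2 _ _ _ I); [exact: hk2K|exact: hk2K'].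
have M0 : (0 < M)%N by rewrite /M addn_gt0 muln_gt0 addn1.
have hb := hbad I.
have N0 : (0 < hN I)%N by apply: leq_trans hb; rewrite muln_gt0 M0 addn1.
pose x0 : 'I_(hN I) := Ordinal N0.
(* The point [x0] makes the cover nonempty, so its density lies in the domain of [tau]; the [+ 1] in
   [hbad] accounts for it. *)
pose B := x0 |: hB2 I.
have memG1 : bounded_free 3 (Fs (hN I)) G1.
  by apply/(loc (hN I)).2; apply: eG_mem (hgamma I) k1B.
have cov : covers B (Fs (hN I)) G2.
  move=> F FF f fE; apply: contrapT => no.
  have fB v : f v \notin hB2 I.
    by apply/negP => h; apply: no; exists v; rewrite inE h orbT.
  have [h hE] : exists h, embedding (F := F) G1 h.
    apply: (@bad_covers C r M I F f k) => //; first exact: (loc (hN I)).1 F FF.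
    by rewrite /M leq_addr.
  by case: memG1 => _ /(_ F FF); apply; exists h.
have B0 : B != set0 by apply/set0Pn; exists x0; rewrite !inE eqxx.
have cB : (M * #|B| <= hN I)%N.
  apply: leq_trans hb; rewrite leq_mul2l cardsU1 addnC; apply/orP; right.
  by apply: leq_add; rewrite ?leq_addl //; case: (_ \in _).
have xb : #|B|%:R / (hN I)%:R <= beta :> R.
  rewrite ler_pdivrMr ?ltr0n //.
  have h1 : (M%:R * #|B|%:R <= (hN I)%:R :> R) by rewrite -natrM ler_nat.
  have h2 : beta^-1 <= M%:R :> R.
    by apply: le_trans (ltW mb) _; rewrite ler_nat /M leq_addl.
  have h3 : beta^-1 * #|B|%:R <= (hN I)%:R :> R.
    by apply: le_trans h1; rewrite ler_wpM2r.
  by have := ler_wpM2l (ltW b0) h3; rewrite mulrA mulfV ?gt_eqF // mul1r.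
have x0' : 0 < #|B|%:R / (hN I)%:R :> R.
  by rewrite divr_gt0 ?ltr0n // card_gt0.
have le_eps : tau (#|B|%:R / (hN I)%:R) <= 1 / (4 * C.+1%:R).
  by apply: le_trans (ltW tb); apply: tau_mono.
case: (tau_close _ G2 B (eG_degree _ k2B) B0 cov) => [cl|]; last by apply; exists G1.
apply: (instance_far s_ball M0 le_eps k2B).
by case: cl => H /(loc (hN I)).2 mH le; exists H.
Qed.
End Propagating.

Theorem theorem7p6 (R : realType) :
  (exists P : property 3, GSF_local P /\ ~ testable R P) /\
  ~ (forall (d : nat) (P : property d), GSF_local P -> non_propagating R P).
Proof.
have [C inst] := hard_instance_exists.
have [s s_ball] : exists s, forall n (G : sgraph n) v, max_degree_le 3 G -> #|ball G v 401| <= s.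
  (* Decoding uses radius 400, and the outer sphere adds one. *)
  by exists (4 ^ 401) => n G v; apply: card_ball.
split; first by exists (gsf_property s); split; [exact: gsf_property_local|exact: gsf_not_testable inst].
move=> h; apply: (@gsf_propagating R s C s_ball inst).
by apply: h; exact: gsf_property_local.
Qed.
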